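(* Let $J\in L_2(\mathbb{R})\cap C(\mathbb{R})$ satisfy: (H1) $J\ge0$; (H2) $\int_{-\infty}^{\infty}J(x)\,dx=1$; (H3) $J(x)=J(-x)$ for all $x\in\mathbb{R}$; (H4) $J$ is decreasing on $(0,\infty)$; (H5) $\hat J(\xi)\ge 0$ for all $\xi$; (H6) $\frac{d}{d\xi}\hat J(\xi)\le 0$ for $\xi\ge0$. Then there exist constants $C_1(h)$ (depending on $h$), $C_2$, and $C_3(\sigma)$ (depending on $\sigma$) such that, whenever $h,\Delta t>0$ are such that the explicit scheme $$U_j^{n+1}=U_j^n-\Delta t\,U_j^n+\Delta t\,\frac{U_{j+1}^n-U_{j-1}^n}{2h}+\Delta t\,\frac{U_{j+1}^n-2U_j^n+U_{j-1}^n}{h^2}+h\,\Delta t\sum_{k=-\infty}^{\infty}J(x_j-x_k)(U_k^n-U_j^n),\quad U^0_j=u_0(x_j),$$ is a stable approximation of the initial value problem $$u_t(x,t)=-u+u_x+u_{xx}+\int_{-\infty}^{\infty}J(x-y)\,(u(y,t)-u(x,t))\,dy,\qquad u(x,0)=u_0(x),\ x\in\mathbb{R},$$ one has, for all $n\ge 0$ and $t_n=n\Delta t$, $$\|u(\cdot,t_n)-\mathcal{S}U^n\|\le t_n C_1(h)\|u_0\|+C_2\,h\,\|u_0\|_{H^2(\mathbb{R})}+C_3(\sigma)\,h^{\sigma}\|u_0\|_{H^{\sigma}(\mathbb{R})}$$ for any $u_0\in H^{\sigma}(\mathbb{R})$ with $\sigma>\frac12$.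
   Context: Grid points are $x_j=jh$, $j\in\mathbb{Z}$. The continuous Fourier transform is $\hat v(\xi)=\frac{1}{\sqrt{2\pi}}\int_{-\infty}^{\infty}e^{-ix\xi}v(x)\,dx$. For a grid function $v=(v_m)$, the discrete Fourier transform is $\tilde v(\xi)=\frac{h}{\sqrt{2\pi}}\sum_{m}e^{-ihm\xi}v_m$, $\xi\in[-\pi/h,\pi/h]$ (applied to $J$ via its grid values $J(x_m)$). $\|\cdot\|$ is the $L_2(\mathbb{R})$ norm and $\|v\|_{H^s(\mathbb{R})}^2=\int(1+\xi^2)^s|\hat v(\xi)|^2d\xi$ (the right-hand side of the estimate is understood as $+\infty$ if $u_0\notin H^2(\mathbb{R})$). The exact solution $u$ is the one given by $\hat u(\xi,t)=e^{\hat q(\xi)t}\hat u_0(\xi)$ with $\hat q(\xi)=\sqrt{2\pi}(\hat J(\xi)-\hat J(0))-1-\xi^2+i\xi$. In the discrete Fourier domain the scheme reads $\tilde U^{n}(\xi)=g(h\xi,\Delta t)^n\,\tilde U^0(\xi)$ with $$g(h\xi,\Delta t)=1-\Delta t+\sqrt{2\pi}\,\Delta t\,(\tilde J(\xi)-\tilde J(0))-\frac{4\Delta t}{h^2}\sin^2\frac{h\xi}{2}+\frac{i\Delta t}{h}\sin(h\xi),$$ and the scheme is called stable (for given $h,\Delta t$) if $|g(h\xi,\Delta t)|\le1$ for all $\xi\in[-\pi/h,\pi/h]$. $\mathcal{S}U^n$ is the Fourier interpolant of $U^n$: $\mathcal{S}U^n(x)=\frac{1}{\sqrt{2\pi}}\int_{-\pi/h}^{\pi/h}e^{ix\xi}\,\tilde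 U^n(\xi)\,d\xi$. The constants may depend on $J$; apart from this, only the indicated dependences are allowed (so the constants do not depend on $u_0$, $n$, $\Delta t$, and $C_2$, $C_3(\sigma)$ do not depend on $h$). *)

(* Defs.v *)
From HB Require Import structures.
From mathcomp Require Import all_boot all_order all_algebra.
From mathcomp Require Import complex.
From mathcomp Require Import all_classical all_reals all_analysis.
Set Implicit Arguments.
Unset Strict Implicit.
Unset Printing Implicit Defensive.
Import Order.TTheory GRing.Theory Num.Theory.
Import numFieldNormedType.Exports.
Local Open Scope classical_set_scope.
Local Open Scope ring_scope.
Local Open Scope complex_scope.

Section Complex.
Context {R : realType}.
Implicit Types (f : R -> R[i]) (D : set R).

Definition cmod (z : R[i]) : R := complex.Re `|z|.

Definition expi (x : R) : R[i] := cos x +i* sin x.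

Definition cexp (z : R[i]) : R[i] :=
  (expR (complex.Re z))%:C * expi (complex.Im z).

Definition Cintegral D f : R[i] :=
  (\int[lebesgue_measure]_(x in D) complex.Re (f x)) +i*
  (\int[lebesgue_measure]_(x in D) complex.Im (f x)).

Definition L2norm D f : \bar R :=
  'N[lebesgue_measure]_2%:E[(fun x => (cmod (f x))%:E) \_ D]%E.

Definition in_L2 D f : Prop :=
  [/\ measurable_fun D (fun x => complex.Re (f x)),
      measurable_fun D (fun x => complex.Im (f x)) &
      (L2norm D f < +oo)%E].

(* Sums over the integers are limits of symmetric partial sums, taken on real
   and imaginary parts separately. *)
Definition psumZ (F : int -> R[i]) (N : nat) : R[i] :=
  \sum_(k < (2 * N).+1) F (k%:Z - N%:Z).

Definition sumZ (F : int -> R[i]) : R[i] :=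
  limn (fun N => complex.Re (psumZ F N)) +i*
  limn (fun N => complex.Im (psumZ F N)).

End Complex.

Section Fourier.
Context {R : realType}.
Implicit Types (v w : R -> R[i]).

Definition fourier_on (D : set R) v (xi : R) : R[i] :=
  (Num.sqrt (2 * pi))^-1%:C * Cintegral D (fun x => expi (- (x * xi)) * v x).

(* Pointwise transform, meant for integrable functions. *)
Definition fourier_int v : R -> R[i] := fourier_on setT v.

(* The transform of a general element of L2(R), whose defining integral need
   not converge: the L2 limit of the transforms of its truncations. *)
Definition is_fourier v w : Prop :=
  [/\ in_L2 setT v, in_L2 setT w &
      L2norm setT (fun xi => w xi - fourier_on `[- N%:R, N%:R] v xi)
        @[N --> \oo] --> 0%E].

(* A chosen representative: is_fourier determines it almost everywhere. *)
Definition fourier v : R -> R[i] := xget (fun=> 0) [set w | is_fourier v w].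

Definition weighted_norm (s : R) w : \bar R :=
  ((\int[lebesgue_measure]_xi ((1 + xi ^+ 2) `^ s * cmod (w xi) ^+ 2)%:E)
     `^ 2^-1)%E.

Definition sobolev_norm (s : R) v : \bar R := weighted_norm s (fourier v).

Definition in_sobolev (s : R) v : Prop :=
  exists2 w, is_fourier v w & (weighted_norm s w < +oo)%E.

End Fourier.

Section Grid.
Context {R : realType}.
Implicit Types (h dt : R) (V : int -> R[i]) (J : R -> R).

Definition grid h (j : int) : R := j%:~R * h.

Definition freq_cell h : set R := `[- (pi / h), pi / h].

Definition dft_term h V (xi : R) (m : int) : R[i] :=
  expi (- (h * m%:~R * xi)) * V m.

Definition dft_const h : R[i] := (h / Num.sqrt (2 * pi))%:C.

(* Pointwise transform, meant for absolutely summable grid functions. *)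
Definition dft_pt h V (xi : R) : R[i] := dft_const h * sumZ (dft_term h V xi).

(* The transform of a square-summable grid function, whose Fourier series
   converges in L2 of the frequency cell but not necessarily pointwise. *)
Definition is_dft h V (w : R -> R[i]) : Prop :=
  in_L2 (freq_cell h) w /\
  L2norm (freq_cell h)
    (fun xi => w xi - dft_const h * psumZ (dft_term h V xi) N)
    @[N --> \oo] --> 0%E.

Definition dft h V : R -> R[i] := xget (fun=> 0) [set w | is_dft h V w].

Definition interpolant h V (x : R) : R[i] :=
  (Num.sqrt (2 * pi))^-1%:C *
  Cintegral (freq_cell h) (fun xi => expi (x * xi) * dft h V xi).

Definition kernel_hat J : R -> R[i] := fourier_int (fun x => (J x)%:C).

Definition kernel_dft J h : R -> R[i] := dft_pt h (fun m => (J (grid h m))%:C).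

Definition scheme_step J h dt V (j : int) : R[i] :=
  V j - dt%:C * V j
  + dt%:C * ((V (j + 1) - V (j - 1)) / (2 * h)%:C)
  + dt%:C * ((V (j + 1) - 2 * V j + V (j - 1)) / (h ^+ 2)%:C)
  + (h * dt)%:C *
    sumZ (fun k => (J (grid h j - grid h k))%:C * (V k - V j)).

Fixpoint scheme J h dt (u0 : R -> R[i]) (n : nat) : int -> R[i] :=
  if n is m.+1 then scheme_step J h dt (scheme J h dt u0 m)
  else fun j => u0 (grid h j).

Definition amplification J h dt (xi : R) : R[i] :=
  1 - dt%:C
  + (Num.sqrt (2 * pi) * dt)%:C * (kernel_dft J h xi - kernel_dft J h 0)
  - (4 * dt / h ^+ 2 * sin (h * xi / 2) ^+ 2)%:C
  + (0 +i* (dt / h * sin (h * xi))).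

Definition stable J h dt : Prop :=
  forall xi, xi \in freq_cell h -> `|amplification J h dt xi| <= 1.

Definition symbol J (xi : R) : R[i] :=
  (Num.sqrt (2 * pi))%:C * (kernel_hat J xi - kernel_hat J 0)
  - 1 - (xi ^+ 2)%:C + (0 +i* xi).

(* u x t is the solution of u_t = -u + u_x + u_xx + \int J(x-y)(u(y)-u(x))dy
   with datum u0, given through the transforms of its time slices; each time
   slice is thereby fixed up to a null set. *)
Definition exact_solution J (u0 : R -> R[i]) (u : R -> R -> R[i]) : Prop :=
  forall t, 0 <= t ->
    is_fourier (u^~ t) (fun xi => cexp (symbol J xi * t%:C) * fourier u0 xi).

End Grid.

(* Main.v *)
Require Import Defs.
From HB Require Import structures.
From mathcomp Require Import all_boot all_order all_algebra.
From mathcomp Require Import complex.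
From mathcomp Require Import all_classical all_reals all_analysis.
From mathcomp Require Import measurable_realfun zify ring lra.
Set Implicit Arguments.
Unset Strict Implicit.
Unset Printing Implicit Defensive.
Import Order.TTheory GRing.Theory Num.Theory.
Import numFieldNormedType.Exports.
Local Open Scope classical_set_scope.
Local Open Scope ring_scope.
Local Open Scope complex_scope.

(** The estimate is proved in frequency space.  Write w for the transform of the
    datum u0, q for the symbol, g for the amplification factor and C for the
    frequency cell [-pi/h, pi/h].

    The grid values u0(mh) are the Fourier coefficients on C of the periodization
    p of w, the sum of the translates w(x + 2 pi k / h) ([fourier_inversion] and
    [coef_aliased]).  One step of the scheme multiplies the function on C whose
    coefficients are the grid values by g ([scheme_step_coef]), so the interpolant
    of U^n is the inverse transform of g^n p, cut off outside C ([is_dft_coef],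
    [interpolantE]).  The exact solution has transform e^{q t} w.  By Plancherel
    the error is therefore controlled by two integrals ([energy_error]).

    On C, write e^{q t} w - g^n p = (e^{q t} - g^n) w - g^n (p - w).  Stability
    gives |g| <= 1, and Re q <= 0 because the kernel is nonnegative, so
    |e^{q n dt} - g^n| <= n |e^{q dt} - g|; both e^{q dt} and g are within a
    multiple of dt of 1, the factor depending on h only, because q and the
    generator of the scheme are bounded on C.  This is the term t_n C1(h)|u0|
    ([propagator_error]).  The aliasing error p - w is at most a constant times
    h^sigma times the H^sigma norm ([energy_aliased]): by Cauchy-Schwarz over the
    translates, against the weights (1 + x^2)^sigma, whose inverses are summable
    over the translates exactly when sigma > 1/2.

    Outside C, |e^{q t}| <= 1 and |x| > pi/h, so h^{2 sigma} (1 + x^2)^sigma >= 1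
    and the remaining mass of w is at most h^{2 sigma} times the squared H^sigma
    norm ([high_freq]).

    The transform of an element of L2 is only given as a limit of transforms of
    truncations, and a grid function as a limit of trigonometric sums, so
    completeness of the trigonometric system on C ([vanish_resid]) and Plancherel
    are established along the way.  Plancherel for a compactly supported v is
    Parseval for the modulations of v, averaged over a period
    ([plancherel_compact]); the inverse direction follows by duality, that is by
    Fubini ([duality]).  All inequalities are between energies, the squares of L2
    norms, with the quasi-triangle inequality |a + b|^2 <= 2|a|^2 + 2|b|^2 in
    place of Minkowski's. *)

(** * Complex moduli and exponentials *)

Section ComplexPlane.
Context {R : realType}.
Implicit Types (z w : R[i]) (x y : R).

Definition sqn z : R := complex.Re z ^+ 2 + complex.Im z ^+ 2.
Definition cdot z w : R :=
  complex.Re z * complex.Re w + complex.Im z * complex.Im w.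

Lemma cReM z w : complex.Re (z * w) =
  complex.Re z * complex.Re w - complex.Im z * complex.Im w.
Proof. by case: z; case: w. Qed.
Lemma cImM z w : complex.Im (z * w) =
  complex.Re z * complex.Im w + complex.Im z * complex.Re w.
Proof. by case: z; case: w. Qed.
Lemma cReD z w : complex.Re (z + w) = complex.Re z + complex.Re w.
Proof. by case: z; case: w. Qed.
Lemma cImD z w : complex.Im (z + w) = complex.Im z + complex.Im w.
Proof. by case: z; case: w. Qed.
Lemma cReN z : complex.Re (- z) = - complex.Re z. Proof. by case: z. Qed.
Lemma cImN z : complex.Im (- z) = - complex.Im z. Proof. by case: z. Qed.
Definition cReImE := (cReM, cImM, cReD, cImD, cReN, cImN).

Lemma complexP z w :
  complex.Re z = complex.Re w -> complex.Im z = complex.Im w -> z = w.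
Proof. by case: z => a b; case: w => c d /= -> ->. Qed.

Lemma cRe_sum I (r : seq I) (P : pred I) (F : I -> R[i]) :
  complex.Re (\sum_(i <- r | P i) F i) = \sum_(i <- r | P i) complex.Re (F i).
Proof. by apply: (big_morph (@complex.Re R)) => //; exact: cReD. Qed.
Lemma cIm_sum I (r : seq I) (P : pred I) (F : I -> R[i]) :
  complex.Im (\sum_(i <- r | P i) F i) = \sum_(i <- r | P i) complex.Im (F i).
Proof. by apply: (big_morph (@complex.Im R)) => //; exact: cImD. Qed.

Lemma sqn_ge0 z : 0 <= sqn z.
Proof. by rewrite addr_ge0 ?sqr_ge0. Qed.
Lemma sqnM z w : sqn (z * w) = sqn z * sqn w.
Proof. rewrite /sqn !cReImE; ring. Qed.
Lemma sqnX z n : sqn (z ^+ n) = sqn z ^+ n.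
Proof.
elim: n => [|n IH]; last by rewrite !exprS sqnM IH.
by rewrite !expr0 /sqn /= expr1n expr0n /= addr0.
Qed.
Lemma sqnN z : sqn (- z) = sqn z.
Proof. rewrite /sqn !cReImE; ring. Qed.
Lemma sqn0 : sqn 0 = 0.
Proof. by rewrite /sqn /= expr0n /= addr0. Qed.
Lemma sqnR x : sqn x%:C = x ^+ 2.
Proof. rewrite /sqn /=; ring. Qed.
Lemma sqnB z w : sqn (z - w) = sqn z + sqn w - 2 * cdot z w.
Proof. rewrite /sqn /cdot !cReImE; ring. Qed.
Lemma sqnD_le z w : sqn (z + w) <= 2 * sqn z + 2 * sqn w.
Proof.
rewrite -subr_ge0.
suff -> : 2 * sqn z + 2 * sqn w - sqn (z + w) = sqn (z - w) by exact: sqn_ge0.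
rewrite /sqn !cReImE; ring.
Qed.
Lemma sqnB_le z w : sqn (z - w) <= 2 * sqn z + 2 * sqn w.
Proof. by rewrite -(sqnN w) sqnD_le. Qed.
Lemma cmodE z : cmod z = Num.sqrt (sqn z).
Proof. by case: z. Qed.
Lemma cmod_ge0 z : 0 <= cmod z. Proof. by rewrite cmodE sqrtr_ge0. Qed.
Lemma cmod_sqr z : cmod z ^+ 2 = sqn z.
Proof. by rewrite cmodE sqr_sqrtr ?sqn_ge0. Qed.
Lemma cmodM z w : cmod (z * w) = cmod z * cmod w.
Proof. by rewrite !cmodE sqnM sqrtrM ?sqn_ge0. Qed.
Lemma cmodN z : cmod (- z) = cmod z.
Proof. by rewrite !cmodE sqnN. Qed.
Lemma cmodR x : cmod x%:C = `|x|.
Proof. by rewrite cmodE sqnR sqrtr_sqr. Qed.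
Lemma cmod1 : cmod (1 : R[i]) = 1.
Proof. by rewrite (cmodR 1) normr1. Qed.
Lemma norm_cmodE z : `|z| = (cmod z)%:C.
Proof. by case: z. Qed.
Lemma cmodD z w : cmod (z + w) <= cmod z + cmod w.
Proof.
have := ler_normD z w; rewrite !norm_cmodE -rmorphD /= lecR; exact.
Qed.
Lemma cmodB z w : cmod (z - w) <= cmod z + cmod w.
Proof. by rewrite -(cmodN w) cmodD. Qed.
Lemma ler_Re_cmod z : `|complex.Re z| <= cmod z.
Proof.
by rewrite cmodE -sqrtr_sqr ler_wsqrtr // /sqn lerDl sqr_ge0.
Qed.
Lemma ler_Im_cmod z : `|complex.Im z| <= cmod z.
Proof.
by rewrite cmodE -sqrtr_sqr ler_wsqrtr // /sqn lerDr sqr_ge0.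
Qed.
Lemma cmod_leD z : cmod z <= `|complex.Re z| + `|complex.Im z|.
Proof.
rewrite -(@ler_pXn2r _ 2) ?nnegrE ?addr_ge0 ?cmod_ge0 ?normr_ge0 //.
rewrite cmod_sqr /sqn -(real_normK (num_real (complex.Re z))).
rewrite -(real_normK (num_real (complex.Im z))) sqrrD.
by rewrite lerD2r lerDl mulrn_wge0 ?mulr_ge0.
Qed.
Lemma cmod_sum I (r : seq I) (P : pred I) (F : I -> R[i]) :
  cmod (\sum_(i <- r | P i) F i) <= \sum_(i <- r | P i) cmod (F i).
Proof.
elim/big_ind2: _ => [|z1 x1 z2 x2 h1 h2|//]; first by rewrite cmodE sqn0 sqrtr0.
by rewrite (le_trans (cmodD _ _)) ?lerD.
Qed.
Lemma sqn_eq0 z : sqn z = 0 -> z = 0.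
Proof.
move/eqP; rewrite /sqn paddr_eq0 ?sqr_ge0 // !sqrf_eq0 => /andP[/eqP a /eqP b].
exact: complexP.
Qed.

Lemma sqn_expi x : sqn (expi x) = 1.
Proof. by rewrite /sqn /= cos2Dsin2. Qed.
Lemma cmod_expi x : cmod (expi x) = 1.
Proof. by rewrite cmodE sqn_expi sqrtr1. Qed.
Lemma expiD x y : expi (x + y) = expi x * expi y.
Proof. by apply: complexP; rewrite !cReImE /= (sinD, cosD) // addrC. Qed.
Lemma expi0 : expi (0 : R) = 1.
Proof. by rewrite /expi cos0 sin0. Qed.
Lemma expiNK x : expi (- x) * expi x = 1.
Proof. by rewrite -expiD addNr expi0. Qed.
Lemma expi2pi (m : int) : expi (m%:~R * (2 * pi) : R) = 1.
Proof.
suff H (n : nat) : expi (n%:R * (2 * pi) : R) = 1.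
  case: m => n; first exact: H.
  rewrite NegzE mulrNz mulNr.
  by have := expiNK (n.+1%:R * (2 * pi)); rewrite H mulr1.
rewrite mulrC mulr_natr.
elim: n => [|n IH]; first by rewrite mulr0n expi0.
rewrite mulrS expiD IH mulr1 /expi mulrC mulr_natr cos2pi sin2pi //.
Qed.

Lemma cdotE z w : cdot z w = complex.Re (z * conjc w).
Proof. by case: z; case: w => a b c d; rewrite /cdot /= mulrN opprK. Qed.

(** The telescoping bound behind Lax's argument: two contractions that differ
    by d in one step differ by at most n d after n steps. *)
Lemma cmod_subXn z w n : cmod z <= 1 -> cmod w <= 1 ->
  cmod (z ^+ n - w ^+ n) <= n%:R * cmod (z - w).
Proof.
move=> hz hw.
have hX (v : R[i]) m : cmod v <= 1 -> cmod (v ^+ m) <= 1.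
  move=> hv; elim: m => [|m IH]; first by rewrite expr0 cmod1.
  by rewrite exprS cmodM mulr_ile1 ?cmod_ge0.
rewrite subrXX cmodM mulrC ler_wpM2r ?cmod_ge0 //.
rewrite (le_trans (cmod_sum _ _ _)) // -[leRHS]mulr_natl mulr1.
rewrite -[in leRHS](card_ord n) -sumr_const ler_sum // => i _.
by rewrite cmodM mulr_ile1 ?cmod_ge0 ?hX.
Qed.

Lemma lipschitz_of_deriv (f df : R -> R) x y :
  (forall t : R, is_derive t 1 f (df t)) -> (forall t, `|df t| <= 1) ->
  `|f x - f y| <= `|x - y|.
Proof.
move=> fdf hd; wlog yx : x y / y <= x.
  move=> H; have [/H//|/ltW/H] := leP y x.
  by rewrite distrC (distrC y).
have cf : {within `[y, x], continuous f}.
  apply: continuous_subspaceT => t.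
  apply: differentiable_continuous; apply/derivable1_diffP.
  exact: (@ex_derive _ _ _ _ _ _ _ (fdf t)).
have [c _ ->] := MVT_segment yx (fun t _ => fdf t) cf.
by rewrite normrM ler_piMl.
Qed.

Lemma sin_lip x y : `|sin x - sin y| <= `|x - y|.
Proof. by apply: (@lipschitz_of_deriv sin cos) => // z; exact: cos_max. Qed.
Lemma cos_lip x y : `|cos x - cos y| <= `|x - y|.
Proof.
apply: (@lipschitz_of_deriv cos (fun t => - sin t)) => // z.
by rewrite normrN; exact: sin_max.
Qed.

Lemma cmod_cexp z : cmod (cexp z) = expR (complex.Re z).
Proof. by rewrite cmodM cmodR cmod_expi mulr1 ger0_norm ?expR_ge0. Qed.

Lemma cexpMn z n : cexp (z * n%:R%:C) = cexp z ^+ n.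
Proof.
elim: n => [|n IH].
  by rewrite mulr0 expr0 /cexp /= expR0 expi0 mulr1.
rewrite exprS -IH /cexp !cReImE /= !mulr0 !subr0 !add0r -natr1 !mulrDr !mulr1.
by rewrite expRD expiD rmorphM /=; ring.
Qed.

(** In the left half plane the derivative of the exponential has modulus at
    most 1; bounding real and imaginary parts separately costs the factor 3. *)
Lemma cmod_cexpB1 z : complex.Re z <= 0 -> cmod (cexp z - 1) <= 3 * cmod z.
Proof.
move=> z0; set a := complex.Re z; set b := complex.Im z.
have ha := ler_Re_cmod z; have hb := ler_Im_cmod z.
have e1 : expR a <= 1 by rewrite -expR0 ler_expR.
have e0 := expR_ge0 a; have ea := expR_ge1Dx a.
have hc := cos_lip b 0; have hs := sin_lip b 0.
rewrite cos0 sin0 !subr0 in hc hs.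
rewrite (le_trans (cmod_leD _)) // !cReImE /= -/a -/b oppr0 addr0 !mul0r subr0 addr0.
have h1 : `|expR a * cos b - 1| <= `|cos b - 1| + `|a|.
  have -> : expR a * cos b - 1 = expR a * (cos b - 1) + (expR a - 1) by ring.
  rewrite (le_trans (ler_normD _ _)) // lerD //.
    by rewrite normrM ger0_norm // ler_piMl.
  rewrite ler_norml; rewrite (ler0_norm z0); apply/andP; split; rewrite -/a; lra.
have h2 : `|expR a * sin b| <= `|sin b|.
  by rewrite normrM (ger0_norm e0) ler_piMl.
lra.
Qed.

End ComplexPlane.

(** * Square integrals *)

Section Measurability.
Context {R : realType}.
Implicit Types (f g : R -> R[i]) (D : set R).

Definition cmeas D f : Prop :=
  measurable_fun D (fun x => complex.Re (f x)) /\
  measurable_fun D (fun x => complex.Im (f x)).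

Lemma cmeas_eq D f g : {in D, f =1 g} -> cmeas D f -> cmeas D g.
Proof.
move=> fg [h1 h2]; split.
  by apply: eq_measurable_fun h1 => x xD; rewrite fg.
by apply: eq_measurable_fun h2 => x xD; rewrite fg.
Qed.
Lemma cmeasS D E f : measurable D -> E `<=` D -> cmeas D f -> cmeas E f.
Proof. by move=> mD ED [h1 h2]; split; exact: measurable_funS ED _. Qed.
Lemma cmeas_cst D (z : R[i]) : cmeas D (fun=> z).
Proof. by split; exact: measurable_cst. Qed.
Lemma cmeasD D f g : cmeas D f -> cmeas D g -> cmeas D (fun x => f x + g x).
Proof.
move=> [a b] [c d]; split.
  under eq_fun do rewrite cReD; exact: measurable_funD.
under eq_fun do rewrite cImD; exact: measurable_funD.
Qed.
Lemma cmeasN D f : cmeas D f -> cmeas D (fun x => - f x).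
Proof.
move=> [a b]; split.
  by under eq_fun do rewrite cReN; apply: measurableT_comp.
by under eq_fun do rewrite cImN; apply: measurableT_comp.
Qed.
Lemma cmeasB D f g : cmeas D f -> cmeas D g -> cmeas D (fun x => f x - g x).
Proof. by move=> hf hg; apply: cmeasD => //; exact: cmeasN. Qed.
Lemma cmeasM D f g : cmeas D f -> cmeas D g -> cmeas D (fun x => f x * g x).
Proof.
move=> [a b] [c d]; split.
  by under eq_fun do rewrite cReM; apply: measurable_funB; apply: measurable_funM.
by under eq_fun do rewrite cImM; apply: measurable_funD; apply: measurable_funM.
Qed.
Lemma cmeas_real D (r : R -> R) : measurable_fun D r -> cmeas D (fun x => (r x)%:C).
Proof. by move=> mr; split => //=; exact: measurable_cst. Qed.
Lemma measurable_cos_comp d (T : measurableType d) (E : set T) (r : T -> R) :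
  measurable_fun E r -> measurable_fun E (fun x => cos (r x)).
Proof.
apply: (@measurableT_comp _ _ _ _ _ _ (@cos R)).
by apply: continuous_measurable_fun; exact: continuous_cos.
Qed.
Lemma measurable_sin_comp d (T : measurableType d) (E : set T) (r : T -> R) :
  measurable_fun E r -> measurable_fun E (fun x => sin (r x)).
Proof.
apply: (@measurableT_comp _ _ _ _ _ _ (@sin R)).
by apply: continuous_measurable_fun; exact: continuous_sin.
Qed.
Lemma cmeas_expi D (r : R -> R) : measurable_fun D r -> cmeas D (fun x => expi (r x)).
Proof. by move=> mr; split; [exact: measurable_cos_comp|exact: measurable_sin_comp]. Qed.
Lemma cmeas_sum D I (s : seq I) (F : I -> R -> R[i]) :
  (forall i, cmeas D (F i)) -> cmeas D (fun x => \sum_(i <- s) F i x).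
Proof.
move=> mF; elim: s => [|i s IH].
  by under eq_fun do rewrite big_nil; exact: cmeas_cst.
by under eq_fun do rewrite big_cons; exact: cmeasD.
Qed.
Lemma cmeasX D f n : cmeas D f -> cmeas D (fun x => f x ^+ n).
Proof.
move=> mf; elim: n => [|n IH].
  by under eq_fun do rewrite expr0; exact: cmeas_cst.
by under eq_fun do rewrite exprS; exact: cmeasM.
Qed.
Lemma continuous_cmeas D f : continuous (fun x => complex.Re (f x)) ->
  continuous (fun x => complex.Im (f x)) -> cmeas D f.
Proof.
by move=> cr ci; split; apply: measurable_funTS; exact: continuous_measurable_fun.
Qed.
Lemma measurable_sqn D f : cmeas D f -> measurable_fun D (fun x => sqn (f x)).
Proof. by move=> [a b]; apply: measurable_funD; exact: measurable_funX. Qed.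
Lemma measurable_cmod D f : cmeas D f -> measurable_fun D (fun x => cmod (f x)).
Proof.
move=> mf; under eq_fun do rewrite cmodE.
apply: (@measurableT_comp _ _ _ _ _ _ (@Num.sqrt R)) => //.
  by apply: continuous_measurable_fun; exact: sqrt_continuous.
exact: measurable_sqn.
Qed.
End Measurability.

Section Energy.
Context {R : realType}.
Notation mu := (@lebesgue_measure R).
Implicit Types (f g : R -> R[i]) (D : set R).

Lemma ae_imp (P Q : R -> Prop) : (forall x, P x -> Q x) ->
  {ae mu, forall x, P x} -> {ae mu, forall x, Q x}.
Proof.
move=> PQ [A [mA A0 sA]]; exists A; split => //.
by apply: subset_trans sA => x /= nQ p; apply: nQ; exact: PQ.
Qed.
(** The square of the L2 norm; its inequalities are those of an integral of a
    nonnegative function and involve no roots. *)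
Definition energy D f : \bar R := (\int[mu]_(x in D) (sqn (f x))%:E)%E.

Lemma energy_ge0 D f : (0 <= energy D f)%E.
Proof. by apply: integral_ge0 => x _; rewrite lee_fin sqn_ge0. Qed.
Hint Resolve energy_ge0 : core.

Lemma measurable_esqn D f : cmeas D f -> measurable_fun D (fun x => (sqn (f x))%:E).
Proof. by move=> mf; apply/measurable_EFinP; exact: measurable_sqn. Qed.

Lemma energyE D f : measurable D -> L2norm D f = (energy D f `^ 2^-1)%E.
Proof.
move=> mD; rewrite /L2norm unlock /energy; congr (_ `^ _)%E.
rewrite [RHS]integral_mkcond; apply: eq_integral => x _.
rewrite /patch; case: ifP => _; last by rewrite abse0 poweR0r.
by rewrite /= -cmod_sqr powR_mulrn ?normr_ge0 // ger0_norm ?cmod_ge0.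
Qed.

Lemma in_L2P D f : measurable D -> in_L2 D f <-> cmeas D f /\ (energy D f < +oo)%E.
Proof.
move=> mD; rewrite /in_L2 energyE //; split.
  by move=> [a b c]; split => //; exact: lty_poweRy c.
by move=> [[a b] c]; split => //; exact: poweR_lty.
Qed.

Lemma le_energy D f g : measurable D -> cmeas D f -> cmeas D g ->
  (forall x, D x -> sqn (f x) <= sqn (g x)) -> (energy D f <= energy D g)%E.
Proof.
move=> mD mf mg fg; apply: ge0_le_integral => //.
- by move=> x _; rewrite lee_fin sqn_ge0.
- exact: measurable_esqn.
- exact: measurable_esqn.
Qed.

Lemma eq_energy D f g : (forall x, D x -> f x = g x) -> energy D f = energy D g.
Proof. by move=> fg; apply: eq_integral => x /set_mem Dx; rewrite fg. Qed.

(** The parallelogram inequality replaces the triangle inequality: constants are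
    lost, but no square root appears. *)
Lemma energyD_le D f g : measurable D -> cmeas D f -> cmeas D g ->
  (energy D (fun x => f x + g x)%R <= 2%:E * energy D f + 2%:E * energy D g)%E.
Proof.
move=> mD mf mg.
have e h : cmeas D h ->
    (2%:E * energy D h = \int[mu]_(x in D) (2 * sqn (h x))%:E)%E.
  move=> mh; rewrite /energy -ge0_integralZl_EFin //.
    by move=> x _; rewrite lee_fin sqn_ge0.
  exact: measurable_esqn.
have m2 h : cmeas D h -> measurable_fun D (fun x => (2 * sqn (h x))%:E).
  move=> mh; apply/measurable_EFinP; apply: measurable_funM => //.
  exact: measurable_sqn.
have p2 h x : D x -> (0 <= (2 * sqn (h x))%:E)%E.
  by move=> _; rewrite lee_fin mulr_ge0 ?sqn_ge0.
rewrite !e // -ge0_integralD //; [|exact: p2|exact: m2|exact: p2|exact: m2].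
apply: ge0_le_integral => //.
- by move=> x _; rewrite lee_fin sqn_ge0.
- by apply: measurable_esqn; exact: cmeasD.
- by apply: emeasurable_funD; exact: m2.
- by move=> x _; rewrite -EFinD lee_fin sqnD_le.
Qed.

Lemma energyN D f : energy D (fun x => - f x) = energy D f.
Proof. by apply: eq_integral => x _; rewrite sqnN. Qed.

Lemma energyB_le D f g : measurable D -> cmeas D f -> cmeas D g ->
  (energy D (fun x => f x - g x)%R <= 2%:E * energy D f + 2%:E * energy D g)%E.
Proof.
move=> mD mf mg; rewrite -(energyN D g).
by apply: energyD_le => //; exact: cmeasN.
Qed.

Lemma energyBC D f g :
  energy D (fun x => f x - g x) = energy D (fun x => g x - f x).
Proof. by rewrite -energyN; apply: eq_integral => x _; rewrite opprB. Qed.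

Lemma energy_triangle D f g h : measurable D ->
  cmeas D f -> cmeas D g -> cmeas D h ->
  (energy D (fun x => f x - h x)%R <=
   2%:E * energy D (fun x => f x - g x)%R + 2%:E * energy D (fun x => g x - h x)%R)%E.
Proof.
move=> mD mf mg mh.
rewrite (_ : energy D (fun x => f x - h x) =
             energy D (fun x => (f x - g x) + (g x - h x))); last first.
  by apply: eq_integral => x _; rewrite addrA subrK.
by apply: energyD_le => //; exact: cmeasB.
Qed.

Lemma energyZ D f (z : R[i]) : measurable D -> cmeas D f ->
  energy D (fun x => z * f x) = ((sqn z)%:E * energy D f)%E.
Proof.
move=> mD mf; rewrite /energy -ge0_integralZl_EFin ?sqn_ge0 //.
- by apply: eq_integral => x _; rewrite sqnM EFinM.
- by move=> x _; rewrite lee_fin sqn_ge0.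
- exact: measurable_esqn.
Qed.

Lemma subset_energy D E f : measurable D -> measurable E -> cmeas E f ->
  D `<=` E -> (energy D f <= energy E f)%E.
Proof.
move=> mD mE mf DE; apply: ge0_subset_integral => //.
  exact: measurable_esqn.
by move=> x _; rewrite lee_fin sqn_ge0.
Qed.

Definition cutoff D f x : R[i] := if x \in D then f x else 0.

Lemma cmeas_cut D E f : measurable D -> measurable E -> D `<=` E ->
  cmeas D f -> cmeas E (cutoff D f).
Proof.
move=> mD mE DE [a b]; split.
  rewrite (_ : (fun x => _) = (fun x => complex.Re (f x)) \_ D); last first.
    by apply/funext => x; rewrite /cutoff /patch; case: ifP.
  apply: (measurable_funS measurableT (@subsetT _ E)).
  by apply/(measurable_restrictT _ mD).
rewrite (_ : (fun x => _) = (fun x => complex.Im (f x)) \_ D); last first.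
  by apply/funext => x; rewrite /cutoff /patch; case: ifP.
apply: (measurable_funS measurableT (@subsetT _ E)).
by apply/(measurable_restrictT _ mD).
Qed.

Lemma energy_cut D E f : measurable D -> measurable E -> D `<=` E ->
  energy E (cutoff D f) = energy D f.
Proof.
move=> mD mE DE; rewrite /energy [LHS]integral_mkcond [RHS]integral_mkcond.
apply: eq_integral => x _; rewrite /patch /cutoff.
case: (boolP (x \in D)) => xD; last by rewrite sqn0 if_same.
by rewrite (_ : x \in E) //; apply/mem_set/DE/set_mem.
Qed.

Lemma energy_setU D E f : measurable D -> measurable E -> [disjoint D & E] ->
  cmeas (D `|` E) f -> energy (D `|` E) f = (energy D f + energy E f)%E.
Proof.
move=> mD mE DE mf; rewrite /energy ge0_integral_setU //.
  exact: measurable_esqn.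
by move=> x _; rewrite lee_fin sqn_ge0.
Qed.

Lemma energy0_ae D f : measurable D -> cmeas D f -> energy D f = 0%E ->
  {ae mu, forall x, D x -> f x = 0}.
Proof.
move=> mD mf e0.
have := (ae_eq_integral_abs mu mD (measurable_esqn mf)).1.
move=> H; have {H} : ae_eq mu D (fun x => (sqn (f x))%:E) (cst 0%E).
  apply: H; rewrite -[RHS]e0; apply: eq_integral => x _.
  by rewrite gee0_abs // lee_fin sqn_ge0.
apply: ae_imp => x /= h Dx; apply: sqn_eq0; have [] := h Dx; exact.
Qed.

(** Convergence to 0 phrased by upper bounds alone, so that infinite values need
    no separate treatment; see [L2norm_cvg0] for the link with L2 norms. *)
Definition vanish (a : nat -> \bar R) : Prop :=
  forall e : R, 0 < e -> \forall N \near \oo, (a N <= e%:E)%E.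

Lemma vanishP (a : nat -> \bar R) : (forall n, 0 <= a n)%E ->
  vanish a <-> a n @[n --> \oo] --> 0%E.
Proof.
move=> a0; split => [va|ca].
  apply/fine_cvgP; split.
    near=> n; rewrite ge0_fin_numE //; apply: (@le_lt_trans _ _ 1%:E); last exact: ltry.
    by near: n; exact: va.
  apply/cvgrPdist_le => e e0; near=> n.
  rewrite sub0r normrN ger0_norm ?fine_ge0 //.
  have h : (a n <= e%:E)%E by near: n; exact: va.
  rewrite -lee_fin fineK // ge0_fin_numE //.
  by apply: (le_lt_trans h); exact: ltry.
move=> e e0; have /fine_cvgP[h1 /cvgrPdist_le/(_ _ e0) h2] := ca.
near=> n.
have f1 : a n \is a fin_num by near: n.
rewrite -(fineK f1) lee_fin -[leLHS]ger0_norm ?fine_ge0 // -normrN -sub0r.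
by near: n.
Unshelve. all: by end_near. Qed.

Lemma cvg0_vanish (a : nat -> \bar R) : (forall n, 0 <= a n)%E ->
  a n @[n --> \oo] --> 0%E -> vanish a.
Proof. by move=> a0 h; have [_] := vanishP a0; apply. Qed.

Lemma vanish_le (a b : nat -> \bar R) :
  (\forall n \near \oo, (b n <= a n)%E) -> vanish a -> vanish b.
Proof.
move=> ba va e e0; near=> n; apply: (@le_trans _ _ (a n)).
  by near: n.
by near: n; exact: va.
Unshelve. all: by end_near. Qed.

Lemma vanishD (a b : nat -> \bar R) :
  vanish a -> vanish b -> vanish (fun n => a n + b n)%E.
Proof.
move=> va vb e e0; have e2 : 0 < e / 2 by rewrite divr_gt0.
near=> n.
rewrite (splitr e) EFinD; apply: leeD.
  by near: n; exact: va.
by near: n; exact: vb.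
Unshelve. all: by end_near. Qed.

Lemma vanishZ (a : nat -> \bar R) (k : R) : 0 <= k ->
  vanish a -> vanish (fun n => k%:E * a n)%E.
Proof.
move=> k0 va e e0; have k1 : 0 < k + 1 by rewrite ltr_wpDl.
have ek : 0 < e / (k + 1) by rewrite divr_gt0.
near=> n.
apply: (@le_trans _ _ (k%:E * (e / (k + 1))%:E)%E).
  apply: lee_wpmul2l; first by rewrite lee_fin.
  by near: n; exact: va.
rewrite -EFinM lee_fin mulrCA; apply: ler_piMr; first exact: ltW.
by rewrite ler_pdivrMr // mul1r lerDl.
Unshelve. all: by end_near. Qed.

Lemma vanish_squeeze (x : \bar R) (a : nat -> \bar R) :
  (forall n, x <= a n)%E -> vanish a -> (x <= 0)%E.
Proof.
move=> xa va; apply/lee_addgt0Pr => e e0.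
have [N _ /(_ N (leqnn N)) h] := va _ e0.
by rewrite add0e; exact: le_trans h.
Qed.

Lemma L2norm_cvg0 D (f : nat -> R -> R[i]) : measurable D ->
  L2norm D (f N) @[N --> \oo] --> 0%E <-> vanish (fun N => energy D (f N)).
Proof.
move=> mD.
have -> : (fun N => L2norm D (f N)) = (fun N => (energy D (f N) `^ 2^-1)%E).
  by apply/funext => N; rewrite energyE.
have h a (e : R) : (0 <= a)%E -> 0 <= e ->
    (a `^ 2^-1 <= e%:E)%E = (a <= (e ^+ 2)%:E)%E.
  case: a => [r||] //; rewrite ?lee_fin => r0 e0.
  - rewrite ?poweR_EFin /= ?lee_fin powR12_sqrt //.
    by rewrite -[in LHS](ger0_norm e0) -sqrtr_sqr ler_sqrt // sqr_ge0.
  - by rewrite poweRyr // invr_eq0.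
split => [/vanishP H e e0|H].
  have {}H := H (fun n => poweR_ge0 _ _).
  have s0 : 0 < Num.sqrt e by rewrite sqrtr_gt0.
  near=> N; rewrite -(@sqr_sqrtr _ e) ?(ltW e0) // -h ?sqrtr_ge0 //.
  by near: N; exact: H.
apply/vanishP => [n|e e0]; first exact: poweR_ge0.
have e2 : 0 < e ^+ 2 by rewrite exprn_gt0.
by near=> N; rewrite h ?(ltW e0) //; near: N; exact: H.
Unshelve. all: by end_near. Qed.

End Energy.
#[global] Hint Resolve energy_ge0 : core.

(** * Integrals of complex functions *)

Section ComplexIntegral.
Context {R : realType}.
Notation mu := (@lebesgue_measure R).
Implicit Types (f g : R -> R[i]) (D : set R).

Lemma integrableD_R D (u v : R -> R) : measurable D ->
  mu.-integrable D (EFin \o u) -> mu.-integrable D (EFin \o v) ->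
  mu.-integrable D (EFin \o (fun x => u x + v x)).
Proof.
move=> mD iu iv; have := @integrableD _ _ _ mu _ _ _ _ iu iv.
by move=> /(_ mD); apply: eq_integrable.
Qed.

Lemma integrableZ_R D (u : R -> R) (k : R) : measurable D ->
  mu.-integrable D (EFin \o u) -> mu.-integrable D (EFin \o (fun x => k * u x)).
Proof.
move=> mD iu; have := @integrableZl _ _ _ mu _ _ k _ iu.
by move=> /(_ mD); apply: eq_integrable.
Qed.

Lemma le_integrable_R D (u k : R -> R) : measurable D -> measurable_fun D u ->
  mu.-integrable D (EFin \o k) -> (forall x, D x -> `|u x| <= k x) ->
  mu.-integrable D (EFin \o u).
Proof.
move=> mD mu' ik uk; apply: le_integrable ik => //; first exact/measurable_EFinP.
by move=> x Dx; rewrite /= lee_fin (le_trans (uk _ Dx)) // ler_norm.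
Qed.

Lemma eq_integrable_R D (u v : R -> R) : measurable D -> (forall x, D x -> u x = v x) ->
  mu.-integrable D (EFin \o u) -> mu.-integrable D (EFin \o v).
Proof.
by move=> mD uv; apply: eq_integrable => // x /set_mem Dx; rewrite /= uv.
Qed.

Lemma integrable_cst_R D (c : R) : measurable D -> (mu D < +oo)%E ->
  mu.-integrable D (EFin \o (fun _ : R => c)).
Proof.
move=> mD fD; apply/integrableP; split; first by apply/measurable_EFinP.
rewrite (_ : (\int[mu]_(x in D) _)%E = (`|c|%:E * mu D)%E); last first.
  by rewrite -integral_cst.
by rewrite lte_mul_pinfty.
Qed.

Definition cint D f : Prop :=
  mu.-integrable D (EFin \o (fun x => complex.Re (f x))) /\
  mu.-integrable D (EFin \o (fun x => complex.Im (f x))).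

Lemma cint_cmeas D f : cint D f -> cmeas D f.
Proof. by move=> [/measurable_int/measurable_EFinP a /measurable_int/measurable_EFinP b]. Qed.

Lemma cint_bound D f (k : R -> R) : measurable D -> cmeas D f ->
  mu.-integrable D (EFin \o k) -> (forall x, D x -> cmod (f x) <= k x) ->
  cint D f.
Proof.
move=> mD [mr mi] ik fk; split; apply: le_integrable_R ik _ => // x Dx.
  exact: le_trans (ler_Re_cmod _) (fk _ Dx).
exact: le_trans (ler_Im_cmod _) (fk _ Dx).
Qed.

Lemma integrable_cmod D f : measurable D -> cint D f ->
  mu.-integrable D (EFin \o (fun x => cmod (f x))).
Proof.
move=> mD fi; have [/integrable_norm ir /integrable_norm ii] := fi.
apply: le_integrable_R (integrableD_R mD ir ii) _ => //.
  by apply: measurable_cmod; exact: cint_cmeas.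
by move=> x Dx /=; rewrite ger0_norm ?cmod_ge0 // cmod_leD.
Qed.

Lemma cintS D E f : measurable D -> measurable E -> E `<=` D -> cint D f -> cint E f.
Proof. by move=> mD mE ED [a b]; split; [move: a|move: b]; apply: integrableS. Qed.

Lemma eq_cint D f g : measurable D -> (forall x, D x -> f x = g x) -> cint D f -> cint D g.
Proof.
move=> mD fg [a b]; split.
  by apply: eq_integrable_R a => // x Dx /=; rewrite fg.
by apply: eq_integrable_R b => // x Dx /=; rewrite fg.
Qed.

Lemma cintD D f g : measurable D -> cint D f -> cint D g ->
  cint D (fun x => f x + g x).
Proof.
move=> mD [a b] [c d]; split.
  by apply: eq_integrable_R (integrableD_R mD a c) => // x _ /=; rewrite cReD.
by apply: eq_integrable_R (integrableD_R mD b d) => // x _ /=; rewrite cImD.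
Qed.

Lemma cintZ D f (z : R[i]) : measurable D -> cint D f -> cint D (fun x => z * f x).
Proof.
move=> mD fi; have ik := integrableZ_R (cmod z) mD (integrable_cmod mD fi).
apply: (@cint_bound _ _ (fun x => cmod z * cmod (f x)) mD) => //.
  by apply: cmeasM; [exact: cmeas_cst|exact: cint_cmeas].
by move=> x _; rewrite cmodM.
Qed.

Lemma cintMl D f g (k : R) : measurable D -> cmeas D g ->
  (forall x, D x -> cmod (g x) <= k) -> cint D f -> cint D (fun x => g x * f x).
Proof.
move=> mD mg gk fi; have ik := integrableZ_R k mD (integrable_cmod mD fi).
apply: (@cint_bound _ _ (fun x => k * cmod (f x)) mD) => //.
  by apply: cmeasM => //; exact: cint_cmeas.
by move=> x Dx; rewrite cmodM ler_wpM2r ?cmod_ge0 ?gk.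
Qed.

Lemma cint_expi D f (t : R -> R) : measurable D -> measurable_fun D t ->
  cint D f -> cint D (fun x => expi (t x) * f x).
Proof.
move=> mD mt; apply: (@cintMl _ _ _ 1) => //; first exact: cmeas_expi.
by move=> x _; rewrite cmod_expi.
Qed.

Lemma cint0 D : measurable D -> cint D (fun=> 0).
Proof. by move=> mD; split; exact: integrable0. Qed.

Lemma cint_sum D I (s : seq I) (F : I -> R -> R[i]) : measurable D ->
  (forall i, cint D (F i)) -> cint D (fun x => \sum_(i <- s) F i x).
Proof.
move=> mD iF; elim: s => [|i s IH].
  by apply: (eq_cint mD) _ (cint0 mD) => x _; rewrite big_nil.
by apply: (eq_cint mD) _ (cintD mD (iF i) IH) => x _; rewrite big_cons.
Qed.

Lemma eq_Cintegral D f g : (forall x, D x -> f x = g x) ->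
  Cintegral D f = Cintegral D g.
Proof.
move=> fg; rewrite /Cintegral.
by congr (_ +i* _); apply: eq_Rintegral => x /set_mem Dx; rewrite fg.
Qed.

Lemma CintegralD D f g : measurable D -> cint D f -> cint D g ->
  Cintegral D (fun x => f x + g x) = Cintegral D f + Cintegral D g.
Proof.
move=> mD [a b] [c d]; apply: complexP; rewrite !cReImE /=.
  by under eq_Rintegral do rewrite cReD; rewrite RintegralD.
by under eq_Rintegral do rewrite cImD; rewrite RintegralD.
Qed.

Lemma CintegralZ D f (z : R[i]) : measurable D -> cint D f ->
  Cintegral D (fun x => z * f x) = z * Cintegral D f.
Proof.
move=> mD [a b]; apply: complexP; rewrite !cReImE /=.
  under eq_Rintegral do rewrite cReM.
  rewrite RintegralB ?RintegralZl //; last exact: integrableZ_R.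
  exact: integrableZ_R.
under eq_Rintegral do rewrite cImM.
rewrite RintegralD ?RintegralZl //; last exact: integrableZ_R.
exact: integrableZ_R.
Qed.

Lemma CintegralB D f g : measurable D -> cint D f -> cint D g ->
  Cintegral D (fun x => f x - g x) = Cintegral D f - Cintegral D g.
Proof.
move=> mD fi gi; transitivity (Cintegral D (fun x => f x + (-1) * g x)).
  by apply: eq_Cintegral => x _; rewrite mulN1r.
by rewrite CintegralD ?CintegralZ // ?mulN1r //; exact: cintZ.
Qed.

Lemma Cintegral0 D : Cintegral D (fun=> 0) = 0.
Proof. by apply: complexP; rewrite /= /Rintegral integral0. Qed.

Lemma Cintegral_sum D I (s : seq I) (F : I -> R -> R[i]) : measurable D ->
  (forall i, cint D (F i)) ->
  Cintegral D (fun x => \sum_(i <- s) F i x) = \sum_(i <- s) Cintegral D (F i).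
Proof.
move=> mD iF; elim: s => [|i s IH].
  rewrite big_nil -[RHS](Cintegral0 D).
  by apply: eq_Cintegral => x _; rewrite big_nil.
rewrite big_cons -IH -CintegralD //; last exact: cint_sum.
by apply: eq_Cintegral => x _; rewrite big_cons.
Qed.

(** The factor 2 comes from treating real and imaginary parts separately, which
    avoids rotating the integral to the positive axis. *)
Lemma cmod_Cintegral D f : measurable D -> cint D f ->
  cmod (Cintegral D f) <= 2 * \int[mu]_(x in D) cmod (f x).
Proof.
move=> mD fi; have [a b] := fi; have im := integrable_cmod mD fi.
have h (u : R -> R) : mu.-integrable D (EFin \o u) ->
    (forall x, `|u x| <= cmod (f x)) ->
    `|\int[mu]_(x in D) u x| <= \int[mu]_(x in D) cmod (f x).
  move=> iu uf; rewrite (le_trans (le_normr_Rintegral _ iu)) //.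
  by apply: le_Rintegral => //; exact: integrable_norm.
rewrite (le_trans (cmod_leD _)) //= mulr_natl mulr2n.
by rewrite lerD // h // => x; [exact: ler_Re_cmod|exact: ler_Im_cmod].
Qed.

Lemma ae_eq_Cintegral D f g : measurable D -> cmeas D f -> cmeas D g ->
  {ae mu, forall x, D x -> f x = g x} -> Cintegral D f = Cintegral D g.
Proof.
move=> mD [a b] [c d] fg; rewrite /Cintegral /Rintegral.
congr (fine _ +i* fine _); apply: ae_eq_integral => //.
- exact/measurable_EFinP.
- exact/measurable_EFinP.
- by apply: ae_imp fg => x /= h Dx; rewrite h.
- exact/measurable_EFinP.
- exact/measurable_EFinP.
- by apply: ae_imp fg => x /= h Dx; rewrite h.
Qed.

Lemma integrable_sqn D f : measurable D -> cmeas D f -> (energy D f < +oo)%E ->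
  mu.-integrable D (EFin \o (fun x => sqn (f x))).
Proof.
move=> mD mf ef; apply/integrableP; split; first exact: measurable_esqn.
rewrite (_ : (\int[mu]_(x in D) _)%E = energy D f) //.
by apply: eq_integral => x _ /=; rewrite ger0_norm ?sqn_ge0.
Qed.

Lemma cintM_L2 D f g : measurable D -> cmeas D f -> cmeas D g ->
  (energy D f < +oo)%E -> (energy D g < +oo)%E -> cint D (fun x => f x * g x).
Proof.
move=> mD mf mg ef eg.
have ik := integrableD_R mD (integrable_sqn mD mf ef) (integrable_sqn mD mg eg).
apply: (@cint_bound _ _ (fun x => sqn (f x) + sqn (g x)) mD) => //.
  exact: cmeasM.
move=> x _; rewrite cmodM -!cmod_sqr.
have := sqr_ge0 (cmod (f x) - cmod (g x)).
have := cmod_ge0 (f x); have := cmod_ge0 (g x); nra.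
Qed.

Lemma energy_bounded D f (k : R) : measurable D -> (mu D < +oo)%E -> cmeas D f ->
  (forall x, D x -> sqn (f x) <= k) -> (energy D f <= k%:E * mu D)%E.
Proof.
move=> mD fD mf fk; rewrite -integral_cst //; apply: ge0_le_integral => //.
- by move=> x _; rewrite lee_fin sqn_ge0.
- exact: measurable_esqn.
Qed.

Lemma cint_L2 D f : measurable D -> (mu D < +oo)%E -> cmeas D f ->
  (energy D f < +oo)%E -> cint D f.
Proof.
move=> mD fD mf ef.
pose o := (fun _ : R => 1 : R[i]); have e1 : (energy D o < +oo)%E.
  apply: (le_lt_trans (@energy_bounded _ _ 1 mD fD (cmeas_cst D 1) _)).
    by move=> x _; rewrite /sqn /= expr1n expr0n /= addr0.
  by rewrite mul1e.
apply: (eq_cint mD) _ (cintM_L2 mD (cmeas_cst D 1) mf e1 ef) => x _.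
by rewrite mul1r.
Qed.

Lemma Rintegral_dct D (F : nat -> R -> R) (f k : R -> R) : measurable D ->
  (forall n, measurable_fun D (F n)) -> measurable_fun D f ->
  (forall x, D x -> F n x @[n --> \oo] --> f x) ->
  mu.-integrable D (EFin \o k) -> (forall n x, D x -> `|F n x| <= k x) ->
  \int[mu]_(x in D) F n x @[n --> \oo] --> \int[mu]_(x in D) f x.
Proof.
move=> mD mF mf Ff ik Fk.
have [] // := @dominated_convergence _ _ _ mu D _
  (fun n => EFin \o F n) (EFin \o f) (EFin \o k).
- by move=> n; apply/measurable_EFinP; exact: mF.
- by apply/measurable_EFinP; exact: mf.
- apply: aeW => x Dx; apply/cvg_EFin; first exact: nearW.
  exact: Ff.
- by apply: aeW => x n Dx; rewrite /= lee_fin Fk.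
move=> ifi _ h.
apply: fine_cvg; rewrite fineK; first exact: h.
exact: integrable_fin_num ifi.
Qed.

Lemma vanish_integral D (u : nat -> R -> R) (k : R -> R) : measurable D ->
  mu.-integrable D (EFin \o k) -> (forall n, measurable_fun D (u n)) ->
  (forall n x, D x -> 0 <= u n x <= k x) ->
  (forall x, D x -> u n x @[n --> \oo] --> 0) ->
  vanish (fun n => \int[mu]_(x in D) (u n x)%:E)%E.
Proof.
move=> mD ik mu' u0k cu.
have uk n x : D x -> `|u n x| <= k x by move=> /(u0k n)/andP[u0 uk]; rewrite ger0_norm.
have e n : (\int[mu]_(x in D) (u n x)%:E)%E = (\int[mu]_(x in D) u n x)%:E.
  rewrite /Rintegral fineK //; apply: (@integrable_fin_num _ _ _ mu) => //.
  exact: (le_integrable_R mD (mu' n) ik (uk n)).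
apply: cvg0_vanish => [n|].
  by apply: integral_ge0 => x Dx; rewrite lee_fin; have /andP[] := u0k n x Dx.
under eq_fun do rewrite e.
apply: cvg_EFin; first exact: nearW.
rewrite (_ : 0 = \int[mu]_(x in D) cst 0 x).
  exact: (Rintegral_dct mD mu' _ cu ik uk).
by rewrite /Rintegral integral0.
Qed.

End ComplexIntegral.

(** * Translations and tilings of the line *)

Section Translation.
Context {R : realType}.
Notation mu := (@lebesgue_measure R).
Implicit Types (D : set R).

Lemma measurable_shift (c : R) : measurable_fun setT (fun x : R => x + c).
Proof. exact: measurable_funD. Qed.

Lemma lebesgue_measure_shift (c : R) (A : set R) : measurable A ->
  pushforward mu (fun x : R => x + c) A = mu A.
Proof.
pose phi := (fun x => x + c) : R -> measurableTypeR R.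
have mphi : measurable_fun setT phi by exact: measurable_shift.
pose phiM := HB.pack_for {mfun _ >-> measurableTypeR R} phi
  (isMeasurableFun.Build _ _ _ _ _ mphi).
move=> mA; apply/esym.
apply: (@lebesgue_measure_unique _ (pushforward mu phiM)) => //= _ [[a b]] _ <-.
rewrite /pushforward (_ : phi @^-1` _ = `](a - c)%R, (b - c)%R]%classic); last first.
  apply/seteqP; split => x /=; rewrite !in_itv /= /phi => /andP[h1 h2];
  apply/andP; split; lra.
rewrite !lebesgue_measure_itv /= !lte_fin ltrD2r.
by case: ifP => // _; rewrite -!EFinB; congr (_%:E); ring.
Qed.

Lemma ge0_integral_shift (c : R) D (f : R -> \bar R) : measurable D ->
  measurable_fun D f -> (forall x, 0 <= f x)%E ->
  (\int[mu]_(x in (fun y : R => (y + c)%R) @^-1` D) f (x + c)%R = \int[mu]_(x in D) f x)%E.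
Proof.
move=> mD mf f0.
pose phi := (fun x => x + c) : measurableTypeR R -> measurableTypeR R.
have mphi : measurable_fun setT phi by exact: measurable_shift.
rewrite -(@ge0_integral_pushforward _ _ _ _ _ phi mphi mu D f) //.
apply: eq_measure_integral => //= A mA _.
exact: lebesgue_measure_shift.
Qed.

Lemma integrable_shift (c : R) D (f : R -> R) : measurable D ->
  measurable_fun setT f ->
  mu.-integrable D (EFin \o f) ->
  mu.-integrable ((fun y => y + c) @^-1` D) (EFin \o (fun x => f (x + c))).
Proof.
move=> mD mf /integrableP[_ fi]; apply/integrableP; split.
  apply/measurable_EFinP; apply: measurable_funTS.
  apply: (@measurableT_comp _ _ _ _ _ _ f) => //; exact: (measurable_shift c).
have := @ge0_integral_shift c D (fun x => `|(f x)%:E|%E) mD _ _.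
move=> -> //; apply: measurableT_comp => //; apply/measurable_EFinP.
exact: measurable_funTS.
Qed.

Lemma Rintegral_shift (c : R) D (f : R -> R) : measurable D ->
  measurable_fun setT f -> mu.-integrable D (EFin \o f) ->
  \int[mu]_(x in (fun y => y + c) @^-1` D) f (x + c) = \int[mu]_(x in D) f x.
Proof.
move=> mD mf fi; pose phi := (fun x => x + c) : measurableTypeR R -> measurableTypeR R.
have mphi : measurable_fun setT phi by exact: measurable_shift.
have ish := integrable_shift c mD mf fi.
rewrite /Rintegral; congr fine.
rewrite -(@integral_pushforward _ _ _ _ _ phi mphi mu D (EFin \o f)) //; last first.
  exact/measurable_EFinP.
by apply: eq_measure_integral => //= A mA _; exact: lebesgue_measure_shift.
Qed.

End Translation.

Section Tiling.
Context {R : realType}.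
Notation mu := (@lebesgue_measure R).
Implicit Types (D : set R) (a c : R).

Definition tile a c : set R := `[a, a + c[.
Definition tiles a c (m : int) (n : nat) : set R :=
  `[a + m%:~R * c, a + (n%:Z + m)%:~R * c[.

Lemma measurable_tile a c : measurable (tile a c). Proof. exact: measurable_itv. Qed.
Lemma measurable_tiles a c m n : measurable (tiles a c m n).
Proof. exact: measurable_itv. Qed.
Hint Resolve measurable_tile measurable_tiles : core.

Lemma tiles0 a c m : tiles a c m 0 = set0.
Proof.
apply/seteqP; split => x //=; rewrite /tiles /= in_itv /= add0r => /andP[h1 h2].
by move: (le_lt_trans h1 h2); rewrite ltxx.
Qed.

Lemma tilesS a c m n : 0 < c ->
  tiles a c m n.+1 = tiles a c m n `|` (tile (a + (n%:Z + m)%:~R * c) c) /\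
  [disjoint tiles a c m n & tile (a + (n%:Z + m)%:~R * c) c].
Proof.
move=> c0.
have e : a + (n.+1%:Z + m)%:~R * c = a + (n%:Z + m)%:~R * c + c.
  by rewrite intS !rmorphD /=; ring.
have n0 : a + m%:~R * c <= a + (n%:Z + m)%:~R * c.
  rewrite lerD2l ler_wpM2r ?(ltW c0) // rmorphD /= lerDr.
  by rewrite (_ : n%:Z%:~R = n%:R).
split; last first.
  apply/disj_set2P/seteqP; split => x //= []; rewrite /tiles /tile /= !in_itv /= => /andP[_ h] /andP[h' _].
  by move: (le_lt_trans h' h); rewrite ltxx.
apply/seteqP; split => x /=; rewrite /tiles /tile /= !in_itv /= e.
  move=> /andP[h1 h2]; case: (ltP x (a + (n%:Z + m)%:~R * c)) => h; [left|right];
  by rewrite ?h1 ?h ?h2.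
move=> [/andP[-> h]|/andP[h ->]] /=.
  by rewrite (lt_trans h) // ltrDl.
by rewrite (le_trans n0).
Qed.

Lemma tile_shift a c (t : R) : (fun y => y + t) @^-1` (tile (a + t) c) = tile a c.
Proof.
by apply/seteqP; split => x /=; rewrite /tile /= !in_itv /= => /andP[h1 h2];
  apply/andP; split; lra.
Qed.

Lemma ge0_integral_tiles a c m n (f : R -> \bar R) : 0 < c ->
  measurable_fun setT f -> (forall x, 0 <= f x)%E ->
  (\int[mu]_(x in tiles a c m n) f x =
   \sum_(k < n) \int[mu]_(x in tile a c) f (x + (k%:Z + m)%:~R * c)%R)%E.
Proof.
move=> c0 mf f0; elim: n => [|n IH].
  by rewrite big_ord0 tiles0 integral_set0.
have [-> dd] := tilesS a m n c0.
rewrite ge0_integral_setU //; last exact: measurable_funTS.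
rewrite IH big_ord_recr /=; congr (_ + _)%E.
rewrite -(ge0_integral_shift ((n%:Z + m)%:~R * c)) //; last exact: measurable_funTS.
rewrite tile_shift //.
all: try exact: measurable_tiles.
all: exact: measurable_tile.
Qed.

Lemma Rintegral_tiles a c m n (f : R -> R) : 0 < c ->
  measurable_fun setT f -> mu.-integrable setT (EFin \o f) ->
  \int[mu]_(x in tiles a c m n) f x =
   \sum_(k < n) \int[mu]_(x in tile a c) f (x + (k%:Z + m)%:~R * c).
Proof.
move=> c0 mf fi; elim: n => [|n IH].
  by rewrite big_ord0 tiles0 Rintegral_set0.
have [-> dd] := tilesS a m n c0.
rewrite Rintegral_setU //; first last.
- move: fi; apply: integrableS => //; apply: measurableU.
    exact: measurable_tiles.
  exact: measurable_tile.
- exact: measurable_tile.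
- exact: measurable_tiles.
rewrite IH big_ord_recr /=; congr (_ + _).
rewrite -(Rintegral_shift ((n%:Z + m)%:~R * c)) ?tile_shift //.
by move: fi; apply: integrableS => //; exact: measurable_tile.
Qed.

(** The window of 2N + 1 tiles centred at the tile of a matches the symmetric
    partial sums that define sums over the integers. *)
Definition window a c (N : nat) : set R := tiles a c (- N%:Z) (2 * N).+1.

Lemma measurable_window a c N : measurable (window a c N).
Proof. exact: measurable_tiles. Qed.

Lemma windowE a c N : window a c N = `[a - N%:R * c, a + N.+1%:R * c[%classic.
Proof.
have -> : N.+1%:R = (((2 * N).+1)%:Z - N%:Z)%:~R :> R.
  rewrite rmorphB /= -!pmulrn -natrB; first by congr (_%:R); lia.
  by lia.
by rewrite /window /tiles rmorphN /= mulNr -pmulrn.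
Qed.

Lemma window_homo a c : 0 < c -> {homo window a c : n m / (n <= m)%N >-> (n <= m)%O}.
Proof.
move=> c0 n m nm; apply/subsetPset; rewrite !windowE => x /=; rewrite !in_itv /=.
have h1 : n%:R * c <= m%:R * c by rewrite ler_wpM2r ?(ltW c0) // ler_nat.
have h2 : n.+1%:R * c <= m.+1%:R * c by rewrite ler_wpM2r ?(ltW c0) // ler_nat.
by move=> /andP[h h']; apply/andP; split; lra.
Qed.

Lemma window_cover a c (x : R) : 0 < c -> \forall N \near \oo, window a c N x.
Proof.
move=> c0; near=> N; rewrite windowE /= in_itv /=.
have h : `|x - a| / c <= N%:R by near: N; exact: nbhs_infty_ger.
have {}h : `|x - a| <= N%:R * c by rewrite -ler_pdivrMr.
have hx := ler_norm (x - a); have hx' := ler_norm (- (x - a)); rewrite normrN in hx'.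
rewrite -natr1 mulrDl mul1r.
by apply/andP; split; lra.
Unshelve. all: by end_near. Qed.

Lemma bigcup_window a c : 0 < c -> \bigcup_N window a c N = setT.
Proof.
move=> c0; apply/seteqP; split => // x _.
by have [N _ /(_ N (leqnn N)) h] := window_cover a x c0; exists N.
Qed.

Lemma ge0_integral_window a c (f : R -> \bar R) : 0 < c ->
  measurable_fun setT f -> (forall x, 0 <= f x)%E ->
  (\sum_(k < (2 * N).+1) \int[mu]_(x in tile a c) f (x + (k%:Z - N%:Z)%:~R * c)%R)%E
    @[N --> \oo] --> (\int[mu]_x f x)%E.
Proof.
move=> c0 mf f0; rewrite -(bigcup_window a c0).
rewrite (_ : (fun N => _) = (fun N => \int[mu]_(x in window a c N) f x)%E); last first.
  by apply/funext => N; rewrite ge0_integral_tiles.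
apply: ge0_nondecreasing_set_cvg_integral => //.
- exact: window_homo.
- by move=> i; exact: measurable_window.
- by move=> i; exact: measurable_funTS.
Qed.

Lemma Rintegral_exhaust (D : nat -> set R) (f : R -> R) : (forall N, measurable (D N)) ->
  (forall x, \forall N \near \oo, D N x) ->
  mu.-integrable setT (EFin \o f) ->
  \int[mu]_(x in D N) f x @[N --> \oo] --> \int[mu]_x f x.
Proof.
move=> mD cD fi; under eq_fun do rewrite Rintegral_mkcond.
have mf : measurable_fun setT f by have /measurable_int/measurable_EFinP := fi.
apply: (@Rintegral_dct _ _ _ _ (fun x => `|f x|)) => //.
- by move=> n; apply/(measurable_restrictT _ (mD n)); exact: measurable_funTS.
- move=> x _; apply: cvg_near_cst; near=> N.
  by rewrite patchT // inE; near: N.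
- exact: integrable_norm.
- by move=> n x _; rewrite /patch; case: ifP => // _; rewrite normr0.
Unshelve. all: by end_near. Qed.

Lemma Rintegral_window a c (f : R -> R) : 0 < c ->
  mu.-integrable setT (EFin \o f) ->
  (\sum_(k < (2 * N).+1) \int[mu]_(x in tile a c) f (x + (k%:Z - N%:Z)%:~R * c))
    @[N --> \oo] --> \int[mu]_x f x.
Proof.
move=> c0 fi.
have mf : measurable_fun setT f by have /measurable_int/measurable_EFinP := fi.
rewrite (_ : (fun N => _) = (fun N => \int[mu]_(x in window a c N) f x)); last first.
  by apply/funext => N; rewrite Rintegral_tiles.
apply: Rintegral_exhaust => // [N|x]; first exact: measurable_window.
exact: window_cover.
Qed.

Lemma energy_tail (D : nat -> set R) (f : R -> R[i]) : (forall N, measurable (D N)) ->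
  (forall x, \forall N \near \oo, D N x) -> cmeas setT f ->
  (energy setT f < +oo)%E -> vanish (fun N => energy (~` D N) f).
Proof.
move=> mD cD mf ef; have mC N : measurable (~` D N) by exact: measurableC.
rewrite (_ : (fun N => _) = (fun N => energy setT (cutoff (~` D N) f))); last first.
  by apply/funext => N; rewrite energy_cut.
apply: (vanish_integral measurableT (integrable_sqn measurableT mf ef)).
- by move=> N; apply: measurable_sqn; apply: cmeas_cut => //; exact: cmeasS mf.
- by move=> N x _; rewrite /cutoff; case: ifP => _; rewrite ?sqn0 sqn_ge0 lexx.
move=> x _; apply: cvg_near_cst; near=> N.
rewrite /cutoff memNset ?sqn0 //=; apply; near: N; exact: cD.
Unshelve. all: by end_near. Qed.

End Tiling.

(** * Sums over the integers and complex limits *)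

Section SumsOverZ.
Context {R : realType}.
Implicit Types (F G : int -> R[i]).

Lemma psum_rev (T : nmodType) (G : int -> T) N :
  \sum_(k < (2 * N).+1) G (k%:Z - N%:Z) = \sum_(k < (2 * N).+1) G (- (k%:Z - N%:Z)).
Proof.
rewrite (reindex_inj rev_ord_inj); apply: eq_bigr => k _; congr G.
by rewrite /= subSS; have := ltn_ord k; lia.
Qed.

Lemma psumS (T : nmodType) (G : int -> T) N :
  \sum_(k < (2 * N.+1).+1) G (k%:Z - N.+1%:Z) =
  \sum_(k < (2 * N).+1) G (k%:Z - N%:Z) + (G N.+1%:Z + G (- N.+1%:Z)).
Proof.
have -> : (2 * N.+1).+1 = (2 * N).+3 by lia.
rewrite big_ord_recl big_ord_recr /= addrCA [in LHS](addrC (G _) (G _)).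
congr (_ + (_ + _)).
- by apply: eq_bigr => k _; congr G; rewrite /bump /=; lia.
- by congr G; rewrite /bump /=; lia.
- by congr G; lia.
Qed.

Lemma psum_series (T : zmodType) (G : int -> T) N :
  \sum_(k < (2 * N).+1) G (k%:Z - N%:Z) =
  G 0 + \sum_(0 <= j < N) (G j.+1%:Z + G (- j.+1%:Z)).
Proof.
elim: N => [|N IH].
  by rewrite big_geq // big_ord_recl big_ord0 subr0 /= addr0.
by rewrite psumS IH big_nat_recr //= -addrA.
Qed.

Lemma Re_psumZ F N : complex.Re (psumZ F N) =
  \sum_(k < (2 * N).+1) complex.Re (F (k%:Z - N%:Z)).
Proof. exact: cRe_sum. Qed.
Lemma Im_psumZ F N : complex.Im (psumZ F N) =
  \sum_(k < (2 * N).+1) complex.Im (F (k%:Z - N%:Z)).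
Proof. exact: cIm_sum. Qed.

Lemma real_psum_cvg (f : int -> R) (M : R) :
  (forall N, \sum_(k < (2 * N).+1) `|f (k%:Z - N%:Z)| <= M) ->
  cvgn (fun N => \sum_(k < (2 * N).+1) f (k%:Z - N%:Z)).
Proof.
move=> fM; pose b j := f j.+1%:Z + f (- j.+1%:Z).
have cb : cvgn (series b).
  apply: normed_cvg; apply: nondecreasing_is_cvgn.
    apply: nondecreasing_series => n _ _; exact: normr_ge0.
  exists M => _ [N _ <-]; apply: le_trans (fM N); rewrite (psum_series (fun k => `|f k|)).
  apply: (@le_trans _ _ (\sum_(0 <= j < N) (`|f j.+1%:Z| + `|f (- j.+1%:Z)|))).
    by apply: ler_sum => j _; exact: ler_normD.
  by rewrite lerDr.
rewrite (_ : (fun N => _) = (fun N => f 0 + series b N)); last first.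
  by apply/funext => N; rewrite psum_series.
by apply: is_cvgD => //; exact: is_cvg_cst.
Qed.

Lemma cmod_psumZ F N : cmod (psumZ F N) <= \sum_(k < (2 * N).+1) cmod (F (k%:Z - N%:Z)).
Proof. exact: cmod_sum. Qed.

Definition ccvg (z : nat -> R[i]) (l : R[i]) : Prop :=
  complex.Re (z n) @[n --> \oo] --> complex.Re l /\
  complex.Im (z n) @[n --> \oo] --> complex.Im l.

Lemma ccvg_cst (l : R[i]) : ccvg (fun=> l) l.
Proof. by split; exact: cvg_cst. Qed.
Lemma ccvgD z1 z2 l1 l2 : ccvg z1 l1 -> ccvg z2 l2 ->
  ccvg (fun n => z1 n + z2 n) (l1 + l2).
Proof.
move=> [a b] [c d]; split.
  by under eq_fun do rewrite cReD; rewrite cReD; exact: cvgD.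
by under eq_fun do rewrite cImD; rewrite cImD; exact: cvgD.
Qed.
Lemma ccvgM z1 z2 l1 l2 : ccvg z1 l1 -> ccvg z2 l2 ->
  ccvg (fun n => z1 n * z2 n) (l1 * l2).
Proof.
move=> [a b] [c d]; split.
  by under eq_fun do rewrite cReM; rewrite cReM; apply: cvgB; exact: cvgM.
by under eq_fun do rewrite cImM; rewrite cImM; apply: cvgD; exact: cvgM.
Qed.
Lemma ccvgB z1 z2 l1 l2 : ccvg z1 l1 -> ccvg z2 l2 ->
  ccvg (fun n => z1 n - z2 n) (l1 - l2).
Proof.
move=> h1 h2; have := ccvgD h1 (ccvgM (ccvg_cst (-1)) h2).
by under eq_fun do rewrite mulN1r; rewrite mulN1r.
Qed.
Lemma ccvg_unique z l1 l2 : ccvg z l1 -> ccvg z l2 -> l1 = l2.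
Proof.
move=> [a b] [c d]; apply: complexP; [exact: (cvg_unique _ a c)|exact: (cvg_unique _ b d)].
Qed.
Lemma ccvg_norm0 z l : (cmod (z n - l) @[n --> \oo] --> 0) -> ccvg z l.
Proof.
move=> /cvgrPdist_le H; split; apply/cvgrPdist_le => e e0; have := H _ e0;
  apply: filterS => n /=; rewrite sub0r normrN ger0_norm ?cmod_ge0 //; apply: le_trans.
  by rewrite distrC (_ : _ - _ = complex.Re (z n - l)) ?ler_Re_cmod // cReD cReN.
by rewrite distrC (_ : _ - _ = complex.Im (z n - l)) ?ler_Im_cmod // cImD cImN.
Qed.
Lemma ccvg_sqn z l : ccvg z l -> sqn (z n) @[n --> \oo] --> sqn l.
Proof.
move=> [a b]; rewrite /sqn; apply: cvgD.
  by rewrite expr2; under eq_fun do rewrite expr2; exact: cvgM.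
by rewrite expr2; under eq_fun do rewrite expr2; exact: cvgM.
Qed.
Lemma ccvg_le_sqn z l (M : R) : ccvg z l -> (forall n, sqn (z n) <= M) -> sqn l <= M.
Proof.
move=> /ccvg_sqn zl zM; rewrite -(cvg_lim _ zl) //; apply: limr_le.
  by apply/cvg_ex; eexists; exact: zl.
exact: nearW.
Qed.

Lemma psumZ_ccvg F (M : R) : (forall N, \sum_(k < (2 * N).+1) cmod (F (k%:Z - N%:Z)) <= M) ->
  ccvg (psumZ F) (sumZ F).
Proof.
move=> FM; have key (u : R[i] -> R) : (forall z, `|u z| <= cmod z) ->
    cvgn (fun N => \sum_(k < (2 * N).+1) u (F (k%:Z - N%:Z))).
  move=> uz; apply: (@real_psum_cvg (fun k => u (F k)) M) => N.
  by apply: le_trans (FM N); apply: ler_sum => k _.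
split; rewrite /sumZ /=.
  by under eq_fun do rewrite Re_psumZ; exact: (key _ (@ler_Re_cmod R)).
by under eq_fun do rewrite Im_psumZ; exact: (key _ (@ler_Im_cmod R)).
Qed.

Lemma ccvg_sumZ F l : ccvg (psumZ F) l -> sumZ F = l.
Proof.
by move=> [a b]; apply: complexP => /=; exact: cvg_lim.
Qed.

Lemma sumZ_rev F : sumZ (fun k => F (- k)) = sumZ F.
Proof.
by rewrite /sumZ; congr (limn _ +i* limn _); apply/funext => N; rewrite /psumZ (psum_rev F).
Qed.

Lemma psum_shift1 (T : zmodType) (G : int -> T) N :
  \sum_(k < (2 * N).+1) G (k%:Z - N%:Z + 1) =
  \sum_(k < (2 * N).+1) G (k%:Z - N%:Z) + (G N.+1%:Z - G (- N%:Z)).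
Proof.
rewrite big_ord_recr /= [in RHS]big_ord_recl /=.
rewrite (_ : (2 * N)%:Z - N%:Z + 1 = N.+1%:Z); last by lia.
rewrite sub0r [in RHS](addrC (G N.+1%:Z)) [RHS]addrACA subrr add0r; congr (_ + _).
by apply: eq_bigr => k _; congr G; rewrite /bump /=; lia.
Qed.

(** Symmetric partial sums are not translation invariant: a shift changes them by
    two boundary terms, which have to tend to 0. *)
Lemma ccvg_shift1 F l : (cmod (F N.+1%:Z) @[N --> \oo] --> 0) ->
  (cmod (F (- N%:Z)) @[N --> \oo] --> 0) ->
  ccvg (psumZ F) l -> ccvg (psumZ (fun k => F (k + 1))) l.
Proof.
move=> h1 h2 Fl.
have e : psumZ (fun k => F (k + 1)) = fun N => psumZ F N + (F N.+1%:Z - F (- N%:Z)).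
  by apply/funext => N; rewrite /psumZ (psum_shift1 F).
rewrite e -[l]addr0; apply: ccvgD => //; apply: ccvg_norm0.
under eq_fun do rewrite subr0.
have : cmod (F N.+1%:Z) + cmod (F (- N%:Z)) @[N --> \oo] --> (0 + 0 : R) by exact: cvgD.
rewrite addr0; apply: (@squeeze_cvgr _ _ _ _ (cst 0)); last exact: cvg_cst.
by apply: nearW => N /=; rewrite cmod_ge0 cmodB.
Qed.

End SumsOverZ.

Section RealSums.
Context {R : realType}.

Lemma cauchy_schwarz_sum n (a b : 'I_n -> R) :
  (forall i, 0 <= a i) -> (forall i, 0 <= b i) ->
  (\sum_i a i * b i) ^+ 2 <= (\sum_i a i ^+ 2) * (\sum_i b i ^+ 2).
Proof.
move=> a0 b0; elim: n a b a0 b0 => [|n IH] a b a0 b0.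
  by rewrite !big_ord0 mul0r expr0n.
rewrite !big_ord_recr /=.
have := IH _ _ (fun i => a0 (widen_ord (leqnSn n) i)) (fun i => b0 (widen_ord (leqnSn n) i)).
set S := \sum_(i < n) _ * _; set A := \sum_(i < n) _ ^+ 2; set B := \sum_(i < n) _ ^+ 2.
have S0 : 0 <= S by apply: sumr_ge0 => i _; rewrite mulr_ge0.
have A0 : 0 <= A by apply: sumr_ge0 => i _; rewrite sqr_ge0.
have B0 : 0 <= B by apply: sumr_ge0 => i _; rewrite sqr_ge0.
move: (a ord_max) (b ord_max) (a0 ord_max) (b0 ord_max) => x y x0 y0 SAB.
suff H : 2 * S * (x * y) <= A * y ^+ 2 + B * x ^+ 2.
  by rewrite sqrrD -mulr_natl; nra.
rewrite -(@ler_pXn2r _ 2) ?nnegrE ?addr_ge0 ?mulr_ge0 ?sqr_ge0 //.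
have h1 : (2 * S * (x * y)) ^+ 2 <= 4 * (A * B) * (x ^+ 2 * y ^+ 2).
  have -> : (2 * S * (x * y)) ^+ 2 = 4 * S ^+ 2 * (x ^+ 2 * y ^+ 2) by ring.
  by rewrite ler_wpM2r ?mulr_ge0 ?sqr_ge0 // ler_pM2l.
apply: (le_trans h1); rewrite -subr_ge0.
have -> : (A * y ^+ 2 + B * x ^+ 2) ^+ 2 - 4 * (A * B) * (x ^+ 2 * y ^+ 2) =
  (A * y ^+ 2 - B * x ^+ 2) ^+ 2 by ring.
exact: sqr_ge0.
Qed.

(** Comparison with an integral: each term j^(-s) is at most an increment of the
    primitive f(x) = - x^(1-s) / (s-1), and the increments telescope. *)
Lemma zeta_bound (s : R) : 1 < s ->
  exists2 Z : R, 0 < Z & forall N, \sum_(0 <= j < N) (j.+1%:R `^ (- s)) <= Z.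
Proof.
move=> s1; pose d := s - 1; have d0 : 0 < d by rewrite subr_gt0.
pose f (x : R) := - d^-1 * x `^ (- d).
have df (x : R) : 0 < x -> is_derive x 1 f (x `^ (- s)).
  move=> x0; have H := is_derive1_powR (- d) x0.
  apply: is_derive_eq; rewrite /GRing.scale /= mulrA mulrNN mulVf ?lt0r_neq0 // mul1r.
  by congr (_ `^ _); rewrite /d; ring.
have step (j : nat) : j.+2%:R `^ (- s) <= f j.+2%:R - f j.+1%:R.
  have jj : j.+1%:R < j.+2%:R :> R by rewrite ltr_nat.
  have pos (x : R) : x \in `]j.+1%:R, j.+2%:R[ -> 0 < x.
    by rewrite in_itv /= => /andP[h _]; apply: lt_trans h; rewrite ltr0n.
  have [||c cj ->] := @MVT _ f (fun x => x `^ (- s)) _ _ jj.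
  - by move=> x /pos; exact: df.
  - apply: derivable_within_continuous => x; rewrite in_itv /= => /andP[h _].
    have x0 : 0 < x by apply: lt_le_trans h; rewrite ltr0n.
    exact: (@ex_derive _ _ _ _ _ _ _ (df x x0)).
  have c0 := pos _ cj; move: cj; rewrite in_itv /= => /andP[_ cj].
  rewrite (_ : j.+2%:R - j.+1%:R = 1) ?mulr1; last by rewrite -[j.+2%:R]natr1 addrC addKr.
  rewrite !powRN lef_pV2 ?posrE ?powR_gt0 ?ltr0n //.
  by apply: ge0_ler_powR; rewrite ?nnegrE ?ler0n //; [lra|exact: ltW|exact: ltW].
have f0 x : 0 < x -> f x <= 0.
  by move=> x0; rewrite /f mulNr oppr_le0 mulr_ge0 ?invr_ge0 ?powR_ge0 ?ltW.
exists (1 + d^-1); first by rewrite addr_gt0 ?invr_gt0.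
case=> [|N]; first by rewrite big_geq // addr_ge0 ?invr_ge0 ?ltW.
rewrite big_nat_recl // powR1 lerD2l.
apply: (@le_trans _ _ (f N.+1%:R - f 1)).
  elim: N => [|N IH]; first by rewrite big_geq // subrr.
  rewrite big_nat_recr //=; apply: (le_trans (lerD IH (step N))).
  by move: (f _) (f _) (f _) => x y z; lra.
have := f0 N.+1%:R; rewrite ltr0n => /(_ isT).
have -> : f 1 = - d^-1 by rewrite /f powR1 mulr1.
lra.
Qed.

End RealSums.

Section CintegralDct.
Context {R : realType}.
Notation mu := (@lebesgue_measure R).

Lemma Cintegral_dct (D : set R) (F : nat -> R -> R[i]) (f : R -> R[i]) (k : R -> R) :
  measurable D -> (forall n, cmeas D (F n)) -> cmeas D f ->
  (forall x, D x -> ccvg (fun n => F n x) (f x)) ->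
  mu.-integrable D (EFin \o k) -> (forall n x, D x -> cmod (F n x) <= k x) ->
  ccvg (fun n => Cintegral D (F n)) (Cintegral D f).
Proof.
move=> mD mF [mf1 mf2] Ff ik Fk; split => /=.
  apply: (@Rintegral_dct _ _ _ _ k) => //.
  - by move=> n; have [] := mF n.
  - by move=> x Dx; have [] := Ff x Dx.
  - by move=> n x Dx; apply: le_trans (Fk n x Dx); exact: ler_Re_cmod.
apply: (@Rintegral_dct _ _ _ _ k) => //.
- by move=> n; have [] := mF n.
- by move=> x Dx; have [] := Ff x Dx.
- by move=> n x Dx; apply: le_trans (Fk n x Dx); exact: ler_Im_cmod.
Qed.

Lemma cmeas_ccvg (D : set R) (F : nat -> R -> R[i]) (f : R -> R[i]) :
  (forall n, cmeas D (F n)) -> (forall x, D x -> ccvg (fun n => F n x) (f x)) ->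
  cmeas D f.
Proof.
move=> mF Ff; split.
  apply: (@measurable_fun_cvg _ _ _ D (fun n x => complex.Re (F n x))).
    by move=> n; have [] := mF n.
  by move=> x Dx; have [] := Ff x Dx.
apply: (@measurable_fun_cvg _ _ _ D (fun n x => complex.Im (F n x))).
  by move=> n; have [] := mF n.
by move=> x Dx; have [] := Ff x Dx.
Qed.

Lemma near_cmod (f : R -> R[i]) x (e : R) :
  continuous (fun x => complex.Re (f x)) -> continuous (fun x => complex.Im (f x)) ->
  0 < e -> \forall y \near x, cmod (f x - f y) <= e.
Proof.
move=> cr ci e0; have e2 : 0 < e / 2 by lra.
have /cvgrPdist_le/(_ _ e2) h1 := @cr x.
have /cvgrPdist_le/(_ _ e2) h2 := @ci x.
near=> y; apply: (le_trans (cmod_leD _)); rewrite cReD cReN cImD cImN.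
have : `|complex.Re (f x) - complex.Re (f y)| <= e / 2 by near: y.
have : `|complex.Im (f x) - complex.Im (f y)| <= e / 2 by near: y.
lra.
Unshelve. all: by end_near. Qed.

(** Transforms of integrable functions are continuous, by dominated convergence
    along sequences.  The phase p covers the direct and the inverse transform. *)
Lemma continuous_Cintegral_expi (D : set R) (p : R -> R -> R) (v : R -> R[i]) (z : R[i]) :
  measurable D -> (forall x, measurable_fun D (p x)) ->
  (forall t, continuous (p^~ t)) -> cint D v ->
  continuous (fun x => complex.Re (z * Cintegral D (fun t => expi (p x t) * v t))) /\
  continuous (fun x => complex.Im (z * Cintegral D (fun t => expi (p x t) * v t))).
Proof.
move=> mD mp cp iv; pose I x := z * Cintegral D (fun t => expi (p x t) * v t).
suff H x (u : nat -> R) : u n @[n --> \oo] --> x -> ccvg (fun n => I (u n)) (I x).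
  by split=> x; [apply: (@cvg_nbhsP R R^o (fun x => complex.Re (I x)) x (complex.Re (I x))).2
    |apply: (@cvg_nbhsP R R^o (fun x => complex.Im (I x)) x (complex.Im (I x))).2] => u /H[].
move=> ux; apply: ccvgM; first exact: ccvg_cst.
have me y : cmeas D (fun t => expi (p y t) * v t).
  by apply: cmeasM; [exact: cmeas_expi|exact: cint_cmeas].
apply: (Cintegral_dct mD _ _ _ (integrable_cmod mD iv)) => //.
- move=> t _; apply: ccvgM; last exact: ccvg_cst.
  have pt : p (u n) t @[n --> \oo] --> p x t by exact: (cvg_comp _ _ ux (cp t x)).
  by split; [exact: (cvg_comp _ _ pt (@continuous_cos R _))|exact: (cvg_comp _ _ pt (@continuous_sin R _))].
- by move=> n t _; rewrite cmodM cmod_expi mul1r.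
Qed.

End CintegralDct.

(** * Density of trigonometric polynomials *)

Section TrigPoly.
Context {R : realType}.
Notation mu := (@lebesgue_measure R).
Implicit Types (h : R) (f g w : R -> R[i]).

Lemma Rintegral_FTC (f F : R -> R) (a b : R) : a < b -> continuous f ->
  (forall x : R, is_derive x 1 F (f x)) ->
  \int[mu]_(x in `[a, b]) f x = F b - F a.
Proof.
move=> ab cf dF.
have cF : continuous F.
  move=> x; apply: differentiable_continuous; apply/derivable1_diffP.
  exact: (@ex_derive _ _ _ _ _ _ _ (dF x)).
rewrite /Rintegral (@continuous_FTC2 _ f F) //.
- exact: continuous_subspaceT.
- split.
  + by move=> x _; exact: (@ex_derive _ _ _ _ _ _ _ (dF x)).
  + exact/cvg_at_right_filter/cF.
  + exact/cvg_at_left_filter/cF.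
- by move=> x _; rewrite derive1E; exact: (@derive_val _ _ _ _ _ _ _ (dF x)).
Qed.

Lemma cell_ltr h : 0 < h -> - (pi / h) < (pi / h : R).
Proof. by move=> h0; rewrite gtrN // divr_gt0 // pi_gt0. Qed.

Lemma measurable_cell h : measurable (freq_cell h : set R).
Proof. exact: measurable_itv. Qed.

Lemma mu_cell h : 0 < h -> mu (freq_cell h) = (2 * pi / h)%:E.
Proof.
move=> h0; rewrite lebesgue_measure_itv /= lte_fin cell_ltr //.
by rewrite -EFinB; congr (_%:E); field; lra.
Qed.
Lemma mu_cell_lty h : 0 < h -> (mu (freq_cell h) < +oo)%E.
Proof. by move=> h0; rewrite mu_cell // ltry. Qed.

Lemma continuous_expi_Re (c : R) : continuous (fun x : R => cos (c * x)).
Proof.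
move=> x; apply: continuous_comp; last exact: continuous_cos.
exact: mulrl_continuous.
Qed.
Lemma continuous_expi_Im (c : R) : continuous (fun x : R => sin (c * x)).
Proof.
move=> x; apply: continuous_comp; last exact: continuous_sin.
exact: mulrl_continuous.
Qed.

Lemma cint_wave h (c : R) : 0 < h -> cint (freq_cell h) (fun x => expi (c * x)).
Proof.
move=> h0; apply: cint_L2; first exact: measurable_cell.
- exact: mu_cell_lty.
- by apply: cmeas_expi; exact: measurable_funM.
- apply: (@le_lt_trans _ _ (1%:E * mu (freq_cell h))%E); last first.
    by rewrite mul1e mu_cell_lty.
  apply: energy_bounded; [exact: measurable_cell|exact: mu_cell_lty| |].
    by apply: cmeas_expi; exact: measurable_funM.
  by move=> x _; rewrite sqn_expi.
Qed.

Lemma wave_orth h (k : int) : 0 < h ->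
  Cintegral (freq_cell h) (fun x => expi (h * k%:~R * x)) =
  (if k == 0 then 2 * pi / h else 0)%:C.
Proof.
move=> h0; case: eqP => [->|/eqP k0].
  rewrite (_ : Cintegral _ _ = Cintegral (freq_cell h) (fun=> 1)); last first.
    by apply: eq_Cintegral => x _; rewrite mulr0 mul0r expi0.
  apply: complexP; rewrite /= Rintegral_cst ?mul0r //; try exact: measurable_cell.
  by rewrite mul1r [X in fine X]mu_cell.
pose c : R := h * k%:~R; have c0 : c != 0 by rewrite mulf_neq0 ?intr_eq0 // lt0r_neq0.
have s0 : sin (c * (pi / h)) = 0.
  rewrite /c (_ : h * k%:~R * (pi / h) = k%:~R * pi); last by field; lra.
  case: k {k0 c c0} => n.
    by rewrite -pmulrn mulr_natl -(add0r (pi *+ n)) (alternatingn (@sinDpi R)) sin0 mulr0.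
  rewrite NegzE mulrNz mulNr sinN -pmulrn mulr_natl -(add0r (pi *+ _)).
  by rewrite (alternatingn (@sinDpi R)) sin0 mulr0 oppr0.
have d1 (x : R) : is_derive x 1 (fun x => c^-1 * sin (c * x)) (cos (c * x)).
  by apply: is_derive_eq; rewrite /GRing.scale /=; field.
have d2 (x : R) : is_derive x 1 (fun x => - c^-1 * cos (c * x)) (sin (c * x)).
  by apply: is_derive_eq; rewrite /GRing.scale /=; field.
apply: complexP => /=.
  rewrite [LHS](Rintegral_FTC (cell_ltr h0) (@continuous_expi_Re c) d1).
  by rewrite mulrN sinN s0 oppr0 mulr0 subrr.
rewrite [LHS](Rintegral_FTC (cell_ltr h0) (@continuous_expi_Im c) d2).
by rewrite mulrN cosN subrr.
Qed.

(** The sign of the exponent is that of the discrete transform, whose partial sums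
    are of this form. *)
Definition trig h (s : seq (int * R[i])) (x : R) : R[i] :=
  \sum_(p <- s) p.2 * expi (- (h * p.1%:~R * x)).

Definition is_trig h f : Prop := exists s, f =1 trig h s.

Lemma measurable_lin D (c : R) : measurable_fun D (fun x : R => c * x).
Proof. exact: measurable_funM. Qed.
Lemma measurable_wave D (c : R) : measurable_fun D (fun x : R => - (c * x)).
Proof. by apply: measurableT_comp => //; exact: measurable_funM. Qed.

Lemma cmeas_trig D h s : cmeas D (trig h s).
Proof.
apply: cmeas_sum => p; apply: cmeasM; first exact: cmeas_cst.
by apply: cmeas_expi; exact: measurable_wave.
Qed.

Lemma is_trigD h f g : is_trig h f -> is_trig h g -> is_trig h (fun x => f x + g x).
Proof. by move=> [s hs] [t ht]; exists (s ++ t) => x; rewrite /trig big_cat hs ht. Qed.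

Lemma is_trigZ h f (z : R[i]) : is_trig h f -> is_trig h (fun x => z * f x).
Proof.
move=> [s hs]; exists [seq (p.1, z * p.2) | p <- s] => x.
rewrite /trig big_map hs mulr_sumr; apply: eq_bigr => p _ /=.
by rewrite mulrA.
Qed.

Lemma is_trig_wave h f (m : int) : is_trig h f ->
  is_trig h (fun x => expi (- (h * m%:~R * x)) * f x).
Proof.
move=> [s hs]; exists [seq (p.1 + m, p.2) | p <- s] => x.
rewrite /trig big_map hs mulr_sumr; apply: eq_bigr => p _ /=.
rewrite mulrCA -expiD; congr (_ * expi _).
by rewrite rmorphD /=; ring.
Qed.

Lemma is_trig_eq h f g : f =1 g -> is_trig h f -> is_trig h g.
Proof. by move=> fg [s hs]; exists s => x; rewrite -fg hs. Qed.

(** Powers of (1 + cos(h x)) / 2 are nonnegative trigonometric polynomials that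
    concentrate at the origin once normalized; averaging against them approximates
    continuous functions by trigonometric polynomials. *)
Definition peak h (x : R) : R := (1 + cos (h * x)) / 2.

Lemma peak_ge0 h x : 0 <= peak h x.
Proof. by rewrite /peak divr_ge0 //; have := cos_geN1 (h * x); lra. Qed.
Lemma peak_le1 h x : peak h x <= 1.
Proof. by rewrite /peak; have := cos_le1 (h * x); lra. Qed.
Lemma peakN h x : peak h (- x) = peak h x.
Proof. by rewrite /peak mulrN cosN. Qed.
Lemma measurable_peakX (D : set R) h x n : measurable_fun D (fun y => peak h (x - y) ^+ n).
Proof.
apply: measurable_funX; apply: measurable_funM => //; apply: measurable_funD => //.
by apply: measurable_cos_comp; apply: measurable_funM => //; apply: measurable_funB.
Qed.

Lemma is_trig_peak h n : is_trig h (fun x => (peak h x ^+ n)%:C).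
Proof.
elim: n => [|n IH].
  exists [:: (0, 1)] => x; rewrite /trig big_seq1 /= mulr0 mul0r oppr0 expi0 mulr1.
  by rewrite expr0.
pose F := fun x => (peak h x ^+ n)%:C.
have h1 := is_trigZ (2^-1)%:C IH.
have h2 := is_trigZ (4^-1)%:C (is_trig_wave 1 IH).
have h3 := is_trigZ (4^-1)%:C (is_trig_wave (-1) IH).
apply: is_trig_eq (is_trigD h1 (is_trigD h2 h3)) => x /=.
rewrite exprS rmorphM /=; set B := (peak h x ^+ n)%:C.
set e1 := expi _; set e2 := expi _.
transitivity (((2^-1)%:C + (4^-1)%:C * (e1 + e2)) * B); first by ring.
congr (_ * _); rewrite /e1 /e2.
rewrite mulr1 mulrN1 mulNr opprK.
by apply: complexP; rewrite !cReImE /= !mul0r ?subr0 ?sinN ?cosN /peak; field.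
Qed.

End TrigPoly.

Section Kernel.
Context {R : realType}.
Notation mu := (@lebesgue_measure R).
Variable h : R.
Hypothesis h0 : 0 < h.
Implicit Types (g : R -> R).
Let cell : set R := freq_cell h.
Let mcell : measurable cell. Proof. exact: measurable_cell. Qed.
Let mucell : (mu cell < +oo)%E. Proof. exact: mu_cell_lty. Qed.

Lemma Cintegral_real D (u : R -> R) :
  Cintegral D (fun y => (u y)%:C) = (\int[mu]_(y in D) u y)%:C.
Proof. by apply: complexP => //=; rewrite /Rintegral /= integral0. Qed.

Lemma integrable_bounded g (M : R) : measurable_fun cell g ->
  (forall y, cell y -> `|g y| <= M) -> mu.-integrable cell (EFin \o g).
Proof.
move=> mg gM; apply: (@le_integrable_R _ _ _ (fun=> M)) => //.
exact: integrable_cst_R.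
Qed.

Lemma integrable_peak x n : mu.-integrable cell (EFin \o (fun y => peak h (x - y) ^+ n)).
Proof.
apply: (@integrable_bounded _ 1); first exact: measurable_peakX.
by move=> y _; rewrite ger0_norm ?exprn_ile1 ?exprn_ge0 ?peak_ge0 ?peak_le1.
Qed.

Lemma integrable_peakM g x n : mu.-integrable cell (EFin \o g) ->
  mu.-integrable cell (EFin \o (fun y => g y * peak h (x - y) ^+ n)).
Proof.
move=> ig; have mg : measurable_fun cell g by have /measurable_int/measurable_EFinP := ig.
apply: (@le_integrable_R _ _ _ (fun y => `|g y|)) => //.
- by apply: measurable_funM => //; exact: measurable_peakX.
- exact: integrable_norm.
- move=> y _; rewrite normrM ler_piMr // ger0_norm ?exprn_ge0 ?peak_ge0 //.
  by rewrite exprn_ile1 ?peak_ge0 ?peak_le1.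
Qed.

Lemma cint_real g : mu.-integrable cell (EFin \o g) -> cint cell (fun y => (g y)%:C).
Proof. by move=> ig; split => //; exact: integrable0. Qed.

(** A convolution with a trigonometric polynomial is one; the list s depends on
    n alone, so that the same identity serves all g. *)
Lemma peak_conv n : exists s : seq (int * R[i]),
  forall g, mu.-integrable cell (EFin \o g) -> forall x,
  (\int[mu]_(y in cell) (g y * peak h (x - y) ^+ n))%:C =
  trig h [seq (p.1, p.2 * Cintegral cell (fun y => expi (h * p.1%:~R * y) * (g y)%:C))
         | p <- s] x.
Proof.
have [s hs] := is_trig_peak h n; exists s => g ig x.
rewrite -Cintegral_real /trig big_map.
pose F (p : int * R[i]) y := (p.2 * expi (- (h * p.1%:~R * x))) *
                 (expi (h * p.1%:~R * y) * (g y)%:C).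
have iF p : cint cell (F p).
  apply: cintZ => //; apply: (@cint_expi _ _ _ (fun y => h * p.1%:~R * y)) => //.
    exact: measurable_lin.
  exact: cint_real.
transitivity (Cintegral cell (fun y => \sum_(p <- s) F p y)).
  apply: eq_Cintegral => y _; rewrite rmorphM /= hs /trig mulr_sumr.
  apply: eq_bigr => p _; rewrite /F.
  have -> : - (h * p.1%:~R * (x - y)) = - (h * p.1%:~R * x) + h * p.1%:~R * y by ring.
  by rewrite expiD; ring.
rewrite Cintegral_sum //; apply: eq_bigr => p _ /=.
rewrite /F CintegralZ //; first by ring.
by apply: (@cint_expi _ _ _ (fun y => h * p.1%:~R * y)) => //; [exact: measurable_lin|exact: cint_real].
Qed.

Definition mass n : R := \int[mu]_(y in cell) peak h (0 - y) ^+ n.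

Lemma integrable_1 : mu.-integrable cell (EFin \o (fun _ : R => 1 : R)).
Proof. exact: integrable_cst_R. Qed.

(** Only the frequency 0 survives integration over the cell, which is a full
    period; hence the integral does not see the translation by x. *)
Lemma peak_mass n x : \int[mu]_(y in cell) peak h (x - y) ^+ n = mass n.
Proof.
have [s hs] := peak_conv n.
have {}hs z := hs _ integrable_1 z.
suff H z : (\int[mu]_(y in cell) peak h (z - y) ^+ n)%:C =
    \sum_(p <- s) p.2 * (if p.1 == 0 then 2 * pi / h else 0)%:C.
  by have := H x; rewrite -(H 0) => -[].
transitivity ((\int[mu]_(y in cell) (1 * peak h (z - y) ^+ n))%:C : R[i]).
  by congr (_%:C); apply: eq_Rintegral => y _; rewrite mul1r.
rewrite hs /trig big_map; apply: eq_bigr => p _ /=.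
under eq_Cintegral do rewrite mulr1.
rewrite wave_orth //; case: eqP => [->|_]; last by rewrite mulr0 mul0r.
by rewrite mulr0 mul0r oppr0 expi0 mulr1.
Qed.

Lemma peak_le (a t : R) : 0 <= a -> a <= t -> t <= 2 * pi / h - a -> peak h t <= peak h a.
Proof.
move=> a0 at_ ta; rewrite /peak ler_pM2r ?invr_gt0 // lerD2l.
have ha : 0 <= h * a by rewrite mulr_ge0 // ltW.
have hat : h * a <= h * t by rewrite ler_pM2l.
have ht : h * t <= 2 * pi - h * a.
  have -> : 2 * pi - h * a = h * (2 * pi / h - a) by field; exact: lt0r_neq0.
  by rewrite ler_pM2l.
have pi0 := pi_gt0 R.
have key (u : R) : h * a <= u -> u <= pi -> cos u <= cos (h * a).
  move=> u1 u2; rewrite leNgt ltr_cos ?in_itv /= -?leNgt //.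
    by apply/andP; split; lra.
  by apply/andP; split; lra.
have [tp|tp] := leP (h * t) pi; first exact: key.
have -> : cos (h * t) = cos (2 * pi - h * t).
  by rewrite -cosN -(cosD2pi (- (h * t))) addrC mulr_natl.
by apply: key; lra.
Qed.

Lemma peak_lt (a t : R) : 0 <= a -> a < t -> t <= pi / h -> peak h t < peak h a.
Proof.
move=> a0 at_ ta; rewrite /peak ltr_pM2r ?invr_gt0 // ltrD2l.
have ha : 0 <= h * a by rewrite mulr_ge0 // ltW.
have hat : h * a < h * t by rewrite ltr_pM2l.
have ht : h * t <= pi.
  have -> : pi = h * (pi / h) by field; exact: lt0r_neq0.
  by rewrite ler_pM2l.
by rewrite ltr_cos ?in_itv //=; apply/andP; split; lra.
Qed.

Lemma mass_ge (d : R) n : 0 < d -> d <= pi / h -> 2 * d * peak h d ^+ n <= mass n.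
Proof.
move=> d0 dp; pose S : set R := `[- d, d]%classic.
have SC : S `<=` cell.
  by move=> y; rewrite /S /cell /freq_cell /= !in_itv /= => /andP[a b]; apply/andP; split; lra.
have mS : measurable S by exact: measurable_itv.
have muS : mu S = (2 * d)%:E.
  rewrite lebesgue_measure_itv /= lte_fin gtrN // -EFinB; congr (_%:E); ring.
rewrite -lee_fin /mass /Rintegral fineK; last exact: integrable_fin_num (integrable_peak 0 n).
apply: (@le_trans _ _ (\int[mu]_(y in S) (peak h (0 - y) ^+ n)%:E)%E); last first.
  apply: ge0_subset_integral => //.
    by apply/measurable_EFinP; exact: measurable_peakX.
  by move=> y _; rewrite lee_fin exprn_ge0 ?peak_ge0.
rewrite mulrC EFinM -muS -integral_cst //; apply: ge0_le_integral => //.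
- by move=> y _; rewrite lee_fin exprn_ge0 ?peak_ge0.
- by apply/measurable_EFinP; exact: measurable_peakX.
- move=> y; rewrite /S /= in_itv /= => /andP[y1 y2]; rewrite lee_fin.
  apply: lerXn2r; rewrite ?nnegrE ?peak_ge0 // sub0r peakN.
  wlog y0 : y y1 y2 / 0 <= y.
    move=> H; have [/H|/ltW y0] := leP 0 y; first exact.
    by rewrite -(peakN h y); apply: H; lra.
  apply: peak_le => //.
  have -> : 2 * pi / h = pi / h + pi / h by field; exact: lt0r_neq0.
  lra.
Qed.

Lemma mass_gt0 n : 0 < mass n.
Proof.
have pi0 := pi_gt0 R; pose d : R := pi / h / 2.
have ph : 0 < pi / h by rewrite divr_gt0.
have d0 : 0 < d by rewrite divr_gt0.
have dp : d < pi / h by rewrite /d; lra.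
apply: lt_le_trans (mass_ge n d0 (ltW dp)).
apply: mulr_gt0; [exact: mulr_gt0|apply: exprn_gt0].
by apply: le_lt_trans (peak_ge0 h (pi / h)) _; apply: peak_lt => //; lra.
Qed.

Definition avg n g x : R := (mass n)^-1 * \int[mu]_(y in cell) (g y * peak h (x - y) ^+ n).

Lemma is_trig_avg n g : mu.-integrable cell (EFin \o g) ->
  is_trig h (fun x => (avg n g x)%:C).
Proof.
move=> ig; have [s hs] := peak_conv n.
have H : is_trig h (fun x => (\int[mu]_(y in cell) (g y * peak h (x - y) ^+ n))%:C).
  by eexists => x; rewrite hs.
by apply: is_trig_eq (is_trigZ (mass n)^-1%:C H) => x; rewrite /avg rmorphM.
Qed.

Lemma avg_bound n g M x : measurable_fun cell g -> (forall y, cell y -> `|g y| <= M) ->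
  `|avg n g x| <= M.
Proof.
move=> mg gM; have ig := integrable_bounded mg gM.
rewrite /avg normrM ger0_norm ?invr_ge0 ?(ltW (mass_gt0 n)) //.
rewrite mulrC ler_pdivrMr ?mass_gt0 // (le_trans (le_normr_Rintegral _ (integrable_peakM _ _ ig))) //.
rewrite -(peak_mass n x) -RintegralZl //; last exact: integrable_peak.
apply: le_Rintegral => //.
- by apply: integrable_norm; exact: integrable_peakM.
- rewrite (_ : EFin \o _ = EFin \o (fun y => cst M y * peak h (x - y) ^+ n)) //.
  by apply: integrable_peakM; exact: integrable_cst_R.
- move=> y Dy; rewrite normrM (ger0_norm (exprn_ge0 _ (peak_ge0 _ _))).
  by rewrite ler_wpM2r ?exprn_ge0 ?peak_ge0 ?gM.
Qed.

Lemma avg_shift n g x (c : R) : mu.-integrable cell (EFin \o g) ->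
  avg n g x - c = avg n (fun y => g y - c) x.
Proof.
move=> ig; rewrite /avg.
rewrite -[X in _ - X](@mulfK _ (mass n)) ?lt0r_neq0 ?mass_gt0 //.
rewrite [X in _ - X]mulrC -mulrBr; congr (_ * _).
have ic : mu.-integrable cell (EFin \o (fun y => cst c y * peak h (x - y) ^+ n)).
  by apply: integrable_peakM; exact: integrable_cst_R.
rewrite -(peak_mass n x) -RintegralZl //; last exact: integrable_peak.
rewrite -RintegralB //; last exact: integrable_peakM.
by apply: eq_Rintegral => y _; rewrite /= mulrBl.
Qed.

End Kernel.

Section Density.
Context {R : realType}.
Notation mu := (@lebesgue_measure R).
Variable h : R.
Hypothesis h0 : 0 < h.
Implicit Types (g : R -> R).
Let cell : set R := freq_cell h.
Let mcell : measurable cell. Proof. exact: measurable_cell. Qed.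
Let mucell : (mu cell < +oo)%E. Proof. exact: mu_cell_lty. Qed.

(** Within distance d of x the function is small; farther away the normalized
    kernel is at most a constant times the ratio peak d / peak (d/2), raised to
    the power n, because the mass is at least that of [-d/2, d/2]. *)
Lemma avg_near n g x (K d e : R) : measurable_fun cell g ->
  (forall y, cell y -> `|g y| <= K) -> 0 <= e ->
  0 < d -> `|x| + d <= pi / h ->
  (forall y, cell y -> `|y - x| < d -> `|g y| <= e) ->
  `|avg h n g x| <= e + K * (2 * pi / h) / d * (peak h d / peak h (d / 2)) ^+ n.
Proof.
move=> mg gK e0 d0 xd ge.
have ig : mu.-integrable cell (EFin \o g) by exact: integrable_bounded gK.
have m0 := mass_gt0 h0 n.
have nx := normr_ge0 x.
have d2 : d / 2 <= pi / h by lra.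
have d20 : 0 < d / 2 by lra.
have p0 : 0 < peak h (d / 2).
  by apply: le_lt_trans (peak_ge0 h (pi / h)) _; apply: peak_lt => //; lra.
have K0 : 0 <= K.
  apply: le_trans (normr_ge0 (g 0)) (gK 0 _).
  rewrite /cell /freq_cell /= in_itv /=; apply/andP; split; lra.
have dd : 2 * pi / h = pi / h + pi / h by field; exact: lt0r_neq0.
have key : `|\int[mu]_(y in cell) (g y * peak h (x - y) ^+ n)| <=
    e * mass h n + K * peak h d ^+ n * (2 * pi / h).
  have igb := integrable_peakM x n ig.
  rewrite (le_trans (le_normr_Rintegral _ igb)) //.
  have -> : K * peak h d ^+ n * (2 * pi / h) = \int[mu]_(y in cell) (cst (K * peak h d ^+ n) y).
    by rewrite Rintegral_cst // [X in fine X]mu_cell.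
  rewrite -(peak_mass h0 n x) -RintegralZl //; last exact: integrable_peak.
  rewrite -RintegralD //; [|by apply: integrableZ_R => //; exact: integrable_peak|exact: integrable_cst_R].
  apply: le_Rintegral => //.
  - exact: integrable_norm.
  - apply: integrableD_R => //; last exact: integrable_cst_R.
    by apply: integrableZ_R => //; exact: integrable_peak.
  move=> y Cy; rewrite normrM (ger0_norm (exprn_ge0 _ (peak_ge0 _ _))) /=.
  have b0 := exprn_ge0 n (peak_ge0 h (x - y)).
  have b1 := exprn_ge0 n (peak_ge0 h d).
  have [yx|yx] := ltP `|y - x| d.
    apply: (@le_trans _ _ (e * peak h (x - y) ^+ n)).
      by rewrite ler_wpM2r // ge.
    by rewrite lerDl mulr_ge0.
  apply: (@le_trans _ _ (K * peak h d ^+ n)); last by rewrite lerDr mulr_ge0.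
  apply: ler_pM => //; first exact: gK.
  apply: lerXn2r; rewrite ?nnegrE ?peak_ge0 //.
  have -> : peak h (x - y) = peak h `|y - x|.
    by case: (ger0P (y - x)) => _; rewrite ?opprB // -opprB peakN.
  apply: peak_le => //; first exact: ltW.
  move: Cy; rewrite /cell /freq_cell /= in_itv /= => /andP[y1 y2].
  have := ler_normB y x; have : `|y| <= pi / h by rewrite ler_norml y1.
  by rewrite dd; lra.
rewrite /avg normrM ger0_norm ?invr_ge0 ?(ltW m0) // mulrC ler_pdivrMr //.
apply: (le_trans key); rewrite [leRHS]mulrDl. apply: lerD => //.
apply: (@le_trans _ _ (K * (2 * pi / h) / d * (peak h d / peak h (d / 2)) ^+ n *
   (2 * (d / 2) * peak h (d / 2) ^+ n))).
  rewrite (expr_div_n (peak h d) (peak h (d / 2))) le_eqVlt; apply/orP; left; apply/eqP.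
  have pn0 : peak h (d / 2) ^+ n != 0 by rewrite lt0r_neq0 // exprn_gt0.
  move: pn0; set A := peak h d ^+ n; set B := peak h (d / 2) ^+ n => pn0.
  by field; rewrite pn0 !lt0r_neq0.
rewrite ler_wpM2l ?mass_ge //.
apply: mulr_ge0; last by rewrite exprn_ge0 // divr_ge0 // peak_ge0.
apply: divr_ge0; last exact: ltW.
by apply: mulr_ge0 => //; rewrite dd; lra.
Qed.

Lemma avg_cvg g (M : R) x : continuous g -> (forall y, `|g y| <= M) ->
  `|x| < pi / h -> avg h n g x @[n --> \oo] --> g x.
Proof.
move=> cg gM xh.
have mg D : measurable_fun D g.
  by apply: measurable_funTS; exact: continuous_measurable_fun.
have ig : mu.-integrable cell (EFin \o g) by apply: integrable_bounded => //.
apply/cvgrPdist_le => e e0.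
have e2 : 0 < e / 2 by lra.
have /cvgrPdist_lt/(_ _ e2)/nbhs_ballP[d1 /= d10 hd] := cg x.
pose d := Num.min d1 (pi / h - `|x|).
have d0 : 0 < d by rewrite lt_min d10 subr_gt0.
have xd : `|x| + d <= pi / h.
  have : d <= pi / h - `|x| by rewrite ge_min lexx orbT.
  by lra.
have nx := normr_ge0 x.
have p0 : 0 < peak h (d / 2).
  by apply: le_lt_trans (peak_ge0 h (pi / h)) _; apply: peak_lt => //; lra.
pose r := peak h d / peak h (d / 2).
have r1 : `|r| < 1.
  rewrite ger0_norm ?divr_ge0 ?peak_ge0 // /r ltr_pdivrMr // mul1r.
  by apply: peak_lt => //; lra.
have [C hC] : exists C, C = (M + M) * (2 * pi / h) / d by eexists.
have /cvgrPdist_le/(_ _ e2) hr := cvg_geometric C r1.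
near=> n.
rewrite distrC (avg_shift h0) //.
have hg y : cell y -> `|g y - g x| <= M + M.
  by move=> _; rewrite (le_trans (ler_normB _ _)) // lerD.
have H := @avg_near n (fun y => g y - g x) x (M + M) d (e / 2) _ hg (ltW e2) d0 xd.
apply: (le_trans (H _ _)) => {H}.
- exact: measurable_funB.
- move=> y _ yx; apply: ltW; rewrite distrC; apply: hd.
  by rewrite /ball /= distrC (lt_le_trans yx) // ge_min lexx.
rewrite -hC -/r [leRHS]splitr lerD2l.
have : `|0 - geometric C r n| <= e / 2 by near: n.
by rewrite sub0r normrN /geometric /=; apply: le_trans; rewrite ler_norm.
Unshelve. all: by end_near. Qed.

Lemma energy_real (u : R -> R) D : energy D (fun x => (u x)%:C) =
  (\int[mu]_(x in D) (u x ^+ 2)%:E)%E.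
Proof. by apply: eq_integral => x _; rewrite sqnR. Qed.

(** The averages converge pointwise on the open cell and are bounded by the
    supremum of g, so dominated convergence applies; the two end points of the
    cell are a null set, and there the periodic averages need not converge. *)
Lemma trig_approx_cont g (M e : R) : continuous g -> (forall y, `|g y| <= M) ->
  0 < e -> exists2 T, is_trig h T & (energy cell (fun x => (g x)%:C - T x)%R <= e%:E)%E.
Proof.
move=> cg gM e0.
have mg D : measurable_fun D g.
  by apply: measurable_funTS; exact: continuous_measurable_fun.
have ig : mu.-integrable cell (EFin \o g) by apply: integrable_bounded => //.
have ma D n : measurable_fun D (avg h n g).
  have [s hs] := is_trig_avg n ig.
  have [+ _] := cmeas_trig D h s; apply: eq_measurable_fun => x _.
  by rewrite -hs.
pose ocell : set R := `]- (pi / h), pi / h[%classic.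
have mo : measurable ocell by exact: measurable_itv.
have V : vanish (fun n => \int[mu]_(x in ocell) ((g x - avg h n g x) ^+ 2)%:E)%E.
  have muo : (mu ocell < +oo)%E.
    apply: le_lt_trans mucell; apply: le_measure; rewrite ?inE //.
    by move=> x; rewrite /ocell /cell /freq_cell /= !in_itv /= => /andP[a b]; rewrite !ltW.
  apply: (@vanish_integral _ _ (fun n x => (g x - avg h n g x) ^+ 2) (cst ((M + M) ^+ 2))) => //.
  - exact: integrable_cst_R.
  - by move=> n; apply: measurable_funX; apply: measurable_funB; [exact: mg|exact: ma].
  - move=> n x _; rewrite sqr_ge0 /= -(real_normK (num_real _)); apply: lerXn2r; rewrite ?nnegrE //.
      by have := gM x; have := normr_ge0 (g x); lra.
    rewrite (le_trans (ler_normB _ _)) // lerD //.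
    by apply: avg_bound => //.
  - move=> x; rewrite /ocell /= in_itv /= => /andP[x1 x2].
    have c1 : g x - avg h n g x @[n --> \oo] --> 0.
      rewrite -[X in _ --> X](subrr (g x)); apply: cvgB; first exact: cvg_cst.
      by apply: avg_cvg gM _ => //; rewrite ltr_norml x1.
    rewrite -[X in _ --> X](mulr0 0); under eq_fun do rewrite expr2.
    exact: cvgM.
have [N _ HN] := V _ e0.
exists (fun x => (avg h N g x)%:C); first exact: is_trig_avg.
rewrite (_ : energy _ _ = energy cell (fun x => (g x - avg h N g x)%:C)); last first.
  by apply: eq_energy => x _; rewrite rmorphB.
rewrite energy_real [leLHS]integral_itv_bndoo; first exact: (HN N (leqnn N)).
by apply/measurable_EFinP; apply: measurable_funX; apply: measurable_funB; [exact: mg|exact: ma].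
Qed.

End Density.

Section L2Density.
Context {R : realType}.
Notation mu := (@lebesgue_measure R).
Variable h : R.
Hypothesis h0 : 0 < h.
Let cell : set R := freq_cell h.
Let mcell : measurable cell. Proof. exact: measurable_cell. Qed.
Let mucell : (mu cell < +oo)%E. Proof. exact: mu_cell_lty. Qed.

(** Truncation to [-M, M]; with absolute values, continuity and the Lipschitz
    bound are immediate. *)
Definition clamp (M x : R) : R := (`|x + M| - `|x - M|) / 2.

Lemma continuous_clamp M : continuous (clamp M).
Proof.
move=> x; apply: cvgM; last exact: cvg_cst.
by apply: cvgB; apply: cvg_norm; [apply: cvgD|apply: cvgB] => //; exact: cvg_cst.
Qed.

Lemma measurable_clamp M D (f : R -> R) : measurable_fun D f ->
  measurable_fun D (fun x => clamp M (f x)).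
Proof.
move=> mf; apply: (@measurableT_comp _ _ _ _ _ _ (clamp M)) => //.
by apply: continuous_measurable_fun; exact: continuous_clamp.
Qed.

Lemma clamp_bound M x : 0 <= M -> `|clamp M x| <= M.
Proof.
move=> M0; rewrite /clamp ler_norml.
by case: (ger0P (x + M)); case: (ger0P (x - M)) => *; apply/andP; split; lra.
Qed.

Lemma clamp_id M x : `|x| <= M -> clamp M x = x.
Proof.
rewrite ler_norml => /andP[x1 x2]; rewrite /clamp.
by rewrite ger0_norm ?ler0_norm; lra.
Qed.

Lemma clamp_lip M x y : `|clamp M x - clamp M y| <= `|x - y|.
Proof.
rewrite /clamp.
case: (ger0P (x + M)); case: (ger0P (x - M)); case: (ger0P (y + M));
case: (ger0P (y - M)) => *; rewrite ler_norml; apply/andP; split;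
case: (ger0P (x - y)) => *; lra.
Qed.

Lemma normr_clamp M x : 0 <= M -> `|clamp M x| <= `|x|.
Proof.
move=> M0; have := clamp_lip M x 0.
by rewrite (@clamp_id M 0) ?normr0 // !subr0.
Qed.

(** Approximation in L1 suffices: clamping the approximant keeps it within 2M of
    f, and |f - g|^2 <= 2M |f - g|. *)
Lemma cont_approx_bounded (f : R -> R) (M e : R) : measurable_fun cell f ->
  0 <= M -> (forall x, cell x -> `|f x| <= M) -> 0 < e ->
  exists g : R -> R, [/\ continuous g, forall x, `|g x| <= M &
    (energy cell (fun x => (f x)%:C - (g x)%:C)%R <= e%:E)%E].
Proof.
move=> mf M0 fM e0.
have fi : mu.-integrable cell (EFin \o f) by exact: integrable_bounded fM.
have [g_ [cg ig]] := approximation_continuous_integrable mcell mucell fi.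
move=> /cvg0_vanish H.
have e1 : 0 < e / (2 * M + 1) by rewrite divr_gt0 //; lra.
have {H} [n|N _ HN] := H _ _ e1; first by apply: integral_ge0.
have {HN} := HN N (leqnn N); set g := g_ N => HN.
have mg D : measurable_fun D g.
  by apply: measurable_funTS; apply: continuous_measurable_fun; exact: cg.
exists (fun x => clamp M (g x)); split.
- move=> x; apply: continuous_comp; [exact: cg|exact: continuous_clamp].
- by move=> x; exact: clamp_bound.
apply: (@le_trans _ _ ((2 * M)%:E * \int[mu]_(x in cell) `|(f x - g x)%:E|)%E).
  rewrite -ge0_integralZl_EFin //; last 2 first.
  - by apply/measurable_EFinP; apply: measurableT_comp => //; apply: measurable_funB; [exact: mf|exact: mg].
  - by rewrite mulr_ge0.
  apply: ge0_le_integral => //.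
  - by move=> x _; rewrite lee_fin sqn_ge0.
  - apply: measurable_esqn; apply: cmeasB; apply: cmeas_real => //.
    exact: measurable_clamp.
  - apply/measurable_EFinP; apply: measurable_funM => //; apply: measurableT_comp => //.
    apply: measurable_funB; [exact: mf|exact: mg].
  - move=> x Cx; rewrite /= lee_fin -rmorphB sqnR -(real_normK (num_real _)) expr2.
    apply: ler_pM => //.
      rewrite (le_trans (ler_normB _ _)) // mulr_natl mulr2n lerD ?fM //.
      exact: clamp_bound.
    by rewrite -{1}(clamp_id (fM _ Cx)); exact: clamp_lip.
apply: (@le_trans _ _ ((2 * M)%:E * (e / (2 * M + 1))%:E)%E).
  by apply: lee_wpmul2l => //; rewrite lee_fin mulr_ge0.
rewrite -EFinM lee_fin mulrCA; apply: ler_piMr; first exact: ltW.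
by rewrite ler_pdivrMr ?mul1r; lra.
Qed.

Lemma vanish_clamp (f : R -> R) : measurable_fun cell f ->
  (energy cell (fun x => (f x)%:C) < +oo)%E ->
  vanish (fun N => energy cell (fun x => (f x)%:C - (clamp N%:R (f x))%:C)%R).
Proof.
move=> mf ef.
have i2 := integrable_sqn mcell (cmeas_real mf) ef.
have mu' N : measurable_fun cell (fun x => sqn ((f x)%:C - (clamp N%:R (f x))%:C)).
  apply: measurable_sqn; apply: cmeasB; apply: cmeas_real => //.
  exact: measurable_clamp.
have bd N x : sqn ((f x)%:C - (clamp N%:R (f x))%:C) <= 4 * sqn ((f x)%:C : R[i]).
  rewrite (le_trans (sqnB_le _ _)) // !sqnR.
  have : clamp N%:R (f x) ^+ 2 <= f x ^+ 2.
    by rewrite -(real_normK (num_real (clamp _ _))) -(real_normK (num_real (f x)))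
      lerXn2r ?nnegrE ?normr_clamp.
  lra.
apply: (vanish_integral mcell (integrableZ_R 4 mcell i2) mu').
  by move=> N x _; rewrite sqn_ge0 bd.
move=> x _; apply: cvg_near_cst; near=> N.
by rewrite clamp_id ?subrr ?sqn0 //; near: N; exact: nbhs_infty_ger.
Unshelve. all: by end_near. Qed.

Lemma trig_approx_real (f : R -> R) (e : R) : measurable_fun cell f ->
  (energy cell (fun x => (f x)%:C) < +oo)%E -> 0 < e ->
  exists2 T, is_trig h T & (energy cell (fun x => (f x)%:C - T x)%R <= e%:E)%E.
Proof.
move=> mf ef e0.
have e1 : 0 < e / 16 by lra.
have [N _ HN] := vanish_clamp mf ef e1.
have {HN} HN := HN N (leqnn N).
have mc := measurable_clamp N%:R mf.
have [g [cg gN Hg]] := cont_approx_bounded mc (ler0n _ N)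
  (fun x _ => clamp_bound (f x) (ler0n _ N)) e1.
have [T tT HT] := trig_approx_cont h0 cg gN e1.
exists T => //.
have mg : measurable_fun cell g.
  by apply: measurable_funTS; exact: continuous_measurable_fun.
have mT : cmeas cell T.
  by have [s hs] := tT; apply: (cmeas_eq _ (cmeas_trig cell h s)) => x _; rewrite hs.
have c1 := cmeas_real mf; have c2 := cmeas_real mc; have c3 := cmeas_real mg.
apply: (le_trans (energy_triangle mcell c1 c2 mT)).
apply: (@le_trans _ _ (2%:E * (e / 16)%:E +
   2%:E * (2%:E * (e / 16)%:E + 2%:E * (e / 16)%:E))%E).
  apply: leeD; first by apply: lee_wpmul2l.
  apply: lee_wpmul2l => //; apply: (le_trans (energy_triangle mcell c2 c3 mT)).
  by apply: leeD; apply: lee_wpmul2l.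
by rewrite -!EFinM -?EFinD -?EFinM -?EFinD lee_fin; lra.
Qed.

Lemma trig_approx (w : R -> R[i]) (e : R) : cmeas cell w -> (energy cell w < +oo)%E ->
  0 < e ->
  exists2 T, is_trig h T & (energy cell (fun x => w x - T x)%R <= e%:E)%E.
Proof.
move=> mw ew e0; have [m1 m2] := mw.
have e1 : 0 < e / 4 by lra.
have f1 : (energy cell (fun x => (complex.Re (w x))%:C) < +oo)%E.
  apply: le_lt_trans ew; apply: le_energy => //.
  by move=> x _; rewrite sqnR /sqn lerDl sqr_ge0.
have f2 : (energy cell (fun x => (complex.Im (w x))%:C) < +oo)%E.
  apply: le_lt_trans ew; apply: le_energy => //.
  by move=> x _; rewrite sqnR /sqn lerDr sqr_ge0.
have [T1 t1 H1] := trig_approx_real m1 f1 e1.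
have [T2 t2 H2] := trig_approx_real m2 f2 e1.
have tc T : is_trig h T -> cmeas cell T.
  by move=> [s hs]; apply: (cmeas_eq _ (cmeas_trig cell h s)) => x _; rewrite hs.
exists (fun x => T1 x + (0 +i* 1) * T2 x); first by apply: is_trigD => //; exact: is_trigZ.
pose u1 x := (complex.Re (w x))%:C - T1 x.
pose u2 x := (0 +i* 1) * ((complex.Im (w x))%:C - T2 x).
have mu1 : cmeas cell u1 by apply: cmeasB; [exact: (cmeas_real m1)|exact: tc].
have mu2 : cmeas cell (fun x => (complex.Im (w x))%:C - T2 x).
  by apply: cmeasB; [exact: (cmeas_real m2)|exact: tc].
have mu2' : cmeas cell u2 by apply: cmeasM => //; exact: cmeas_cst.
rewrite (_ : energy _ _ = energy cell (fun x => u1 x + u2 x)); last first.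
  apply: eq_energy => x _; rewrite /u1 /u2.
  by apply: complexP; rewrite !cReImE /=; ring.
apply: (le_trans (energyD_le mcell mu1 mu2')).
rewrite /u2 energyZ // (_ : sqn _ = 1); last by rewrite /sqn /=; ring.
rewrite mul1e; apply: (@le_trans _ _ (2%:E * (e / 4)%:E + 2%:E * (e / 4)%:E)%E).
  by apply: leeD; apply: lee_wpmul2l.
by rewrite -!EFinM -!EFinD lee_fin; lra.
Qed.

End L2Density.

(** * Fourier series on the frequency cell *)

Section Parseval.
Context {R : realType}.
Notation mu := (@lebesgue_measure R).
Variable h : R.
Hypothesis h0 : 0 < h.
Let cell : set R := freq_cell h.
Let mcell : measurable cell. Proof. exact: measurable_cell. Qed.
Let mucell : (mu cell < +oo)%E. Proof. exact: mu_cell_lty. Qed.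
Implicit Types (w u v : R -> R[i]) (s : seq (int * R[i])) (m : int).

Definition coef w m : R[i] := Cintegral (freq_cell h) (fun x => expi (h * m%:~R * x) * w x).

Lemma cint_coef w m : cint cell w -> cint cell (fun x => expi (h * m%:~R * x) * w x).
Proof.
by move=> iw; apply: (@cint_expi _ _ _ (fun x => h * m%:~R * x)) => //; exact: measurable_lin.
Qed.

Lemma cint_trig s : cint cell (trig h s).
Proof.
apply: cint_sum => // p; apply: cintZ => //.
apply: (eq_cint mcell) (cint_wave (- (h * p.1%:~R)) h0) => x _.
by rewrite mulNr.
Qed.

Lemma wcoefD u v m : cint cell u -> cint cell v ->
  coef (fun x => u x + v x) m = coef u m + coef v m.
Proof.
move=> iu iv; rewrite /coef -CintegralD //; try exact: cint_coef.
by apply: eq_Cintegral => x _; rewrite mulrDr.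
Qed.
Lemma wcoefZ u z m : cint cell u -> coef (fun x => z * u x) m = z * coef u m.
Proof.
move=> iu; rewrite /coef -CintegralZ //; last exact: cint_coef.
by apply: eq_Cintegral => x _; rewrite mulrCA.
Qed.
Lemma wcoefB u v m : cint cell u -> cint cell v ->
  coef (fun x => u x - v x) m = coef u m - coef v m.
Proof.
move=> iu iv; rewrite /coef -CintegralB //; try exact: cint_coef.
by apply: eq_Cintegral => x _; rewrite mulrBr.
Qed.

Lemma coef_trig s m : coef (trig h s) m =
  \sum_(p <- s) p.2 * (if m == p.1 then 2 * pi / h else 0)%:C.
Proof.
pose F (p : int * R[i]) x := p.2 * expi (h * (m - p.1)%:~R * x).
have iF p : cint cell (fun x => expi (h * (m - p.1)%:~R * x)).
  exact: cint_wave.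
transitivity (Cintegral cell (fun x => \sum_(p <- s) F p x)).
  apply: eq_Cintegral => x _; rewrite /trig mulr_sumr; apply: eq_bigr => p _.
  rewrite /F mulrCA -expiD; congr (_ * expi _).
  by rewrite rmorphB /=; ring.
rewrite Cintegral_sum //; last by move=> p; exact: cintZ.
apply: eq_bigr => p _; rewrite /F CintegralZ // wave_orth //.
by rewrite subr_eq0.
Qed.

Definition fourier_seq w N : seq (int * R[i]) :=
  [seq (k%:Z - N%:Z, (h / (2 * pi))%:C * coef w (k%:Z - N%:Z)) | k <- iota 0 (2 * N).+1].

(** The Fourier sum of order N has the coefficients of w up to N, so the residue
    is orthogonal to all polynomials of that order. *)
Lemma coef_fourier_seq w N m : `|m| <= N%:Z -> coef (trig h (fourier_seq w N)) m = coef w m.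
Proof.
move=> mN; rewrite coef_trig big_map.
pose k0 := absz (m + N%:Z); have Hk : (k0 < (2 * N).+1)%N by rewrite /k0; lia.
have e : k0%:Z - N%:Z = m by rewrite /k0; lia.
rewrite (bigD1_seq k0) ?iota_uniq ?mem_iota //.
rewrite [(_, _).1]/= [(_, _).2]/=.
rewrite e eqxx big1 => [|k kk]; last first.
  rewrite /= (_ : (m == _) = false) ?mulr0 //.
  by apply/eqP => E; move/eqP: kk; apply; lia.
rewrite [LHS]addr0.
transitivity ((h / (2 * pi) * (2 * pi / h))%:C * coef w m).
  by rewrite rmorphM /=; ring.
have key (p : R) : p != 0 -> h / (2 * p) * (2 * p / h) = 1.
  by move=> p0; field; rewrite p0 lt0r_neq0.
rewrite key ?lt0r_neq0 ?pi_gt0 //.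
by rewrite mul1r.
Qed.

Lemma Re_cint D u : complex.Re (Cintegral D u) = \int[mu]_(x in D) complex.Re (u x).
Proof. by []. Qed.

Lemma conjc_meas D u : cmeas D u -> cmeas D (fun x => conjc (u x)).
Proof.
move=> [a b]; split.
  by apply: eq_measurable_fun a => x _; case: (u x).
by apply: eq_measurable_fun (measurableT_comp (@oppr_measurable _ setT) b) => x _;
  rewrite /=; case: (u x).
Qed.

Lemma sqn_conj (z : R[i]) : sqn (conjc z) = sqn z.
Proof. by case: z => a b; rewrite /sqn /= sqrrN. Qed.

Lemma energy_fin D u : cmeas D u -> measurable D -> (energy D u < +oo)%E ->
  energy D u = (\int[mu]_(x in D) sqn (u x))%:E.
Proof.
move=> mu' mD eu; rewrite /Rintegral fineK // ge0_fin_numE //.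
exact: (energy_ge0 D u).
Qed.

Lemma energy_conj D u : energy D (fun x => conjc (u x)) = energy D u.
Proof. by apply: eq_integral => x _; rewrite sqn_conj. Qed.

Lemma energyB_eq D u v : measurable D -> cmeas D u -> cmeas D v ->
  (energy D u < +oo)%E -> (energy D v < +oo)%E ->
  energy D (fun x => u x - v x) = (energy D u + energy D v -
    (2 * complex.Re (Cintegral D (fun x => u x * conjc (v x)))%R)%:E)%E.
Proof.
move=> mD mu' mv eu ev.
have iuv : cint D (fun x => u x * conjc (v x)).
  by apply: cintM_L2 => //; [exact: conjc_meas|rewrite energy_conj].
have euv : (energy D (fun x => u x - v x)%R < +oo)%E.
  apply: (le_lt_trans (energyB_le mD mu' mv)).
  by rewrite lte_add_pinfty // lte_mul_pinfty.
have i1 := integrable_sqn mD mu' eu; have i2 := integrable_sqn mD mv ev.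
rewrite (energy_fin mu' mD eu) (energy_fin mv mD ev) (energy_fin (cmeasB mu' mv) mD euv).
rewrite Re_cint -EFinD -?EFinB; congr (_%:E).
rewrite -RintegralZl //; last exact: iuv.1.
rewrite -RintegralD // -RintegralB //; last first.
- by apply: integrableZ_R => //; exact: iuv.1.
- exact: integrableD_R.
by apply: eq_Rintegral => x _; rewrite sqnB cdotE.
Qed.

Lemma coef_conj_trig u s : cint cell u ->
  Cintegral cell (fun x => u x * conjc (trig h s x)) =
  \sum_(p <- s) conjc p.2 * coef u p.1.
Proof.
move=> iu; pose F (p : int * R[i]) x := conjc p.2 * (expi (h * p.1%:~R * x) * u x).
transitivity (Cintegral cell (fun x => \sum_(p <- s) F p x)).
  apply: eq_Cintegral => x _; rewrite /trig rmorph_sum mulr_sumr; apply: eq_bigr => p _.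
  rewrite /F rmorphM mulrCA; congr (_ * _); rewrite mulrC; congr (_ * _).
  by apply: complexP => /=; rewrite ?cosN ?sinN ?opprK.
rewrite Cintegral_sum //; last by move=> p; apply: cintZ => //; exact: cint_coef.
by apply: eq_bigr => p _; rewrite /F CintegralZ //; exact: cint_coef.
Qed.

Lemma energy_trig_lty s : (energy cell (trig h s) < +oo)%E.
Proof.
apply: (@le_lt_trans _ _ (((\sum_(p <- s) cmod p.2) ^+ 2)%:E * mu cell)%E); last first.
  by rewrite lte_mul_pinfty // lee_fin sqr_ge0.
apply: energy_bounded => //; first exact: cmeas_trig.
move=> x _; rewrite -cmod_sqr; apply: lerXn2r; rewrite ?nnegrE ?cmod_ge0 //.
  by apply: sumr_ge0 => p _; exact: cmod_ge0.
apply: (le_trans (cmod_sum _ _ _)); apply: ler_sum => p _.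
by rewrite cmodM cmod_expi mulr1.
Qed.

Lemma trig_cat s1 s2 x : trig h (s1 ++ s2) x = trig h s1 x + trig h s2 x.
Proof. by rewrite /trig big_cat. Qed.

Lemma trig_opp s x : trig h [seq (p.1, - p.2) | p <- s] x = - trig h s x.
Proof. by rewrite /trig big_map -sumrN; apply: eq_bigr => p _; rewrite mulNr. Qed.

Lemma window_index (k N : nat) : (k < (2 * N).+1)%N -> `|k%:Z - N%:Z| <= N%:Z.
Proof. lia. Qed.

Lemma freq_bounded s : exists M : nat, forall p, p \in s -> `|p.1| <= M%:Z.
Proof.
elim: s => [|q s [M HM]]; first by exists 0%N.
exists (absz q.1 + M)%N => p; rewrite inE => /predU1P[->|/HM].
  by case: q => a b /=; lia.
by case: p => c d; case: q => a b /=; lia.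
Qed.

Section Projection.
Variable w : R -> R[i].
Hypothesis mw : cmeas cell w.
Hypothesis ew : (energy cell w < +oo)%E.

Let iw : cint cell w. Proof. exact: cint_L2. Qed.

Lemma energy_resid_lty N : (energy cell (fun x => w x - trig h (fourier_seq w N) x)%R < +oo)%E.
Proof.
apply: (le_lt_trans (energyB_le mcell mw (cmeas_trig cell h _))).
by rewrite lte_add_pinfty // lte_mul_pinfty // energy_trig_lty.
Qed.

Lemma coef_resid N m : `|m| <= N%:Z -> coef (fun x => w x - trig h (fourier_seq w N) x) m = 0.
Proof. by move=> mN; rewrite wcoefB ?coef_fourier_seq ?subrr //; exact: cint_trig. Qed.

Lemma pythagoras N s : (forall p, p \in s -> `|p.1| <= N%:Z) ->
  energy cell (fun x => w x - trig h s x) =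
  (energy cell (fun x => w x - trig h (fourier_seq w N) x)%R +
   energy cell (fun x => trig h (fourier_seq w N) x - trig h s x)%R)%E.
Proof.
move=> sN; pose t := s ++ [seq (p.1, - p.2) | p <- fourier_seq w N].
have te x : trig h t x = trig h s x - trig h (fourier_seq w N) x.
  by rewrite trig_cat trig_opp.
pose u x := w x - trig h (fourier_seq w N) x.
have mu' : cmeas cell u by apply: cmeasB => //; exact: cmeas_trig.
have eu : (energy cell u < +oo)%E by exact: energy_resid_lty.
have iu : cint cell u by exact: cint_L2.
have tN p : p \in t -> `|p.1| <= N%:Z.
  rewrite mem_cat => /orP[/sN//|/mapP[q + ->]] /=.
  by move=> /mapP[k]; rewrite mem_iota => /andP[_ k2] -> /=; lia.
rewrite (_ : energy cell (fun x => w x - trig h s x) =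
             energy cell (fun x => u x - trig h t x)); last first.
  by apply: eq_energy => x _; rewrite te /u; ring.
rewrite energyB_eq //; [|exact: cmeas_trig|exact: energy_trig_lty].
rewrite coef_conj_trig // big_seq big1 => [|p pt]; last first.
  by rewrite coef_resid ?mulr0 ?tN.
rewrite mulr0 sube0; congr (_ + _)%E.
by rewrite energyBC; apply: eq_energy => x _; rewrite te.
Qed.

Lemma energy_fourier_seq N : energy cell (trig h (fourier_seq w N)) =
  (h / (2 * pi) * \sum_(k < (2 * N).+1) sqn (coef w (k%:Z - N%:Z)))%:E.
Proof.
have mt := cmeas_trig cell h (fourier_seq w N); have et := energy_trig_lty (fourier_seq w N).
rewrite energy_fin //; congr (_%:E).
transitivity (complex.Re (Cintegral cell (fun x =>
    trig h (fourier_seq w N) x * conjc (trig h (fourier_seq w N) x)))).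
  rewrite Re_cint; apply: eq_Rintegral => x _; rewrite -cdotE.
  by rewrite /cdot /sqn !expr2.
rewrite coef_conj_trig; last exact: cint_trig.
rewrite cRe_sum big_map -(big_mkord xpredT (fun k => sqn (coef w (k%:Z - N%:Z)))).
rewrite /index_iota subn0 mulr_sumr big_seq [RHS]big_seq; apply: eq_bigr => k.
rewrite mem_iota => /andP[_ k2]; rewrite [X in coef _ X]/= coef_fourier_seq; last exact: window_index.
by rewrite /sqn; case: (coef w _) => a b /=; ring.
Qed.

(** Parseval with a remainder: the squared coefficients up to order N account for
    the energy of w except for that of the residue. *)
Lemma energy_split N : energy cell w =
  (energy cell (fun x => w x - trig h (fourier_seq w N) x)%R +
  (h / (2 * pi) * \sum_(k < (2 * N).+1) sqn (coef w (k%:Z - N%:Z)))%:E)%E.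
Proof.
have := @pythagoras N [::]; rewrite -energy_fourier_seq => H.
rewrite (_ : energy cell w = energy cell (fun x => w x - trig h [::] x)); last first.
  by apply: eq_energy => x _; rewrite /trig big_nil subr0.
rewrite H //; congr (_ + _)%E.
by apply: eq_energy => x _; rewrite /trig big_nil subr0.
Qed.

(** By the Pythagorean identity the Fourier sums are the best approximations, so
    density of trigonometric polynomials gives completeness. *)
Lemma vanish_resid : vanish (fun N => energy cell (fun x => w x - trig h (fourier_seq w N) x)%R).
Proof.
move=> e e0; have [T [s hs] HT] := trig_approx h0 mw ew e0.
have [M sM] := freq_bounded s.
near=> N; apply: le_trans HT.
have MN : (M <= N)%N by near: N; exact: nbhs_infty_ge.
have sN p : p \in s -> `|p.1| <= N%:Z by move=> /sM; lia.
rewrite (_ : energy cell (fun x => w x - T x) = energy cell (fun x => w x - trig h s x)); last first.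
  by apply: eq_energy => x _; rewrite hs.
by rewrite (pythagoras sN) leeDl //; exact: energy_ge0.
Unshelve. all: by end_near. Qed.

End Projection.
End Parseval.

Section DftCoef.
Context {R : realType}.
Notation mu := (@lebesgue_measure R).
Variable h : R.
Hypothesis h0 : 0 < h.
Let cell : set R := freq_cell h.
Let mcell : measurable cell. Proof. exact: measurable_cell. Qed.
Let mucell : (mu cell < +oo)%E. Proof. exact: mu_cell_lty. Qed.
Implicit Types (w : R -> R[i]) (V : int -> R[i]).

Definition rt2pi : R := Num.sqrt (2 * pi).
Lemma rt2pi_gt0 : 0 < rt2pi.
Proof. by rewrite sqrtr_gt0 mulr_gt0 // pi_gt0. Qed.
Lemma rt2pi_sqr : rt2pi * rt2pi = 2 * pi.
Proof. by rewrite -expr2 sqr_sqrtr // mulr_ge0 // pi_ge0. Qed.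
Lemma rt2pi_invM : rt2pi^-1 * rt2pi^-1 = (2 * pi)^-1.
Proof. by rewrite -invfM rt2pi_sqr. Qed.

Definition has_coef V w : Prop := forall m, V m = (rt2pi^-1)%:C * coef h w m.

Lemma dft_partial V w N x : has_coef V w ->
  dft_const h * psumZ (dft_term h V x) N = trig h (fourier_seq h w N) x.
Proof.
move=> Vw; rewrite /trig /fourier_seq big_map /psumZ.
rewrite -(big_mkord xpredT (fun k : nat => dft_term h V x (k%:Z - N%:Z))).
rewrite /index_iota subn0 mulr_sumr; apply: eq_bigr => k _ /=.
rewrite /dft_term Vw /dft_const -/rt2pi.
have -> : (h / (2 * pi))%:C = (h / rt2pi)%:C * (rt2pi^-1)%:C :> R[i].
  by rewrite -rmorphM /= -mulrA rt2pi_invM.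
by ring.
Qed.

(** The partial sums of the discrete transform are the Fourier sums of w, which
    converge to w by completeness. *)
Lemma is_dft_coef V w : cmeas cell w -> (energy cell w < +oo)%E ->
  has_coef V w -> is_dft h V w.
Proof.
move=> mw ew Vw; split; first by apply/in_L2P.
apply/L2norm_cvg0 => //.
rewrite (_ : (fun N => _) = (fun N => energy cell (fun x => w x - trig h (fourier_seq h w N) x)%R)).
  exact: vanish_resid.
by apply/funext => N; apply: eq_energy => x _; rewrite (dft_partial _ _ Vw).
Qed.

Lemma cmeas_psum V N : cmeas cell (fun x => dft_const h * psumZ (dft_term h V x) N).
Proof.
apply: cmeasM; first exact: cmeas_cst.
apply: cmeas_sum => k; apply: cmeasM; last exact: cmeas_cst.
by apply: cmeas_expi; exact: measurable_wave.
Qed.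

Lemma is_dft_unique V w w' : is_dft h V w -> is_dft h V w' ->
  energy cell (fun x => w x - w' x) = 0%E.
Proof.
move=> [/in_L2P-/(_ mcell)[mw ew] /L2norm_cvg0-/(_ mcell) H].
move=> [/in_L2P-/(_ mcell)[mw' ew'] /L2norm_cvg0-/(_ mcell) H'].
apply/eqP; rewrite eq_le energy_ge0 andbT.
apply: (vanish_squeeze _ (vanishD (vanishZ (ler0n _ 2) H) (vanishZ (ler0n _ 2) H'))) => N.
rewrite [X in (_ <= _ + _ * X)%E]energyBC.
by apply: energy_triangle => //; exact: cmeas_psum.
Qed.

Lemma dftP V w : is_dft h V w -> is_dft h V (dft h V).
Proof. by move=> H; rewrite /dft; case: xgetP => [y -> //|/(_ w)]; case. Qed.

(** The chosen transform agrees with w almost everywhere, which is all that the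
    integral defining the interpolant sees. *)
Lemma interpolantE V w x : is_dft h V w ->
  interpolant h V x = (rt2pi^-1)%:C * Cintegral cell (fun xi => expi (x * xi) * w xi).
Proof.
move=> H; rewrite /interpolant; congr (_ * _).
have H' := dftP H; have e := is_dft_unique H' H.
have [/in_L2P-/(_ mcell)[mw _] _] := H; have [/in_L2P-/(_ mcell)[mw' _] _] := H'.
have := energy0_ae mcell (cmeasB mw' mw) e.
have me : cmeas cell (fun xi => expi (x * xi)) by apply: cmeas_expi; exact: measurable_lin.
move=> h1; apply: ae_eq_Cintegral => //; [exact: cmeasM|exact: cmeasM|].
by apply: ae_imp h1 => y /= hy Dy; have /subr0_eq-> := hy Dy.
Qed.

End DftCoef.

(** * Plancherel's identity and duality *)

Section PlancherelCompact.
Context {R : realType}.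
Notation mu := (@lebesgue_measure R).
Variable h : R.
Hypothesis h0 : 0 < h.
Let cell : set R := freq_cell h.
Let mcell : measurable cell. Proof. exact: measurable_cell. Qed.
Let mucell : (mu cell < +oo)%E. Proof. exact: mu_cell_lty. Qed.
Implicit Types (v : R -> R[i]).

Lemma cmeas_fourier_on v : cint cell v -> cmeas setT (fourier_on cell v).
Proof.
move=> iv; have [||cr ci] := @continuous_Cintegral_expi _ cell (fun x t => - (t * x)) v
  (Num.sqrt (2 * pi))^-1%:C mcell _ _ iv; last exact: continuous_cmeas cr ci.
- by move=> x; apply: measurableT_comp => //; exact: measurable_funM.
- by move=> t x; apply: cvgN; apply: cvgM => //; exact: cvg_cst.
Qed.

(* The Fourier coefficients of the modulation are samples of the transform of v
   on the translated grid x + h Z. *)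
Let modul v (x : R) t := expi (- (t * x)) * v t.

Lemma coef_modul v x m : cint cell v ->
  coef h (modul v x) m = (rt2pi : R)%:C * fourier_on cell v (x + (- m)%:~R * h).
Proof.
move=> iv; rewrite /fourier_on -/rt2pi mulrA -rmorphM /= divff ?lt0r_neq0 ?rt2pi_gt0 // mul1r.
apply: eq_Cintegral => t _; rewrite /modul mulrA -expiD; congr (expi _ * _).
by rewrite rmorphN /=; ring.
Qed.

Lemma energy_modul v x : energy cell (modul v x) = energy cell v.
Proof. by apply: eq_integral => t _; rewrite sqnM sqn_expi mul1r. Qed.

Lemma cmeas_modul v x : cmeas cell v -> cmeas cell (modul v x).
Proof.
move=> mv; apply: cmeasM => //; apply: cmeas_expi.
by apply: measurableT_comp => //; exact: measurable_funM.
Qed.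

Section OneFunction.
Variable v : R -> R[i].
Hypothesis mv : cmeas cell v.
Hypothesis ev : (energy cell v < +oo)%E.
Let iv : cint cell v. Proof. exact: cint_L2. Qed.
Let F := fourier_on cell v.
Let E : R := \int[mu]_(x in cell) sqn (v x).
Let P N x : R := \sum_(k < (2 * N).+1) sqn (F (x + (k%:Z - N%:Z)%:~R * h)).

Let energy_E : energy cell v = E%:E. Proof. exact: energy_fin. Qed.

Let P_split N x : (E%:E = energy cell (fun t => modul v x t -
    trig h (fourier_seq h (modul v x) N) t)%R + (h * P N x)%:E)%E.
Proof.
rewrite -energy_E -(energy_modul v x).
rewrite (energy_split h0 (cmeas_modul x mv) _ N); last by rewrite energy_modul.
congr (_ + _%:E)%E; rewrite /P.
rewrite (psum_rev (fun m => sqn (coef h (modul v x) m))) !mulr_sumr.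
apply: eq_bigr => k _; rewrite coef_modul // opprK sqnM sqnR expr2 rt2pi_sqr mulrA.
by congr (_ * _); rewrite divfK // lt0r_neq0 // mulr_gt0 // pi_gt0.
Qed.

Let P_le N x : h * P N x <= E.
Proof.
rewrite -lee_fin (P_split N x) leeDr //; exact: energy_ge0.
Qed.

Let P_ge0 N x : 0 <= P N x.
Proof. by apply: sumr_ge0 => k _; exact: sqn_ge0. Qed.

Let P_cvg x : P N x @[N --> \oo] --> E / h.
Proof.
apply/cvgrPdist_le => e e0.
have he : 0 < h * e by rewrite mulr_gt0.
have := vanish_resid h0 (cmeas_modul x mv); rewrite energy_modul => /(_ ev _ he).
apply: filterS => N /= H.
have EP : E - h * P N x <= h * e.
  rewrite -lee_fin EFinB (P_split N x) addeK //.
have := P_le N x => PE.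
rewrite ger0_norm; last by rewrite subr_ge0 ler_pdivlMr // mulrC.
by rewrite -(ler_pM2l h0) mulrBr mulrCA divff ?lt0r_neq0 // mulr1.
Qed.

Lemma measurable_sqnF : measurable_fun setT (fun x => sqn (F x)).
Proof. by apply: measurable_sqn; exact: cmeas_fourier_on. Qed.

Let mshift (c : R) : measurable_fun setT (fun x : R => sqn (F (x + c))).
Proof.
apply: (@measurableT_comp _ _ _ _ _ _ (fun x => sqn (F x))); first exact: measurable_sqnF.
exact: measurable_shift.
Qed.

Let mP N (D : set R) : measurable_fun D (P N).
Proof.
apply: measurable_funTS; apply: measurable_sum => k; exact: mshift.
Qed.

(** Parseval for the modulation of v by x says that h times the sum of the squared
    samples of the transform on x + h Z is the energy of v.  Averaging over x in
    [0, h[ turns the sum over the grid into the integral over the line. *)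
Lemma plancherel_compact : energy setT F = energy cell v.
Proof.
rewrite energy_E; pose T0 : set R := tile 0 h.
have mT0 : measurable T0 by exact: measurable_tile.
have muT0 : mu T0 = h%:E.
  by rewrite lebesgue_measure_itv /= add0r lte_fin h0 sube0.
have E0 : 0 <= E by rewrite -lee_fin -energy_E; exact: energy_ge0.
have iE : mu.-integrable T0 (EFin \o (fun _ : R => E / h)).
  by apply: integrable_cst_R => //; rewrite muT0 ltry.
have c1 := @ge0_integral_window R 0 h (fun x => (sqn (F x))%:E) h0
   ((measurable_EFinP _ _).2 measurable_sqnF) (fun x => sqn_ge0 _).
have e1 N : (\sum_(k < (2 * N).+1)
     \int[mu]_(x in tile 0 h) (sqn (F (x + (k%:Z - N%:Z)%:~R * h)))%:E)%E =
     (\int[mu]_(x in T0) P N x)%:E.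
  rewrite -ge0_integral_sum //; last 2 first.
  - by move=> k; apply/measurable_EFinP; apply: measurable_funTS; exact: mshift.
  - by move=> k x _; rewrite lee_fin sqn_ge0.
  rewrite /Rintegral fineK; last first.
    apply: (@integrable_fin_num _ _ _ mu) => //.
    apply: (le_integrable_R mT0 _ iE) => // x _.
    by rewrite ger0_norm ?P_ge0 // ler_pdivlMr // mulrC; exact: P_le.
  by apply: eq_integral => x _; rewrite sumEFin.
move: c1; under eq_fun do rewrite e1.
move=> c1; have c2 : \int[mu]_(x in T0) P N x @[N --> \oo] --> \int[mu]_(x in T0) (cst (E / h) x).
  apply: (@Rintegral_dct _ _ _ _ (fun=> E / h)) => // N x _.
  by rewrite ger0_norm ?P_ge0 // ler_pdivlMr // mulrC; exact: P_le.
have c3 : (\int[mu]_(x in T0) P N x)%:E @[N --> \oo] --> E%:E.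
  apply: cvg_EFin; first exact: nearW.
  move: c2; rewrite Rintegral_cst // [X in fine X]muT0 /= divfK ?lt0r_neq0 //.
exact: (cvg_unique _ c1 c3).
Qed.

End OneFunction.

Definition inv_on v x : R[i] :=
  (rt2pi^-1)%:C * Cintegral cell (fun t => expi (x * t) * v t).

Lemma Cintegral_conj D v : measurable D -> cint D v ->
  conjc (Cintegral D v) = Cintegral D (fun t => conjc (v t)).
Proof.
move=> mD [a b]; apply: complexP => /=.
  by apply: eq_Rintegral => t _; case: (v t).
rewrite -mulN1r -RintegralZl //; apply: eq_Rintegral => t _.
by case: (v t) => x y /=; rewrite mulN1r.
Qed.

Lemma cint_conj D v : measurable D -> cint D v -> cint D (fun t => conjc (v t)).
Proof.
move=> mD iv; apply: (cint_bound mD _ (integrable_cmod mD iv)).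
  by apply: conjc_meas; exact: cint_cmeas.
by move=> x _; rewrite !cmodE sqn_conj.
Qed.

Lemma conjc_mul (z w : R[i]) : conjc (z * w) = conjc z * conjc w.
Proof. exact: rmorphM. Qed.

Lemma conj_expi (x : R) : conjc (expi x) = expi (- x).
Proof. by rewrite /expi cosN sinN. Qed.

Lemma inv_onE v x : cint cell v ->
  inv_on v x = conjc (fourier_on cell (fun t => conjc (v t)) x).
Proof.
move=> iv; rewrite /fourier_on -/rt2pi conjc_mul; congr (_ * _).
  by apply: complexP => //=; rewrite oppr0.
rewrite Cintegral_conj //; last first.
  apply: (@cint_expi _ _ _ (fun t => - (t * x))) => //; last exact: cint_conj.
  by apply: measurableT_comp => //; exact: measurable_funM.
apply: eq_Cintegral => t _; by rewrite conjc_mul conjcK conj_expi opprK (mulrC t).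
Qed.

Lemma cmeas_inv_on v : cint cell v -> cmeas setT (inv_on v).
Proof.
move=> iv; apply: (@cmeas_eq _ _ (fun x => conjc (fourier_on cell (fun t => conjc (v t)) x))).
  by move=> x _; rewrite inv_onE.
by apply: conjc_meas; apply: cmeas_fourier_on; exact: cint_conj.
Qed.

Lemma plancherel_inv v : cmeas cell v -> (energy cell v < +oo)%E ->
  energy setT (inv_on v) = energy cell v.
Proof.
move=> mv ev; have iv : cint cell v by exact: cint_L2.
rewrite (eq_energy (fun x _ => inv_onE x iv)) energy_conj plancherel_compact.
- by rewrite energy_conj.
- exact: conjc_meas.
- by rewrite energy_conj.
Qed.

End PlancherelCompact.

Section Duality.
Context {R : realType}.
Notation mu := (@lebesgue_measure R).
Implicit Types (a b f g : R -> R[i]).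

Lemma Cintegral_cut D g f : Cintegral setT (fun x => g x * cutoff D f x) =
  Cintegral D (fun x => g x * f x).
Proof.
apply: complexP => /=; rewrite [RHS]Rintegral_mkcond; apply: eq_Rintegral => x _;
  by rewrite /cutoff /patch; case: ifP => // _; rewrite mulr0.
Qed.

Lemma cint_cut D f : measurable D -> cint D f -> cint setT (cutoff D f).
Proof.
move=> mD [a b].
have key (u : R -> R) : mu.-integrable D (EFin \o u) ->
    mu.-integrable setT (EFin \o (u \_ D)).
  move=> iu; rewrite -restrict_EFin.
  by have [h _] := @integrable_mkcond _ _ _ mu D (EFin \o u) mD; exact: h.
split; [move: (key _ a)|move: (key _ b)]; apply: eq_integrable => // x _ /=;
  by rewrite /patch /cutoff; case: ifP.
Qed.

Section FubiniKernel.
Variables a b : R -> R[i].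
Hypotheses (ia : cint setT a) (ib : cint setT b).

Let k (z : R * R) : R :=
  complex.Re (expi (- (z.1 * z.2)) * a z.1 * conjc (b z.2)).

Let kE z : k z = (cos (z.1 * z.2) * complex.Re (a z.1) + sin (z.1 * z.2) * complex.Im (a z.1)) *
   complex.Re (b z.2) +
   (cos (z.1 * z.2) * complex.Im (a z.1) - sin (z.1 * z.2) * complex.Re (a z.1)) *
   complex.Im (b z.2).
Proof.
rewrite /k; case: (a z.1) => x y; case: (b z.2) => u v.
by rewrite !cReImE /= cosN sinN; ring.
Qed.

Let mk : measurable_fun setT k.
Proof.
have [ma1 ma2] := cint_cmeas ia; have [mb1 mb2] := cint_cmeas ib.
have m12 : measurable_fun setT (fun z : R * R => z.1 * z.2) by exact: measurable_funM.
have mc := measurable_cos_comp m12; have ms := measurable_sin_comp m12.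
have n1 : measurable_fun setT (fun z : R * R => complex.Re (a z.1)).
  exact: (measurableT_comp ma1 measurable_fst).
have n2 : measurable_fun setT (fun z : R * R => complex.Im (a z.1)).
  exact: (measurableT_comp ma2 measurable_fst).
have n3 : measurable_fun setT (fun z : R * R => complex.Re (b z.2)).
  exact: (measurableT_comp mb1 measurable_snd).
have n4 : measurable_fun setT (fun z : R * R => complex.Im (b z.2)).
  exact: (measurableT_comp mb2 measurable_snd).
rewrite (funext kE).
apply: measurable_funD; apply: measurable_funM => //.
  by apply: measurable_funD; exact: measurable_funM.
by apply: measurable_funB; exact: measurable_funM.
Qed.

Let k_le x y : `|k (x, y)| <= cmod (a x) * cmod (b y).
Proof.
rewrite /k /= (le_trans (ler_Re_cmod _)) // !cmodM cmod_expi mul1r.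
by rewrite [X in _ * X]cmodE sqn_conj -cmodE.
Qed.

Let mkx x : measurable_fun setT (fun y => k (x, y)).
Proof. by apply: (measurableT_comp mk); exact: measurable_pair1. Qed.

Let ik : (mu \x mu)%E.-integrable setT (EFin \o k).
Proof.
apply/integrable12ltyP; first exact/measurable_EFinP.
have Ia := integrable_cmod measurableT ia; have Ib := integrable_cmod measurableT ib.
pose IA := (\int[mu]_x (cmod (a x))%:E)%E; pose IB := (\int[mu]_x (cmod (b x))%:E)%E.
have IAf : IA \is a fin_num by exact: integrable_fin_num Ia.
have IBf : IB \is a fin_num by exact: integrable_fin_num Ib.
have IB0 : (0 <= IB)%E by apply: integral_ge0 => x _; rewrite lee_fin cmod_ge0.
have ma := measurable_cmod (cint_cmeas ia); have mb := measurable_cmod (cint_cmeas ib).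
apply: (@le_lt_trans _ _ (IA * IB)%E); last first.
  by rewrite -(fineK IAf) -(fineK IBf) -EFinM ltry.
rewrite /IA -ge0_integralZr //; last 2 first.
- exact/measurable_EFinP.
- by move=> x _; rewrite lee_fin cmod_ge0.
apply: ge0_le_integral => //.
- by move=> x _; apply: integral_ge0.
- have mak : measurable_fun setT (fun z => `|(k z)%:E|%E).
    by apply: measurableT_comp => //; exact/measurable_EFinP.
  have ak0 z : (0 <= `|(k z)%:E|)%E by [].
  exact: (@measurable_fun_fubini_tonelli_F _ _ _ _ R mu _ mak ak0).
- by apply: emeasurable_funM => //; exact/measurable_EFinP.
move=> x _; rewrite /IB -ge0_integralZl //; last 3 first.
- exact/measurable_EFinP.
- by move=> y _; rewrite lee_fin cmod_ge0.
- by rewrite lee_fin cmod_ge0.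
apply: ge0_le_integral => //.
- apply: measurableT_comp => //; apply/measurable_EFinP; exact: mkx.
- by apply: emeasurable_funM => //; exact/measurable_EFinP.
- by move=> y _; rewrite /= -EFinM lee_fin k_le.
Qed.

Lemma fubini_pairing :
  complex.Re (Cintegral setT (fun x => a x * conjc (Cintegral setT (fun y => expi (x * y) * b y)))) =
  complex.Re (Cintegral setT (fun y => Cintegral setT (fun x => expi (- (x * y)) * a x) * conjc (b y))).
Proof.
have ie (u : R -> R[i]) (c : R) : cint setT u -> cint setT (fun t => expi (c * t) * u t).
  move=> iu; apply: (@cint_expi _ _ _ (fun t => c * t)) => //; exact: measurable_lin.
rewrite !Re_cint /Rintegral; congr fine.
have := Fubini ik; rewrite /= => FB.
transitivity (\int[mu]_x \int[mu]_y (k (x, y))%:E)%E; last rewrite FB.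
  apply: eq_integral => x _.
  have ix := ie b x ib.
  transitivity ((complex.Re (a x *
      conjc (Cintegral setT (fun y => expi (x * y) * b y))))%:E); first by [].
  rewrite Cintegral_conj // -CintegralZ //; last exact: cint_conj.
  rewrite Re_cint /Rintegral fineK; last first.
    apply: (@integrable_fin_num _ _ _ mu) => //.
    exact: (cintZ (a x) measurableT (cint_conj measurableT ix)).1.
  apply: eq_integral => y _; congr (_%:E); rewrite /k conjc_mul conj_expi /=.
  by congr complex.Re; ring.
apply: eq_integral => y _.
have iy : cint setT (fun x => expi (- (x * y)) * a x).
  by apply: (eq_cint measurableT) (ie a (- y) ia) => x _; rewrite mulNr (mulrC y).
rewrite mulrC -CintegralZ // Re_cint /Rintegral fineK; last first.
  apply: (@integrable_fin_num _ _ _ mu) => //.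
  exact: (cintZ (conjc (b y)) measurableT iy).1.
apply: eq_integral => x _; congr (_%:E); rewrite /k /=.
by congr complex.Re; ring.
Qed.

End FubiniKernel.

(** Expanding both squares, the norms agree by Plancherel and the cross terms by
    Fubini.  In this form no inversion formula is needed to pass from an error in
    frequency to an error in space. *)
Lemma duality (h1 h2 : R) a b : 0 < h1 -> 0 < h2 ->
  cmeas (freq_cell h1) a -> (energy (freq_cell h1) a < +oo)%E ->
  cmeas (freq_cell h2) b -> (energy (freq_cell h2) b < +oo)%E ->
  energy setT (fun x => cutoff (freq_cell h1) a x - inv_on h2 b x) =
  energy setT (fun y => fourier_on (freq_cell h1) a y - cutoff (freq_cell h2) b y).
Proof.
move=> h10 h20 ma ea mb eb.
set D1 := freq_cell h1; set D2 := freq_cell h2.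
have m1 : measurable D1 by exact: measurable_cell.
have m2 : measurable D2 by exact: measurable_cell.
have ia : cint D1 a by apply: cint_L2 => //; exact: mu_cell_lty.
have ib : cint D2 b by apply: cint_L2 => //; exact: mu_cell_lty.
have mA : cmeas setT (cutoff D1 a) by exact: cmeas_cut.
have mB : cmeas setT (cutoff D2 b) by exact: cmeas_cut.
have eA : energy setT (cutoff D1 a) = energy D1 a by exact: energy_cut.
have eB : energy setT (cutoff D2 b) = energy D2 b by exact: energy_cut.
have eF := plancherel_compact h10 ma ea.
have eI := plancherel_inv h20 mb eb.
have mF : cmeas setT (fourier_on D1 a) by exact: cmeas_fourier_on.
have mI : cmeas setT (inv_on h2 b) by exact: cmeas_inv_on.
rewrite (energyB_eq _ mA mI) ?eA ?eI // (energyB_eq _ mF mB) ?eF ?eB //.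
congr (_ - (_ * _)%:E)%E.
have := fubini_pairing (cint_cut m1 ia) (cint_cut m2 ib).
have c0 : (rt2pi^-1 : R) != 0 by rewrite invr_eq0 lt0r_neq0 // rt2pi_gt0.
have cc : (rt2pi : R)%:C * (rt2pi^-1)%:C = 1 :> R[i].
  by rewrite -rmorphM /= divff // lt0r_neq0 // rt2pi_gt0.
move/(congr1 (fun z => rt2pi^-1 * z)) => H.
have rZ (c : R) (z : R[i]) : complex.Re (c%:C * z) = c * complex.Re z.
  by rewrite cReM /= mul0r subr0.
transitivity (complex.Re ((rt2pi^-1 : R)%:C * Cintegral setT (fun x =>
   cutoff D1 a x * conjc (Cintegral setT (fun y => expi (x * y) * cutoff D2 b y))))).
  rewrite -CintegralZ //.
    congr complex.Re; apply: eq_Cintegral => x _; rewrite /inv_on conjc_mul.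
    rewrite Cintegral_cut (_ : conjc _%:C = (rt2pi^-1)%:C); last first.
      by apply: complexP => //=; rewrite oppr0.
    by rewrite mulrCA.
  have := cintM_L2 measurableT mA (conjc_meas mI).
  rewrite eA energy_conj eI => /(_ ea eb) /(cintZ (rt2pi)%:C measurableT).
  apply: eq_cint => // x _; rewrite /inv_on conjc_mul Cintegral_cut.
  rewrite (_ : conjc _%:C = (rt2pi^-1)%:C); last first.
    by apply: complexP => //=; rewrite oppr0.
  set X := conjc (Cintegral _ _).
  transitivity (((rt2pi : R)%:C * (rt2pi^-1)%:C) * (cutoff D1 a x * X)).
    by ring.
  by rewrite cc mul1r.
rewrite rZ H -rZ -CintegralZ //.
  congr complex.Re; apply: eq_Cintegral => y _; rewrite mulrA; congr (_ * _).
  by rewrite /fourier_on Cintegral_cut.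
have := cintM_L2 measurableT mF (conjc_meas mB).
rewrite eF energy_conj eB => /(_ ea eb) /(cintZ (rt2pi)%:C measurableT).
apply: eq_cint => // y _; rewrite mulrA; congr (_ * _).
by rewrite /fourier_on Cintegral_cut mulrA cc mul1r.
Qed.

End Duality.

(** * The Fourier transform of square-integrable functions *)

Section FourierL2.
Context {R : realType}.
Notation mu := (@lebesgue_measure R).

Lemma Rintegral_split (D : set R) (f : R -> R) : measurable D ->
  mu.-integrable setT (EFin \o f) ->
  \int[mu]_x f x = \int[mu]_(x in D) f x + \int[mu]_(x in ~` D) f x.
Proof.
move=> mD fi; have mC : measurable (~` D) by exact: measurableC.
rewrite -Rintegral_setU ?setUv //.
by apply/disj_set2P; rewrite setICr.
Qed.

Implicit Types (v w phi : R -> R[i]).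

(** Lets an estimate pass to the limit of the truncations. *)
Lemma vanish_le_add (x y : \bar R) (a : nat -> \bar R) :
  (\forall n \near \oo, x <= y + a n)%E -> vanish a -> (x <= y)%E.
Proof.
move=> xa va; apply/lee_addgt0Pr => e e0.
near \oo => n; apply: (@le_trans _ _ (y + a n)%E); first by near: n.
by apply: leeD2l; near: n; exact: va.
Unshelve. all: by end_near. Qed.

(** Symmetric intervals are frequency cells, of step pi/N; this applies the results
    on cells to truncations. *)
Lemma truncE (N : nat) : (0 < N)%N ->
  `[- N%:R, N%:R]%classic = freq_cell (pi / N%:R) :> set R.
Proof.
move=> N0; rewrite /freq_cell (_ : pi / (pi / N%:R) = N%:R) //.
by rewrite invfM invrK mulrA divff ?mul1r // lt0r_neq0 // pi_gt0.
Qed.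

Lemma trunc_gt0 (N : nat) : (0 < N)%N -> 0 < pi / N%:R :> R.
Proof. by move=> N0; rewrite divr_gt0 ?pi_gt0 ?ltr0n. Qed.

Lemma trunc_cover (x : R) : \forall N \near \oo, (`[- N%:R, N%:R]%classic : set R) x.
Proof.
near=> N; rewrite /= in_itv /= -ler_norml; near: N; exact: nbhs_infty_ger.
Unshelve. all: by end_near. Qed.

Section IsFourier.
Variables v w : R -> R[i].
Hypothesis Fvw : is_fourier v w.

Lemma is_fourier_meas : [/\ cmeas setT v, (energy setT v < +oo)%E,
  cmeas setT w & (energy setT w < +oo)%E].
Proof.
have [/in_L2P-/(_ measurableT)[a b] /in_L2P-/(_ measurableT)[c d] _] := Fvw.
by [].
Qed.

Let mv : cmeas setT v. Proof. by have [] := is_fourier_meas. Qed.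
Let ev : (energy setT v < +oo)%E. Proof. by have [] := is_fourier_meas. Qed.
Let mw : cmeas setT w. Proof. by have [] := is_fourier_meas. Qed.
Let ew : (energy setT w < +oo)%E. Proof. by have [] := is_fourier_meas. Qed.

Let vw : vanish (fun N => energy setT (fun x => w x - fourier_on `[- N%:R, N%:R] v x)%R).
Proof. by have [_ _ /L2norm_cvg0] := Fvw; exact. Qed.

Let mvD (D : set R) : measurable D -> cmeas D v.
Proof. by move=> mD; apply: cmeasS mv. Qed.
Let evD (D : set R) : measurable D -> (energy D v < +oo)%E.
Proof. by move=> mD; apply: le_lt_trans ev; exact: subset_energy. Qed.

Let mFN N : (0 < N)%N -> cmeas setT (fourier_on `[- N%:R, N%:R] v).
Proof.
move=> N0; rewrite truncE //; apply: cmeas_fourier_on.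
by apply: cint_L2; rewrite ?mu_cell_lty ?trunc_gt0 //;
  [exact: measurable_cell|apply: mvD; exact: measurable_cell
  |apply: evD; exact: measurable_cell].
Qed.

Lemma is_fourier_le : (energy setT w <= 2%:E * energy setT v)%E.
Proof.
apply: (@vanish_le_add _ _ _ _ (vanishZ (ler0n _ 2) vw)).
near=> N; have N0 : (0 < N)%N by near: N; exact: nbhs_infty_gt.
pose F := fourier_on `[- N%:R, N%:R] v; have mF : cmeas setT F by exact: mFN.
have e1 : (energy setT F <= energy setT v)%E.
  rewrite /F truncE // plancherel_compact ?trunc_gt0 //.
  - by apply: subset_energy => //; exact: measurable_cell.
  - by apply: mvD; exact: measurable_cell.
  - by apply: evD; exact: measurable_cell.
have e2 : energy setT w = energy setT (fun x => (w x - F x) + F x).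
  by apply: eq_energy => x _; rewrite subrK.
rewrite e2 addeC; apply: (le_trans (energyD_le measurableT (cmeasB mw mF) mF)).
by apply: leeD => //; apply: lee_wpmul2l.
Unshelve. all: by end_near. Qed.

(** Truncate v to [-N, N], apply [duality] to the truncation and let N grow.  The
    two uses of the parallelogram inequality give the constant 4. *)
Lemma is_fourier_inv (h : R) phi : 0 < h -> cmeas (freq_cell h) phi ->
  (energy (freq_cell h) phi < +oo)%E ->
  (energy setT (fun x => v x - inv_on h phi x)%R <=
   4%:E * energy setT (fun x => w x - cutoff (freq_cell h) phi x)%R)%E.
Proof.
move=> h0 mp ep; set C := freq_cell h.
have mC : measurable C by exact: measurable_cell.
have mI : cmeas setT (inv_on h phi).
  by apply: cmeas_inv_on => //; apply: cint_L2 => //; exact: mu_cell_lty.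
have mcp : cmeas setT (cutoff C phi) by exact: cmeas_cut.
pose D (N : nat) : set R := `[- N%:R, N%:R]%classic.
have mD N : measurable (D N) by exact: measurable_itv.
have V1 : vanish (fun N => energy (~` D N) v).
  by apply: energy_tail => //; exact: trunc_cover.
apply: (@vanish_le_add _ _ _ _ (vanishD (vanishZ (ler0n _ 2) V1) (vanishZ (ler0n _ 4) vw))).
near=> N; have N0 : (0 < N)%N by near: N; exact: nbhs_infty_gt.
have mcv : cmeas setT (cutoff (D N) v) by apply: cmeas_cut => //; exact: mvD.
apply: (le_trans (energy_triangle measurableT mv mcv mI)).
rewrite (_ : energy setT (fun x => v x - cutoff (D N) v x) = energy (~` D N) v); last first.
  rewrite -(@energy_cut _ (~` D N) setT v) //; last exact: measurableC.
  apply: eq_energy => x _; rewrite /cutoff in_setC.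
  by case: (x \in D N); rewrite /= ?subrr ?subr0.
have -> : energy setT (fun x => cutoff (D N) v x - inv_on h phi x) =
    energy setT (fun y => fourier_on (D N) v y - cutoff C phi y).
  rewrite /D truncE // duality ?trunc_gt0 //.
  - by apply: mvD; exact: measurable_cell.
  - by apply: evD; exact: measurable_cell.
set X := energy (~` D N) v; set Z := energy setT _.
have HZ : (Z <= 2%:E * energy setT (fun x => w x - fourier_on (D N) v x)%R +
  2%:E * energy setT (fun x => w x - cutoff C phi x)%R)%E.
  rewrite [X in (_ <= _ * X + _)%E]energyBC; apply: energy_triangle => //; exact: mFN.
rewrite addeCA; apply: leeD => //.
apply: (@le_trans _ _ (2%:E * (2%:E * energy setT (fun x => w x - fourier_on (D N) v x)%R +
  2%:E * energy setT (fun x => w x - cutoff C phi x)%R))%E).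
  by apply: lee_wpmul2l.
rewrite ge0_muleDr; [|by apply: mule_ge0 => //; exact: energy_ge0..].
have e4 : 4%:E = (2%:E * 2%:E)%E :> \bar R by rewrite -EFinM; congr (_%:E); ring.
by rewrite e4 -!muleA addeC.
Unshelve. all: by end_near. Qed.

Section Inversion.
Hypothesis iw : cint setT w.
Hypothesis cv1 : continuous (fun x => complex.Re (v x)).
Hypothesis cv2 : continuous (fun x => complex.Im (v x)).

Let W (x : R) : R[i] := (rt2pi^-1)%:C * Cintegral setT (fun t => expi (x * t) * w t).
Let D (N : nat) : set R := `[- N%:R, N%:R]%classic.
Let mD N : measurable (D N). Proof. exact: measurable_itv. Qed.
Let B N (x : R) : R[i] := (rt2pi^-1)%:C * Cintegral (D N) (fun t => expi (x * t) * w t).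

Let tail N : R := \int[mu]_(t in ~` D N) cmod (w t).

Let iwx x : cint setT (fun t => expi (x * t) * w t).
Proof. by apply: (@cint_expi _ _ _ (fun t => x * t)) => //; exact: measurable_lin. Qed.

Lemma rt2pi_inv_le1 : cmod ((rt2pi^-1 : R)%:C : R[i]) <= 1.
Proof.
have g0 : 0 < (rt2pi : R) by exact: rt2pi_gt0.
have g1 : 1 <= (rt2pi : R).
  rewrite -[leLHS]sqrtr1 ler_sqrt ?mulr_ge0 ?pi_ge0 //.
  by have := pi_ge2 R; lra.
by rewrite cmodR ger0_norm ?invr_ge0 ?(ltW g0) // invf_cp1.
Qed.

Let WB N x : cmod (W x - B N x) <= 2 * tail N.
Proof.
have mC : measurable (~` D N) by exact: measurableC.
have iC : cint (~` D N) (fun t => expi (x * t) * w t) by apply: cintS (iwx x).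
rewrite /W /B -mulrBr.
have -> : Cintegral setT (fun t => expi (x * t) * w t) -
    Cintegral (D N) (fun t => expi (x * t) * w t) =
    Cintegral (~` D N) (fun t => expi (x * t) * w t).
  have [a b] := iwx x.
  by apply: complexP; rewrite !cReImE /= (Rintegral_split (mD N)) // addrAC subrr add0r.
rewrite cmodM; apply: (@le_trans _ _ (1 * (2 * tail N))); last by rewrite mul1r.
apply: ler_pM; rewrite ?cmod_ge0 ?rt2pi_inv_le1 //.
apply: (le_trans (cmod_Cintegral mC iC)); rewrite ler_pM2l // /tail.
rewrite le_eqVlt; apply/orP; left; apply/eqP; apply: eq_Rintegral => t _.
by rewrite cmodM cmod_expi mul1r.
Qed.

Let tail_cvg : tail N @[N --> \oo] --> 0.
Proof.
have ia := integrable_cmod measurableT iw.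
have := Rintegral_exhaust mD trunc_cover ia => H.
have e N : tail N = \int[mu]_t cmod (w t) - \int[mu]_(t in D N) cmod (w t).
  by rewrite (Rintegral_split (mD N) ia) addrAC subrr add0r.
pose I := \int[mu]_t cmod (w t).
have : (I - \int[mu]_(t in D N) cmod (w t)) @[N --> \oo] --> I - I.
  by apply: cvgB; [exact: cvg_cst|exact: H].
by rewrite subrr; under eq_fun do rewrite -e.
Qed.

Let B_inv N : (0 < N)%N -> forall x, B N x = inv_on (pi / N%:R) w x.
Proof. by move=> N0 x; rewrite /inv_on -truncE. Qed.

Let wD E : measurable E -> (energy E w < +oo)%E.
Proof. by move=> mE; apply: le_lt_trans ew; exact: subset_energy. Qed.

Let vanish_vB : vanish (fun N => energy setT (fun x => v x - B N x)%R).
Proof.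
have V1 : vanish (fun N => energy (~` D N) w).
  by apply: energy_tail => //; exact: trunc_cover.
apply: vanish_le (vanishZ (ler0n _ 4) V1).
near=> N; have N0 : (0 < N)%N by near: N; exact: nbhs_infty_gt.
have mc : measurable (freq_cell (pi / N%:R) : set R) by exact: measurable_cell.
rewrite (eq_energy (fun x _ => congr1 (fun z => v x - z) (B_inv N0 x))).
apply: (le_trans (is_fourier_inv (trunc_gt0 N0) _ _)).
- exact: cmeasS mw.
- exact: wD.
apply: lee_wpmul2l => //.
rewrite -(@energy_cut _ (~` D N) setT w) //; last exact: measurableC.
rewrite -truncE // le_eqVlt; apply/orP; left; apply/eqP; apply: eq_energy => x _.
rewrite /cutoff in_setC.
by case: (x \in D N); rewrite /= ?subrr ?subr0.
Unshelve. all: by end_near. Qed.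

Let W_cont : continuous (fun x => complex.Re (W x)) /\ continuous (fun x => complex.Im (W x)).
Proof.
apply: (@continuous_Cintegral_expi _ setT (fun x t => x * t)) => //.
  by move=> x; exact: measurable_lin.
by move=> t x; apply: cvgM => //; exact: cvg_cst.
Qed.

Let W_meas D' : cmeas D' W.
Proof. by have [cr ci] := W_cont; exact: continuous_cmeas cr ci. Qed.

(** The inverse transforms of the truncations of w converge to v in L2 and to W
    uniformly.  Hence v and W agree almost everywhere; both being continuous, a
    point where they differ would come with an interval of positive energy. *)
Lemma fourier_inversion x :
  v x = (rt2pi^-1)%:C * Cintegral setT (fun t => expi (x * t) * w t).
Proof.
rewrite -/(W x); apply/eqP; rewrite -subr_eq0; apply: contraT => vW.
pose c := cmod (v x - W x).
have c0 : 0 < c.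
  rewrite lt_neqAle cmod_ge0 andbT eq_sym; apply: contra vW => /eqP c0.
  by apply/eqP; apply: sqn_eq0; rewrite -cmod_sqr -/c c0 expr0n.
have c4 : 0 < c / 4 by lra.
have [r r0 hr] : exists2 r : R, 0 < r & forall y, `|x - y| < r ->
    cmod (v x - v y) <= c / 4 /\ cmod (W x - W y) <= c / 4.
  have : \forall y \near x, cmod (v x - v y) <= c / 4 /\ cmod (W x - W y) <= c / 4.
    by near=> y; split; near: y; [exact: near_cmod|have [cr ci] := W_cont; exact: near_cmod].
  by move=> /nbhs_ballP[r /= r0 hr]; exists r => // y xy; exact: hr.
pose I : set R := `]x - r, x + r[%classic.
have mI : measurable I by exact: measurable_itv.
have muI : mu I = (2 * r)%:E.
  rewrite lebesgue_measure_itv /= lte_fin ltrD2l gtrN // -EFinB; congr (_%:E); ring.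
have low y : I y -> (c / 2) ^+ 2 <= sqn (v y - W y).
  rewrite /I /= in_itv /= => /andP[y1 y2].
  have /hr[h1 h2] : `|x - y| < r by rewrite ltr_norml; apply/andP; split; lra.
  rewrite -cmod_sqr; apply: lerXn2r; rewrite ?nnegrE ?cmod_ge0 //; first by lra.
  have := cmodB ((v x - v y) + (v y - W y)) (W x - W y).
  have := cmodD (v x - v y) (v y - W y).
  rewrite (_ : v x - v y + (v y - W y) - (W x - W y) = v x - W x); last by ring.
  rewrite -/c; lra.
have mvI : cmeas I v by exact: mvD.
have mWI : cmeas I W by exact: W_meas.
have mBI N : (0 < N)%N -> cmeas setT (B N).
  move=> N0; apply: (@cmeas_eq _ _ (inv_on (pi / N%:R) w)); first by move=> z _; rewrite B_inv.
  apply: cmeas_inv_on.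
  by rewrite -truncE //; apply: cintS iw.
have : (((c / 2) ^+ 2)%:E * mu I <= energy I (fun y => v y - W y)%R)%E.
  rewrite -integral_cst //; apply: ge0_le_integral => //.
  - by move=> y _; rewrite lee_fin sqr_ge0.
  - by apply: measurable_esqn; exact: cmeasB.
have E0 : (energy I (fun y => v y - W y)%R <= 0)%E.
  have V2 : vanish (fun N => ((2 * tail N) ^+ 2)%:E * mu I)%E.
    apply: cvg0_vanish => [n|].
      by apply: mule_ge0; rewrite ?lee_fin ?sqr_ge0.
    rewrite muI; under eq_fun do rewrite -EFinM.
    apply: cvg_EFin; first exact: nearW.
    have c1 : 2 * tail N @[N --> \oo] --> (2 * 0 : R) by apply: cvgM; [exact: cvg_cst|exact: tail_cvg].
    have c2 : (2 * tail N) * (2 * tail N) * (2 * r) @[N --> \oo] --> ((2 * 0) * (2 * 0) * (2 * r) : R).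
      by apply: cvgM; [exact: cvgM|exact: cvg_cst].
    by move: c2; rewrite mulr0 !mul0r; under eq_fun do rewrite -expr2.
  apply: (vanish_le_add _ (vanishD (vanishZ (ler0n _ 2) vanish_vB) (vanishZ (ler0n _ 2) V2))).
  near=> N; have N0 : (0 < N)%N by near: N; exact: nbhs_infty_gt.
  have mB : cmeas I (B N) by apply: cmeasS (mBI N N0).
  rewrite add0e; apply: (le_trans (energy_triangle mI mvI mB mWI)).
  apply: leeD; apply: lee_wpmul2l => //.
    by apply: subset_energy => //; apply: cmeasB => //; exact: mBI.
  apply: energy_bounded => //; [by rewrite muI ltry|exact: cmeasB|].
  move=> y _; rewrite -cmod_sqr; apply: lerXn2r; rewrite ?nnegrE ?cmod_ge0 //.
    by apply: le_trans (cmod_ge0 _) (WB N y).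
  by rewrite -cmodN opprB; exact: WB.
move=> /le_trans/(_ E0); rewrite muI -EFinM lee_fin leNgt.
by rewrite !mulr_gt0 // exprn_gt0 //; lra.
Unshelve. all: by end_near. Qed.

End Inversion.
End IsFourier.
End FourierL2.

(** * Sampling and aliasing *)

Section CellTile.
Context {R : realType}.
Notation mu := (@lebesgue_measure R).
Variable h : R.
Hypothesis h0 : 0 < h.
Let c : R := 2 * pi / h.

Lemma cell_tile (f : R -> \bar R) : measurable_fun setT f ->
  (\int[mu]_(x in tile (- (pi / h)) c) f x = \int[mu]_(x in freq_cell h) f x)%E.
Proof.
move=> mf; rewrite /tile /freq_cell (_ : - (pi / h) + c = pi / h); last first.
  by rewrite /c; field; exact: lt0r_neq0.
by rewrite integral_itv_bndo_bndc //; exact: measurable_funTS.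
Qed.

Lemma Rcell_tile (f : R -> R) : measurable_fun setT f ->
  \int[mu]_(x in tile (- (pi / h)) c) f x = \int[mu]_(x in freq_cell h) f x.
Proof. by move=> mf; rewrite /Rintegral cell_tile //; exact/measurable_EFinP. Qed.

Lemma period_gt0 : 0 < c.
Proof. by rewrite /c divr_gt0 // mulr_gt0 // pi_gt0. Qed.

Lemma ge0_integral_cells (f : R -> \bar R) :
  measurable_fun setT f -> (forall x, 0 <= f x)%E ->
  (\sum_(k < (2 * N).+1) \int[mu]_(x in freq_cell h) f (x + (k%:Z - N%:Z)%:~R * c)%R)%E
    @[N --> \oo] --> (\int[mu]_x f x)%E.
Proof.
move=> mf f0; have := ge0_integral_window (- (pi / h)) period_gt0 mf f0.
rewrite (_ : (fun N => _) = (fun N => \sum_(k < (2 * N).+1)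
  \int[mu]_(x in freq_cell h) f (x + (k%:Z - N%:Z)%:~R * c)%R)%E) //.
apply/funext => N; apply: eq_bigr => k _; apply: cell_tile.
by apply: (measurableT_comp mf); exact: measurable_shift.
Qed.

Lemma Rintegral_cells (f : R -> R) : mu.-integrable setT (EFin \o f) ->
  (\sum_(k < (2 * N).+1) \int[mu]_(x in freq_cell h) f (x + (k%:Z - N%:Z)%:~R * c))
    @[N --> \oo] --> \int[mu]_x f x.
Proof.
move=> fi; have := Rintegral_window (- (pi / h)) period_gt0 fi.
rewrite (_ : (fun N => _) = (fun N => \sum_(k < (2 * N).+1)
  \int[mu]_(x in freq_cell h) f (x + (k%:Z - N%:Z)%:~R * c))) //.
apply/funext => N; apply: eq_bigr => k _; apply: Rcell_tile.
have /measurable_int/measurable_EFinP mf := fi.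
by apply: (measurableT_comp mf); exact: measurable_shift.
Qed.

Lemma Cintegral_cells (f : R -> R[i]) : cint setT f ->
  ccvg (fun N => \sum_(k < (2 * N).+1)
     Cintegral (freq_cell h) (fun x => f (x + (k%:Z - N%:Z)%:~R * c)))
   (Cintegral setT f).
Proof.
move=> [a b]; split.
  by under eq_fun do rewrite cRe_sum; exact: (Rintegral_cells a).
by under eq_fun do rewrite cIm_sum; exact: (Rintegral_cells b).
Qed.

End CellTile.

Section Aliasing.
Context {R : realType}.
Notation mu := (@lebesgue_measure R).
Variables (h s Z0 : R).
Hypotheses (h0 : 0 < h) (s_gt : 2^-1 < s) (Z00 : 0 < Z0).
Hypothesis zeta : forall N, \sum_(0 <= j < N) (j.+1%:R `^ (- (2 * s))) <= Z0.
Variable w : R -> R[i].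
Hypothesis mw : cmeas setT w.

Definition sob_weight (x : R) : R := (1 + x ^+ 2) `^ s.
Definition sob_sq : \bar R := (\int[mu]_x (sob_weight x * sqn (w x))%:E)%E.
Hypothesis fW : (sob_sq < +oo)%E.

Let c : R := 2 * pi / h.
Let C : set R := freq_cell h.
Let mC : measurable C. Proof. exact: measurable_cell. Qed.
Let muC : (mu C < +oo)%E. Proof. exact: mu_cell_lty. Qed.
Let s0 : 0 < s. Proof. by apply: lt_trans s_gt; rewrite invr_gt0. Qed.
Definition alias_const : R := (h / pi) `^ (2 * s) * (2 * Z0).
Local Notation K := alias_const.

Lemma alias_const_gt0 : 0 < K.
Proof. by rewrite /K mulr_gt0 ?powR_gt0 ?divr_gt0 ?pi_gt0 ?mulr_gt0. Qed.

Lemma weight_ge1 x : 1 <= sob_weight x.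
Proof.
rewrite /sob_weight -[leLHS](_ : 1 `^ s = 1); last by rewrite powR1.
apply: ge0_ler_powR; rewrite ?nnegrE ?(ltW s0) ?addr_ge0 ?sqr_ge0 //.
by rewrite lerDl sqr_ge0.
Qed.
Let weight_gt0 x : 0 < sob_weight x. Proof. by apply: lt_le_trans (weight_ge1 x). Qed.

Lemma measurable_weight D : measurable_fun D sob_weight.
Proof.
apply: measurable_funTS; apply: (@measurableT_comp _ _ _ _ _ _ (fun y : R => y `^ s)).
  exact: measurable_powR.
by apply: measurable_funD => //; exact: measurable_funX.
Qed.

(** For x in the cell the k-th translate has modulus at least |k| pi/h. *)
Lemma weight_alias x (k : int) : C x -> k != 0 ->
  (sob_weight (x + k%:~R * c))^-1 <= (h / pi) `^ (2 * s) * (absz k)%:R `^ (- (2 * s)).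
Proof.
rewrite /C /freq_cell /= in_itv /= -ler_norml => xC k0.
have pi0 := pi_gt0 R; have ph : 0 < pi / h by rewrite divr_gt0.
have k1 : 1 <= (absz k)%:R :> R by rewrite -[1]/(1%:R) ler_nat absz_gt0.
have kk : `|k%:~R : R| = (absz k)%:R by rewrite -intr_norm -abszE.
pose y : R := (absz k)%:R * (pi / h).
have y0 : 0 < y by rewrite mulr_gt0 // (lt_le_trans _ k1).
have hy : y <= `|x + k%:~R * c|.
  have := ler_normB (x + k%:~R * c) x; rewrite addrAC subrr add0r normrM kk.
  rewrite (ger0_norm (ltW (period_gt0 h0))).
  have -> : 2 * pi / h = pi / h + pi / h by field; exact: lt0r_neq0.
  have : pi / h <= (absz k)%:R * (pi / h) by rewrite ler_peMl // ltW.
  rewrite /y mulrDr; move: (_ * (pi / h)) => t; lra.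
have hw : y `^ (2 * s) <= sob_weight (x + k%:~R * c).
  rewrite powRrM (_ : y `^ 2 = y ^+ 2); last by rewrite powR_mulrn // ltW.
  apply: ge0_ler_powR; rewrite ?nnegrE ?(ltW s0) ?addr_ge0 ?sqr_ge0 //.
  rewrite -[X in _ <= 1 + X](real_normK (num_real _)).
  apply: (@le_trans _ _ (`|x + k%:~R * c| ^+ 2)); last by rewrite lerDr.
  by apply: lerXn2r; rewrite ?nnegrE // ltW.
have -> : (h / pi) `^ (2 * s) * (absz k)%:R `^ (- (2 * s)) = (y `^ (2 * s))^-1.
  rewrite /y (@powRM _ (absz k)%:R (pi / h)); [|by rewrite ler0n|exact: ltW].
  rewrite (powRN (absz k)%:R) invfM mulrC; congr (_ * _).
  have -> : h / pi = (pi / h)^-1 by rewrite invfM invrK mulrC.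
  by rewrite -powR_inv1 ?(ltW ph) // -powRrM mulN1r powRN.
by rewrite lef_pV2 ?posrE ?weight_gt0 ?powR_gt0.
Qed.

Let iw_ (k : int) (x : R) : R := (sob_weight (x + k%:~R * c))^-1.
Let iw_ge0 k x : 0 <= iw_ k x. Proof. by rewrite invr_ge0 ltW. Qed.

Lemma sum_iw_ne0 x N : C x ->
  \sum_(k < (2 * N).+1) (if k%:Z - N%:Z == 0 then 0 else iw_ (k%:Z - N%:Z) x) <= K.
Proof.
move=> Cx; rewrite (psum_series (fun k => if k == 0 then 0 else iw_ k x)) eqxx add0r.
apply: (@le_trans _ _ (\sum_(0 <= j < N)
    (h / pi) `^ (2 * s) * 2 * (j.+1%:R `^ (- (2 * s))))).
  apply: ler_sum => j _; rewrite oppr_eq0 /=.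
  have p := @weight_alias x j.+1%:Z Cx isT.
  have n := @weight_alias x (- j.+1%:Z) Cx isT.
  rewrite abszN /= in n; rewrite /= in p.
  apply: (le_trans (lerD p n)); rewrite le_eqVlt; apply/orP; left; apply/eqP; ring.
rewrite -mulr_sumr /alias_const -mulrA ler_wpM2l ?powR_ge0 // ler_pM2l //.
Qed.

Lemma sum_iw x N : C x -> \sum_(k < (2 * N).+1) iw_ (k%:Z - N%:Z) x <= 1 + K.
Proof.
move=> Cx; apply: le_trans (lerD (lexx 1) (sum_iw_ne0 N Cx)).
rewrite (psum_series (fun k => iw_ k x)).
rewrite (psum_series (fun k => if k == 0 then 0 else iw_ k x)) eqxx add0r.
by apply: lerD => //; rewrite /iw_ invf_le1 ?weight_ge1.
Qed.

Lemma integrable_inv_weight : mu.-integrable setT (EFin \o (fun x => (sob_weight x)^-1)).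
Proof.
have mi : measurable_fun setT (fun x => (sob_weight x)^-1).
  rewrite (_ : (fun x => _) = (fun x => (1 + x ^+ 2) `^ (- s))); last first.
    by apply/funext => x; rewrite powRN.
  apply: (@measurableT_comp _ _ _ _ _ _ (fun y : R => y `^ (- s))).
    exact: measurable_powR.
  by apply: measurable_funD => //; exact: measurable_funX.
apply/integrableP; split; first exact/measurable_EFinP.
rewrite (_ : (\int[mu]_x _)%E = (\int[mu]_x ((sob_weight x)^-1)%:E)%E); last first.
  by apply: eq_integral => x _ /=; rewrite ger0_norm ?invr_ge0 ?ltW.
have mi' : measurable_fun setT (fun x => ((sob_weight x)^-1)%:E) by exact/measurable_EFinP.
have i0 x : (0 <= ((sob_weight x)^-1)%:E)%E by rewrite lee_fin invr_ge0 ltW.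
have H := ge0_integral_cells h0 mi' i0.
apply: (@le_lt_trans _ _ ((1 + K)%:E * mu C)%E); last first.
  by rewrite lte_mul_pinfty // lee_fin addr_ge0 // ltW // alias_const_gt0.
rewrite -(cvg_lim _ H) //; apply: lime_le; first by apply/cvg_ex; eexists; exact: H.
apply: nearW => N; rewrite -ge0_integral_sum //; last first.
- move=> k; apply: measurable_funTS; apply: (measurableT_comp mi').
  exact: measurable_shift.
- rewrite -integral_cst //; apply: ge0_le_integral => //.
  + by move=> x _; apply: sume_ge0 => k _.
  + apply: emeasurable_sum => k; apply: measurable_funTS; apply: (measurableT_comp mi').
    exact: measurable_shift.
  + by move=> x Cx; rewrite sumEFin lee_fin; exact: sum_iw.
Qed.

(** Either |w| is below the inverse weight or the weight times |w| is at least 1;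
    this makes w integrable, both bounds on the right being integrable. *)
Lemma cmod_le_weight x : cmod (w x) <= (sob_weight x)^-1 + sob_weight x * sqn (w x).
Proof.
have o0 := weight_gt0 x; have t0 := cmod_ge0 (w x); rewrite -cmod_sqr.
have [h1|h1] := leP (cmod (w x)) (sob_weight x)^-1.
  by rewrite (le_trans h1) // lerDl mulr_ge0 ?sqr_ge0 // ltW.
have : 1 <= sob_weight x * cmod (w x).
  by rewrite -(@mulfV _ (sob_weight x)) ?lt0r_neq0 // ler_pM2l // ltW.
move=> h2; rewrite expr2 mulrA; apply: (@le_trans _ _ (sob_weight x * cmod (w x) * cmod (w x))).
  by rewrite ler_peMl.
by rewrite lerDr invr_ge0 ltW.
Qed.

Let msw : measurable_fun setT (fun x => sob_weight x * sqn (w x)).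
Proof. by apply: measurable_funM; [exact: measurable_weight|exact: measurable_sqn]. Qed.
Let sw0 x : 0 <= sob_weight x * sqn (w x).
Proof. by rewrite mulr_ge0 ?sqn_ge0 // ltW. Qed.

Lemma integrable_sob : mu.-integrable setT (EFin \o (fun x => sob_weight x * sqn (w x))).
Proof.
apply/integrableP; split; first exact/measurable_EFinP.
rewrite (_ : (\int[mu]_x _)%E = sob_sq) //.
by apply: eq_integral => x _ /=; rewrite ger0_norm.
Qed.

Lemma sobolev_cint : cint setT w.
Proof.
apply: (cint_bound measurableT mw (integrableD_R measurableT integrable_inv_weight integrable_sob)).
by move=> x _; exact: cmod_le_weight.
Qed.

Let g (k : int) (x : R) : R := sob_weight (x + k%:~R * c) * sqn (w (x + k%:~R * c)).
Let gN (N : nat) (x : R) : R := \sum_(k < (2 * N).+1) g (k%:Z - N%:Z) x.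
(* The periodized weighted square; its integral over the cell is the squared
   H^s norm, so it is finite almost everywhere. *)
Let S (x : R) : \bar R := limn (fun N => (gN N x)%:E).
Let g0 k x : 0 <= g k x. Proof. exact: sw0. Qed.
Let mg k : measurable_fun setT (g k).
Proof. by apply: (measurableT_comp msw); exact: measurable_shift. Qed.
Let mgN N : measurable_fun setT (gN N).
Proof. by apply: measurable_sum => k; exact: mg. Qed.
Let gN0 N x : 0 <= gN N x. Proof. by apply: sumr_ge0 => k _. Qed.
Let gN_homo x : nondecreasing_seq (fun N => (gN N x)%:E).
Proof.
apply/nondecreasing_seqP => N; rewrite lee_fin /gN (psumS (fun k => g k x)).
by rewrite lerDl addr_ge0.
Qed.
Let gN_cvg x : (gN N x)%:E @[N --> \oo] --> S x.
Proof. exact: ereal_nondecreasing_is_cvgn. Qed.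
Let gN_le N x : ((gN N x)%:E <= S x)%E.
Proof.
rewrite /S (cvg_lim _ (ereal_nondecreasing_cvgn (gN_homo x))) //.
by apply: ereal_sup_ubound; exists N.
Qed.
Let S0 x : (0 <= S x)%E.
Proof. by apply: le_trans (gN_le 0 x); rewrite lee_fin. Qed.
Let mS : measurable_fun setT S.
Proof.
apply: (@emeasurable_fun_cvg _ _ _ _ (fun N x => (gN N x)%:E)).
  by move=> N; exact/measurable_EFinP.
by move=> x _; exact: gN_cvg.
Qed.

Let intS : (\int[mu]_(x in C) S x = sob_sq)%E.
Proof.
have mw' : measurable_fun setT (fun x => (sob_weight x * sqn (w x))%:E) by exact/measurable_EFinP.
have := @ge0_integral_cells _ h h0 _ mw' (fun x => sw0 x).
rewrite -/sob_sq => H.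
rewrite (@monotone_convergence _ _ _ mu _ mC (fun N x => (gN N x)%:E)).
- rewrite -(cvg_lim _ H) //; congr (limn _); apply/funext => N.
  rewrite -ge0_integral_sum //.
  + by apply: eq_integral => x _; rewrite sumEFin.
  + by move=> k; apply/measurable_EFinP; apply: measurable_funTS; exact: mg.
  + by move=> k x _; rewrite lee_fin.
- by move=> N; apply/measurable_EFinP; apply: measurable_funTS; exact: mgN.
- by move=> N x _; rewrite lee_fin.
- by move=> x _; exact: gN_homo.
Qed.

Let G : set R := [set x | (S x < +oo)%E].
Let mG : measurable G.
Proof.
by rewrite -[G]setTI; apply: emeasurable_fun_infty_o => //.
Qed.

Let ms_ (k : int) : cmeas setT (fun x => w (x + k%:~R * c)).
Proof.
have [a b] := mw; split.
  by apply: (measurableT_comp a); exact: measurable_shift.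
by apply: (measurableT_comp b); exact: measurable_shift.
Qed.

(* Setting the translates to 0 on the null set where S is infinite makes the
   periodization converge at every point of the cell. *)
Let p (k : int) (x : R) : R[i] := cutoff G (fun x => w (x + k%:~R * c)) x.
Let mp k : cmeas setT (p k).
Proof. by apply: cmeas_cut => //; apply: cmeasS (ms_ k). Qed.

Let pG (k : int) x : G x -> p k x = w (x + k%:~R * c).
Proof. by move=> Gx; rewrite /p /cutoff mem_set. Qed.
Let pNG (k : int) x : ~ G x -> p k x = 0.
Proof. by move=> Gx; rewrite /p /cutoff memNset. Qed.

Let fineS x : G x -> S x = (fine (S x))%:E.
Proof. by move=> Gx; rewrite fineK // ge0_fin_numE. Qed.

(* Dominates all partial sums of the periodization. *)
Let dom x : R := 1 + K + fine (S x).
Let K0 : 0 < K. Proof. exact: alias_const_gt0. Qed.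

Let sum_p x N : C x -> \sum_(k < (2 * N).+1) cmod (p (k%:Z - N%:Z) x) <= dom x.
Proof.
move=> Cx; have [Gx|Gx] := pselect (G x); last first.
  rewrite big1 => [|k _]; last by rewrite pNG // cmodE sqn0 sqrtr0.
  by rewrite !addr_ge0 ?fine_ge0 ?(ltW K0).
apply: (@le_trans _ _ (\sum_(k < (2 * N).+1) (iw_ (k%:Z - N%:Z) x + g (k%:Z - N%:Z) x))).
  by apply: ler_sum => k _; rewrite pG //; exact: cmod_le_weight.
rewrite big_split /=; apply: lerD; first exact: sum_iw.
by rewrite -lee_fin -fineS //; exact: gN_le.
Qed.

Definition aliased (x : R) : R[i] := sumZ (fun k => p k x).

Let pN (N : nat) (x : R) : R[i] := psumZ (fun k => p k x) N.

Let pN_cvg x : C x -> ccvg (fun N => pN N x) (aliased x).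
Proof. by move=> Cx; apply: (@psumZ_ccvg _ _ (dom x)) => N; exact: sum_p. Qed.

Let mpN N : cmeas C (pN N).
Proof. by apply: cmeas_sum => k; apply: cmeasS (mp _). Qed.

Lemma cmeas_aliased : cmeas C aliased.
Proof. exact: (cmeas_ccvg mpN (fun x => @pN_cvg x)). Qed.

Let aeG : {ae mu, forall x, C x -> G x}.
Proof.
have iS : mu.-integrable C S.
  apply/integrableP; split; first exact: measurable_funTS.
  rewrite (_ : (\int[mu]_(x in C) _)%E = sob_sq) // -intS.
  by apply: eq_integral => x _; rewrite gee0_abs.
have := @integrable_ae _ _ _ mu C mC S iS.
apply: ae_imp => x /= h1 Cx; rewrite /G /=.
by have := h1 Cx; rewrite ge0_fin_numE.
Qed.

Let idom : mu.-integrable C (EFin \o dom).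
Proof.
apply: integrableD_R => //; first exact: integrable_cst_R.
have mf : measurable_fun C (fun x => fine (S x)).
  by apply: measurableT_comp => //; exact: measurable_funTS.
apply/integrableP; split; first exact/measurable_EFinP.
rewrite (_ : (\int[mu]_(x in C) _)%E = sob_sq) // -intS.
apply: ge0_ae_eq_integral => //.
- by apply: measurableT_comp => //; exact/measurable_EFinP.
- exact: measurable_funTS.
- apply: ae_imp aeG => x /= h1 Cx; have Gx := h1 Cx.
  by rewrite [in RHS]fineS // ger0_norm ?fine_ge0.
Qed.

Let sqn_alias x : C x -> G x -> sqn (aliased x - w x) <= K * fine (S x).
Proof.
move=> Cx Gx; apply: (@ccvg_le_sqn _ (fun N => pN N x - p 0 x)).
  by rewrite (_ : w x = p 0 x) ?pG ?mul0r ?addr0 //; apply: ccvgB; [exact: pN_cvg|exact: ccvg_cst].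
move=> N.
pose q (k : int) : R[i] := if k == 0 then 0 else p k x.
have -> : pN N x - p 0 x = psumZ q N.
  rewrite /pN /psumZ (psum_series (fun k => p k x)) (psum_series q) /q eqxx add0r.
  by rewrite addrC addKr.
pose a (k : int) : R := if k == 0 then 0 else Num.sqrt (iw_ k x).
pose b (k : int) : R := Num.sqrt (g k x).
have qab k : cmod (q k) <= a k * b k.
  rewrite /q /a /b; case: eqP => [_|k0].
    by rewrite cmodE sqn0 sqrtr0 mul0r.
  have e : iw_ k x * g k x = sqn (w (x + k%:~R * c)).
    by rewrite /iw_ /g mulKf // lt0r_neq0.
  by rewrite pG // -sqrtrM ?iw_ge0 // e cmodE.
rewrite -cmod_sqr; apply: (@le_trans _ _ ((\sum_(k < (2 * N).+1)
    a (k%:Z - N%:Z) * b (k%:Z - N%:Z)) ^+ 2)).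
  apply: lerXn2r; rewrite ?nnegrE ?cmod_ge0 //.
    by apply: sumr_ge0 => k _; apply: le_trans (qab _); exact: cmod_ge0.
  by apply: (le_trans (cmod_psumZ _ _)); apply: ler_sum => k _.
apply: (le_trans (@cauchy_schwarz_sum _ _ (fun k => a (k%:Z - N%:Z)) (fun k => b (k%:Z - N%:Z)) _ _)).
- by move=> k; rewrite /a; case: ifP => // _; exact: sqrtr_ge0.
- by move=> k; exact: sqrtr_ge0.
apply: ler_pM.
- by apply: sumr_ge0 => k _; rewrite sqr_ge0.
- by apply: sumr_ge0 => k _; rewrite sqr_ge0.
- apply: le_trans (sum_iw_ne0 N Cx); apply: ler_sum => k _; rewrite /a.
  by case: ifP => _; rewrite ?expr0n // sqr_sqrtr ?iw_ge0.
- rewrite -lee_fin -fineS //; apply: le_trans (gN_le N x); rewrite lee_fin.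
  by apply: ler_sum => k _; rewrite /b sqr_sqrtr.
Qed.

(** Cauchy-Schwarz over the nonzero translates, at each point of the cell: the sum
    of the inverse weights gives the constant, and the periodized weighted square
    integrates to the squared H^s norm. *)
Lemma energy_aliased : (energy C (fun x => aliased x - w x)%R <= K%:E * sob_sq)%E.
Proof.
rewrite -intS -ge0_integralZl_EFin ?(ltW K0) //; last exact: measurable_funTS.
apply: ge0_le_integral => //.
- by move=> x _; rewrite lee_fin sqn_ge0.
- by apply: measurable_esqn; apply: cmeasB; [exact: cmeas_aliased|exact: cmeasS mw].
- by apply: emeasurable_funM => //; exact: measurable_funTS.
- move=> x Cx; have [Gx|Gx] := pselect (G x).
    by rewrite fineS // -EFinM lee_fin sqn_alias.
  have -> : S x = +oo%E by move/negP: Gx; rewrite -leNgt leye_eq => /eqP.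
  by rewrite mulry gtr0_sg // mul1e leey.
Qed.

Lemma energy_aliased_lty : (energy setT w < +oo)%E -> (energy C aliased < +oo)%E.
Proof.
move=> ew; have mwC : cmeas C w by apply: cmeasS mw.
rewrite (_ : energy C aliased = energy C (fun x => (aliased x - w x) + w x)); last first.
  by apply: eq_energy => x _; rewrite subrK.
apply: (le_lt_trans (energyD_le mC (cmeasB cmeas_aliased mwC) mwC)).
rewrite lte_add_pinfty // lte_mul_pinfty //.
  by apply: (le_lt_trans energy_aliased); rewrite lte_mul_pinfty // lee_fin ltW.
by apply: le_lt_trans ew; exact: subset_energy.
Qed.

Lemma expi_period (m k : int) x : expi (h * m%:~R * (x + k%:~R * c)) = expi (h * m%:~R * x).
Proof.
have -> : h * m%:~R * (x + k%:~R * c) = h * m%:~R * x + (m * k)%:~R * (2 * pi).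
  by rewrite /c rmorphM /=; field; exact: lt0r_neq0.
by rewrite expiD expi2pi mulr1.
Qed.

(** The exponential has period 2 pi / h in x, so integrating the periodization
    over the cell unfolds to an integral over the line. *)
Lemma coef_aliased (m : int) :
  coef h aliased m = Cintegral setT (fun x => expi (h * m%:~R * x) * w x).
Proof.
have me D : cmeas D (fun x => expi (h * m%:~R * x)).
  by apply: cmeas_expi; exact: measurable_lin.
have iw : cint setT w := sobolev_cint.
have ie : cint setT (fun x => expi (h * m%:~R * x) * w x).
  by apply: (@cint_expi _ _ _ (fun x => h * m%:~R * x)) => //; exact: measurable_lin.
have H1 : ccvg (fun N => Cintegral C (fun x => expi (h * m%:~R * x) * pN N x)) (coef h aliased m).
  apply: (@Cintegral_dct _ C _ _ dom) => //.
  - by move=> N; apply: cmeasM.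
  - by apply: cmeasM => //; exact: cmeas_aliased.
  - by move=> x Cx; apply: ccvgM; [exact: ccvg_cst|exact: pN_cvg].
  - move=> N x Cx; rewrite cmodM cmod_expi mul1r.
    by apply: (le_trans (cmod_psumZ _ _)); exact: sum_p.
have H2 := Cintegral_cells h0 ie.
apply: (ccvg_unique H1).
rewrite (_ : (fun N => _) = (fun N => \sum_(k < (2 * N).+1) Cintegral C
   (fun x => expi (h * m%:~R * (x + (k%:Z - N%:Z)%:~R * c)) * w (x + (k%:Z - N%:Z)%:~R * c)))) //.
apply/funext => N.
have iwk (k : int) : cint C (fun x => w (x + k%:~R * c)).
  have [a b] := iw; have [ma mb] := mw.
  have sub (u : R -> R) : mu.-integrable setT (EFin \o u) -> measurable_fun setT u ->
     mu.-integrable C (EFin \o (fun x => u (x + k%:~R * c))).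
    move=> iu mu'; have := integrable_shift (k%:~R * c) measurableT mu' iu.
    by rewrite preimage_setT; apply: integrableS.
  by split; [exact: (sub _ a ma)|exact: (sub _ b mb)].
have iek (k : int) : cint C (fun x => expi (h * m%:~R * x) * w (x + k%:~R * c)).
  by apply: (@cint_expi _ _ _ (fun x => h * m%:~R * x)) => //; exact: measurable_lin.
transitivity (Cintegral C (fun x => \sum_(k < (2 * N).+1)
   expi (h * m%:~R * x) * w (x + (k%:Z - N%:Z)%:~R * c))).
  apply: ae_eq_Cintegral => //.
  - exact: cmeasM.
  - by apply: cmeas_sum => k; exact: cint_cmeas.
  - apply: ae_imp aeG => x h1 Cx; rewrite /pN /psumZ mulr_sumr.
    by apply: eq_bigr => k _; rewrite pG //; exact: h1.
rewrite Cintegral_sum //; apply: eq_bigr => k _.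
by apply: eq_Cintegral => x _; rewrite expi_period.
Qed.

End Aliasing.

(** * The scheme in frequency space *)

Section AbsSummable.
Context {R : realType}.
Implicit Types (F : int -> R[i]).

Definition zsummable F : Prop :=
  exists M : R, forall N, \sum_(k < (2 * N).+1) cmod (F (k%:Z - N%:Z)) <= M.

Lemma zsummable_ccvg F : zsummable F -> ccvg (psumZ F) (sumZ F).
Proof. by move=> [M FM]; exact: psumZ_ccvg FM. Qed.

Lemma zsummable_cvg0 F : zsummable F ->
  (cmod (F N.+1%:Z) @[N --> \oo] --> 0) /\ (cmod (F (- N.+1%:Z)) @[N --> \oo] --> 0).
Proof.
move=> [M FM]; pose u N := \sum_(k < (2 * N).+1) cmod (F (k%:Z - N%:Z)).
have uS N : u N.+1 = u N + (cmod (F N.+1%:Z) + cmod (F (- N.+1%:Z))).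
  exact: (psumS (fun k => cmod (F k))).
have cu : cvgn u.
  apply: nondecreasing_is_cvgn.
    by apply/nondecreasing_seqP => N; rewrite uS lerDl addr_ge0 ?cmod_ge0.
  by exists M => _ [N _ <-]; exact: FM.
have d0 : u N.+1 - u N @[N --> \oo] --> 0.
  rewrite -[X in _ --> X](subrr (limn u)); apply: cvgB => //.
  by rewrite (_ : (fun N => u N.+1) = [sequence u (n + 1)%N]_n) ?cvg_shiftn //;
    apply/funext => N; rewrite /= addn1.
by split; apply: (@squeeze_cvgr _ _ _ _ (cst 0)) d0; try exact: cvg_cst;
  apply: nearW => N /=; rewrite cmod_ge0 uS addrC addKr /= ?lerDl ?lerDr cmod_ge0.
Qed.

Lemma zsummable_shift1 F : zsummable F -> zsummable (fun k => F (k + 1)).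
Proof.
move=> [M FM]; exists M => N; apply: le_trans (FM N.+1).
rewrite (psum_shift1 (fun k => cmod (F k))) (psumS (fun k => cmod (F k))) lerD2l.
have h1 := cmod_ge0 (F (- N%:Z)); have h2 := cmod_ge0 (F (- N.+1%:Z)).
lra.
Qed.

Lemma zsummable_rev F : zsummable F -> zsummable (fun k => F (- k)).
Proof.
by move=> [M FM]; exists M => N; apply: le_trans (FM N); rewrite (psum_rev (fun k => cmod (F k))).
Qed.

Lemma sumZ_shift1 F : zsummable F -> sumZ (fun k => F (k + 1)) = sumZ F.
Proof.
move=> sF; have [h1 h2] := zsummable_cvg0 sF.
apply: ccvg_sumZ; apply: ccvg_shift1 => //; last exact: zsummable_ccvg.
by rewrite -cvg_shiftS.
Qed.

Lemma zsummable_shiftn F (n : nat) : zsummable F ->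
  zsummable (fun k => F (k + n%:Z)) /\ sumZ (fun k => F (k + n%:Z)) = sumZ F.
Proof.
move=> sF; elim: n => [|n [IH1 IH2]].
  by rewrite (_ : (fun k => _) = F) //; apply/funext => k; rewrite addr0.
rewrite (_ : (fun k => F (k + n.+1%:Z)) = (fun k => F (k + 1 + n%:Z))); last first.
  by apply/funext => k; rewrite intS addrA.
split; first exact: (zsummable_shift1 IH1).
by rewrite -IH2; exact: (sumZ_shift1 IH1).
Qed.

Lemma sumZ_shift F (m : int) : zsummable F ->
  sumZ (fun k => F (k + m)) = sumZ F.
Proof.
move=> sF; case: m => n; first by have [] := zsummable_shiftn n sF.
pose G k := F (- k); have sG : zsummable G by exact: zsummable_rev.
have [_ e] := zsummable_shiftn n.+1 sG.
rewrite -(sumZ_rev F) -/G -e -(sumZ_rev (fun k => F (k + Negz n))).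
congr sumZ; apply/funext => k; rewrite /G NegzE; congr F.
by rewrite opprD.
Qed.

Lemma sumZ_reflect F (m : int) : zsummable F ->
  sumZ (fun k => F (m - k)) = sumZ F.
Proof.
move=> sF; rewrite -(sumZ_shift m sF) -(sumZ_rev (fun k => F (k + m))).
by congr sumZ; apply/funext => k; rewrite addrC.
Qed.

Lemma zsummable_le F (a : int -> R) (B : R) : zsummable (fun k => (a k)%:C) ->
  0 <= B -> (forall k, cmod (F k) <= B * `|a k|) -> zsummable F.
Proof.
move=> [M aM] B0 FB; exists (B * M) => N.
apply: (@le_trans _ _ (B * \sum_(k < (2 * N).+1) cmod ((a (k%:Z - N%:Z))%:C))).
  by rewrite mulr_sumr; apply: ler_sum => k _; rewrite cmodR.
by rewrite ler_wpM2l.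
Qed.

End AbsSummable.

Section Kernel.
Context {R : realType}.
Notation mu := (@lebesgue_measure R).
Variable J : R -> R.
Hypothesis J_cont : continuous J.
Hypothesis H1 : forall x, 0 <= J x.
Hypothesis H2 : (\int[mu]_x (J x)%:E = 1)%E.
Hypothesis H3 : forall x, J x = J (- x).
Hypothesis H4 : forall x y, 0 < x -> x <= y -> J y <= J x.

Let mJ D : measurable_fun D J.
Proof. by apply: measurable_funTS; exact: continuous_measurable_fun. Qed.

(** Continuity extends the monotonicity to the end point 0. *)
Lemma kernel_decr x y : 0 <= x -> x <= y -> J y <= J x.
Proof.
rewrite le_eqVlt => /predU1P[<- y0|]; last exact: H4.
move: y0; rewrite le_eqVlt => /predU1P[<-//|y0].
apply/ler_addgt0Pr => e e0.
have /cvgrPdist_le/(_ _ e0)/nbhs_ballP[d /= d0 hd] := @J_cont 0.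
pose z := Num.min (d / 2) y.
have z0 : 0 < z by rewrite lt_min y0 divr_gt0.
have zy : z <= y by rewrite ge_min lexx orbT.
have zd : z < d by rewrite gt_min; apply/orP; left; lra.
apply: (le_trans (H4 z0 zy)).
have /hd : ball 0 d z by rewrite /ball /= sub0r normrN gtr0_norm.
by rewrite ler_norml => /andP[]; lra.
Qed.

Lemma integrable_kernel : mu.-integrable setT (EFin \o J).
Proof.
apply/integrableP; split; first by apply/measurable_EFinP; exact: mJ.
rewrite (_ : (\int[mu]_x _)%E = 1%E) ?ltry // -H2.
by apply: eq_integral => x _ /=; rewrite ger0_norm.
Qed.

Lemma Rintegral_kernel : \int[mu]_x J x = 1.
Proof. by rewrite /Rintegral H2. Qed.

Section Step.
Variable h : R.
Hypothesis h0 : 0 < h.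

(** Bounds the sum of J over the grid: by monotonicity each half sum is at most the
    integral of J, which is at most 1, divided by h. *)
Definition kernel_mass : R := J 0 + 2 / h.

Lemma kernel_mass_ge0 : 0 <= kernel_mass.
Proof. by rewrite addr_ge0 // divr_ge0 // ltW. Qed.

Let half_sum N : h * \sum_(0 <= j < N) J (j.+1%:R * h) <= 1.
Proof.
have mJE : measurable_fun setT (EFin \o J) by apply/measurable_EFinP; exact: mJ.
have e := @ge0_integral_tiles R 0 h 0 N (EFin \o J) h0 mJE (fun x => H1 x).
have le1 : (\int[mu]_(x in tiles 0 h 0 N) (J x)%:E <= 1)%E.
  by rewrite -H2; apply: ge0_subset_integral => //; [exact: measurable_tiles|move=> x _; rewrite lee_fin].
rewrite -lee_fin; apply: le_trans le1; rewrite [leRHS]e.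
rewrite mulr_sumr -sumEFin big_mkord; apply: lee_sum => k _.
have muT : mu (tile 0 h) = h%:E.
  by rewrite lebesgue_measure_itv /= add0r lte_fin h0 sube0.
rewrite mulrC EFinM -muT -integral_cst; last exact: measurable_tile.
apply: ge0_le_integral => //.
- exact: measurable_tile.
- by move=> x _; rewrite lee_fin.
- apply: measurable_funTS; apply: (measurableT_comp mJE); exact: measurable_shift.
- move=> x; rewrite /tile /= in_itv /= add0r => /andP[x0 xh]; rewrite lee_fin addr0.
  have k0 : 0 <= k%:R * h :> R by rewrite mulr_ge0 // ltW.
  apply: kernel_decr; first by rewrite addr_ge0.
  by rewrite -natr1 mulrDl mul1r -pmulrn addrC lerD2l ltW.
Qed.

Let ksum N : \sum_(k < (2 * N).+1) cmod (J (grid h (k%:Z - N%:Z)))%:C <= kernel_mass.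
Proof.
rewrite (psum_series (fun k => cmod (J (grid h k))%:C)).
rewrite cmodR ger0_norm // /grid mul0r lerD2l.
rewrite -(@ler_pM2l _ h) // (_ : h * (2 / h) = 2); last by field; exact: lt0r_neq0.
apply: (@le_trans _ _ (2 * (h * \sum_(0 <= j < N) J (j.+1%:R * h)))); last first.
  by have := half_sum N; lra.
rewrite mulrCA ler_pM2l // mulr_sumr; apply: ler_sum => j _.
rewrite !cmodR !ger0_norm // mulrNz mulNr -H3 -!pmulrn.
by move: (J _) => y; lra.
Qed.

Lemma zsummable_kernel : zsummable (fun k => (J (grid h k))%:C).
Proof. by exists kernel_mass => N; exact: ksum. Qed.

Let T (x : R) (N : nat) : R[i] := psumZ (dft_term h (fun m => (J (grid h m))%:C) x) N.
Let Sg (x : R) : R[i] := sumZ (dft_term h (fun m => (J (grid h m))%:C) x).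

Let T_le x N : cmod (T x N) <= kernel_mass.
Proof.
apply: (le_trans (cmod_psumZ _ _)); apply: le_trans (ksum N); apply: ler_sum => k _.
by rewrite /dft_term cmodM cmod_expi mul1r.
Qed.

Let T_cvg x : ccvg (T x) (Sg x).
Proof.
apply: zsummable_ccvg; exists kernel_mass => N; apply: le_trans (ksum N).
by apply: ler_sum => k _; rewrite /dft_term cmodM cmod_expi mul1r.
Qed.

(* The part of the amplification factor that comes from the difference quotients,
   written with exponentials to match the shifts of the grid function. *)
Let Dg dt (x : R) : R[i] :=
  (dt / h ^+ 2)%:C * (expi (h * 1%:~R * x) + expi (h * (-1)%:~R * x) - 2) +
  (dt / (2 * h))%:C * (expi (h * 1%:~R * x) - expi (h * (-1)%:~R * x)).

Let ampN dt (N : nat) (x : R) : R[i] :=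
  1 - dt%:C + (h * dt)%:C * (T x N - T 0 N) + Dg dt x.

Lemma amplificationE dt x : amplification J h dt x =
  1 - dt%:C + (h * dt)%:C * (Sg x - Sg 0) + Dg dt x.
Proof.
rewrite /amplification /kernel_dft /dft_pt -/(Sg x) -/(Sg 0) -/rt2pi.
have -> : (rt2pi * dt)%:C * (dft_const h * Sg x - dft_const h * Sg 0) =
   (h * dt)%:C * (Sg x - Sg 0).
  rewrite -mulrBr mulrA; congr (_ * _); rewrite /dft_const -/rt2pi -rmorphM /=.
  by congr (_%:C); field; rewrite lt0r_neq0 // rt2pi_gt0.
rewrite -addrA; congr (_ + _).
have sc : sin (h * x / 2) ^+ 2 = (1 - cos (h * x)) / 2.
  have e : h * x = (h * x / 2) *+ 2 by rewrite -mulr_natr divfK.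
  by rewrite {2}e cos_mulr2n cos2sin2; field.
rewrite sc /Dg mulr1 mulrN1 mulNr.
apply: complexP; rewrite !cReImE /= ?cosN ?sinN; field; exact: lt0r_neq0.
Qed.

Let ampN_cvg dt x : ccvg (fun N => ampN dt N x) (amplification J h dt x).
Proof.
rewrite amplificationE; apply: ccvgD; last exact: ccvg_cst.
apply: ccvgD; first exact: ccvg_cst.
by apply: ccvgM; [exact: ccvg_cst|apply: ccvgB; exact: T_cvg].
Qed.

Let cmeas_T D N : cmeas D (fun x => T x N).
Proof.
apply: cmeas_sum => k; apply: cmeasM; last exact: cmeas_cst.
by apply: cmeas_expi; exact: measurable_wave.
Qed.

Let cmeas_Dg D dt : cmeas D (Dg dt).
Proof.
have me (c : R) : cmeas D (fun x => expi (c * x)).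
  by apply: cmeas_expi; exact: measurable_lin.
apply: cmeasD; apply: cmeasM; try exact: cmeas_cst.
  by apply: cmeasB; [exact: cmeasD|exact: cmeas_cst].
exact: cmeasB.
Qed.

Let cmeas_ampN D dt N : cmeas D (ampN dt N).
Proof.
apply: cmeasD => //; apply: cmeasD; first exact: cmeas_cst.
apply: cmeasM; first exact: cmeas_cst.
by apply: cmeasB; [exact: cmeas_T|exact: cmeas_cst].
Qed.

Lemma cmeas_amplification D dt : cmeas D (amplification J h dt).
Proof. by apply: (cmeas_ccvg (fun N => cmeas_ampN D dt N)) => x _; exact: ampN_cvg. Qed.

Definition amp_const : R := 1 + h * (2 * kernel_mass) + 4 / h ^+ 2 + 1 / h.

Let Dg_le dt x : 0 <= dt -> cmod (Dg dt x) <= dt * (4 / h ^+ 2 + 1 / h).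
Proof.
move=> dt0; apply: (le_trans (cmodD _ _)).
have c2 : cmod (2 : R[i]) = 2.
  by rewrite (_ : 2 = (2 : R)%:C) ?cmodR ?ger0_norm // rmorph_nat.
rewrite !cmodM !cmodR !ger0_norm ?divr_ge0 ?exprn_ge0 ?mulr_ge0 ?(ltW h0) //.
have e1 : cmod (expi (h * 1%:~R * x) + expi (h * (-1)%:~R * x) - 2) <= 4.
  apply: (le_trans (cmodB _ _)); apply: (le_trans (lerD (cmodD _ _) (lexx _))).
  by rewrite !cmod_expi c2; lra.
have e2 : cmod (expi (h * 1%:~R * x) - expi (h * (-1)%:~R * x)) <= 2.
  by apply: (le_trans (cmodB _ _)); rewrite !cmod_expi; lra.
have d1 : 0 <= dt / h ^+ 2 by rewrite divr_ge0 ?exprn_ge0 ?(ltW h0).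
have d2 : 0 <= dt / (2 * h) by rewrite divr_ge0 ?mulr_ge0 ?(ltW h0).
apply: (le_trans (lerD (ler_wpM2l d1 e1) (ler_wpM2l d2 e2))).
by rewrite le_eqVlt; apply/orP; left; apply/eqP; field; exact: lt0r_neq0.
Qed.

Let ampN_le dt x N : 0 <= dt -> cmod (ampN dt N x - 1) <= dt * amp_const.
Proof.
move=> dt0.
have -> : ampN dt N x - 1 = - dt%:C + (h * dt)%:C * (T x N - T 0 N) + Dg dt x.
  by rewrite /ampN; ring.
apply: (le_trans (cmodD _ _)).
apply: (@le_trans _ _ ((dt + h * dt * (2 * kernel_mass)) + dt * (4 / h ^+ 2 + 1 / h))).
  apply: lerD; last exact: Dg_le.
  apply: (le_trans (cmodD _ _)); rewrite cmodN cmodR (ger0_norm dt0) lerD2l.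
  rewrite cmodM cmodR ger0_norm ?mulr_ge0 ?(ltW h0) //.
  rewrite ler_wpM2l ?mulr_ge0 ?(ltW h0) //.
  apply: (le_trans (cmodB _ _)); rewrite mulr_natl mulr2n lerD ?T_le //.
by rewrite le_eqVlt; apply/orP; left; apply/eqP; rewrite /amp_const; ring.
Qed.

Lemma amp_const_ge0 : 0 <= amp_const.
Proof.
have hh := ltW h0; have k0 := kernel_mass_ge0.
rewrite /amp_const; apply: addr_ge0; last by rewrite divr_ge0.
apply: addr_ge0; last by rewrite divr_ge0 // exprn_ge0.
by apply: addr_ge0 => //; rewrite !mulr_ge0.
Qed.

(** The generator of the scheme is bounded for fixed h: the kernel sum by
    [kernel_mass] and the difference quotients by powers of 1/h. *)
Lemma amplification_near1 dt x : 0 <= dt ->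
  cmod (amplification J h dt x - 1) <= dt * amp_const.
Proof.
move=> dt0; rewrite -(@ler_pXn2r _ 2) ?nnegrE ?cmod_ge0 ?mulr_ge0 ?amp_const_ge0 //.
rewrite cmod_sqr; apply: (@ccvg_le_sqn _ (fun N => ampN dt N x - 1)).
  by apply: ccvgB; [exact: ampN_cvg|exact: ccvg_cst].
move=> N; rewrite -cmod_sqr; apply: lerXn2r; rewrite ?nnegrE ?cmod_ge0 ?mulr_ge0 ?amp_const_ge0 //.
exact: ampN_le.
Qed.

Section OneStep.
Variables (dt : R) (w : R -> R[i]) (V : int -> R[i]).
Hypothesis dt0 : 0 <= dt.
Let C : set R := freq_cell h.
Hypothesis mw : cmeas C w.
Hypothesis ew : (energy C w < +oo)%E.
Hypothesis Vw : has_coef h V w.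
Let mC : measurable C. Proof. exact: measurable_cell. Qed.
Let muC : (mu C < +oo)%E. Proof. exact: mu_cell_lty. Qed.
Let iw : cint C w. Proof. exact: cint_L2. Qed.

Let cint_expw (k : int) : cint C (fun x => expi (h * k%:~R * x) * w x).
Proof.
by apply: (@cint_expi _ _ _ (fun x => h * k%:~R * x)) => //; exact: measurable_lin.
Qed.

Lemma coef_expi (k m : int) :
  coef h (fun x => expi (h * k%:~R * x) * w x) m = coef h w (m + k).
Proof.
apply: eq_Cintegral => x _; rewrite mulrA -expiD; congr (expi _ * _).
by rewrite rmorphD /=; ring.
Qed.

Let V_bounded : exists2 B : R, 0 <= B & forall m, cmod (V m) <= B.
Proof.
exists (2 * \int[mu]_(x in C) cmod (w x)) => [|m].
  by rewrite mulr_ge0 // Rintegral_ge0 // => x _; exact: cmod_ge0.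
rewrite Vw cmodM; apply: (@le_trans _ _ (1 * (2 * \int[mu]_(x in C) cmod (w x)))); last by rewrite mul1r.
apply: ler_pM; rewrite ?cmod_ge0 ?rt2pi_inv_le1 //.
apply: (le_trans (cmod_Cintegral mC (cint_expw m))); rewrite ler_pM2l //.
rewrite le_eqVlt; apply/orP; left; apply/eqP; apply: eq_Rintegral => x _.
by rewrite cmodM cmod_expi mul1r.
Qed.

Let F (m k : int) : R[i] := (J (grid h k))%:C * (V (m - k) - V m).

Let zF m : zsummable (F m).
Proof.
have [B B0 VB] := V_bounded.
apply: (zsummable_le zsummable_kernel (mulr_ge0 (ler0n _ 2) B0)) => k.
rewrite cmodM cmodR mulrC ler_wpM2r // (le_trans (cmodB _ _)) //.
by rewrite mulr_natl mulr2n lerD.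
Qed.

Let scheme_sum m : sumZ (fun k => (J (grid h m - grid h k))%:C * (V k - V m)) = sumZ (F m).
Proof.
rewrite -(sumZ_reflect m (zF m)); congr sumZ; apply/funext => k; rewrite /F.
congr ((J _)%:C * (V _ - _)); last by rewrite subKr.
by rewrite /grid -mulrBl -rmorphB.
Qed.

Let u (k : int) x := expi (h * k%:~R * x) * w x.

(* With the kernel sum truncated at N both sides are finite combinations of the
   shifts V (m + k). *)
Let coef_ampN N m : (rt2pi^-1)%:C * coef h (fun x => ampN dt N x * w x) m =
  V m - dt%:C * V m
  + dt%:C * ((V (m + 1) - V (m - 1)) / (2 * h)%:C)
  + dt%:C * ((V (m + 1) - 2 * V m + V (m - 1)) / (h ^+ 2)%:C)
  + (h * dt)%:C * psumZ (F m) N.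
Proof.
pose a1 : R[i] := 1 - dt%:C - (h * dt)%:C * T 0 N - 2 * (dt / h ^+ 2)%:C.
pose a2 : R[i] := (dt / h ^+ 2)%:C + (dt / (2 * h))%:C.
pose a3 : R[i] := (dt / h ^+ 2)%:C - (dt / (2 * h))%:C.
pose jk k : R[i] := (h * dt)%:C * (J (grid h k))%:C.
have T0E : T 0 N = \sum_(k < (2 * N).+1) (J (grid h (k%:Z - N%:Z)))%:C.
  by apply: eq_bigr => k _; rewrite /dft_term mulr0 oppr0 expi0 mul1r.
pose s0 x := a1 * w x + (a2 * u 1 x + a3 * u (-1) x).
pose s1 x := \sum_(k < (2 * N).+1) jk (k%:Z - N%:Z) * u (- (k%:Z - N%:Z)) x.
have is0 : cint C s0 by apply: cintD => //; [exact: cintZ|apply: cintD => //; apply: cintZ => //; exact: cint_expw].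
have is1 : cint C s1 by apply: cint_sum => // k; apply: cintZ => //; exact: cint_expw.
have -> : coef h (fun x => ampN dt N x * w x) m = coef h (fun x => s0 x + s1 x) m.
  apply: eq_Cintegral => x _; congr (_ * _).
  rewrite /s1 (_ : \sum_(k < _) _ = (h * dt)%:C * T x N * w x); last first.
    rewrite /T /psumZ -mulrA mulr_suml mulr_sumr; apply: eq_bigr => k _.
    rewrite /jk /u /dft_term (_ : h * (- (k%:Z - N%:Z))%:~R * x = - (h * (k%:Z - N%:Z)%:~R * x)).
      by ring.
    by rewrite rmorphN /=; ring.
  by rewrite /s0 /ampN /a1 /a2 /a3 /Dg /u; ring.
rewrite wcoefD //.
have -> : coef h s0 m = a1 * coef h w m + (a2 * coef h w (m + 1) + a3 * coef h w (m + - 1)).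
  rewrite /s0 wcoefD //; [|exact: cintZ|by apply: cintD => //; apply: cintZ => //; exact: cint_expw].
  rewrite wcoefZ // wcoefD //; [|by apply: cintZ => //; exact: cint_expw..].
  by rewrite !wcoefZ ?coef_expi //; exact: cint_expw.
have -> : coef h s1 m = \sum_(k < (2 * N).+1) jk (k%:Z - N%:Z) * coef h w (m - (k%:Z - N%:Z)).
  rewrite /s1 /coef -/C.
  transitivity (Cintegral C (fun x => \sum_(k < (2 * N).+1)
     jk (k%:Z - N%:Z) * (expi (h * m%:~R * x) * u (- (k%:Z - N%:Z)) x))).
    by apply: eq_Cintegral => x _; rewrite mulr_sumr; apply: eq_bigr => k _; rewrite mulrCA.
  have ieu (k : int) : cint C (fun x => expi (h * m%:~R * x) * u k x).
    by apply: (@cint_expi _ _ _ (fun x => h * m%:~R * x)) => //; [exact: measurable_lin|exact: cint_expw].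
  rewrite Cintegral_sum //; last by move=> k; apply: cintZ.
  apply: eq_bigr => k _; rewrite CintegralZ //; congr (_ * _).
  exact: coef_expi.
rewrite mulrDr [X in _ + X]mulr_sumr.
have -> : \sum_(k < (2 * N).+1) (rt2pi^-1)%:C * (jk (k%:Z - N%:Z) * coef h w (m - (k%:Z - N%:Z))) =
   (h * dt)%:C * psumZ (F m) N + (h * dt)%:C * T 0 N * V m.
  rewrite T0E -mulrA mulr_suml -mulrDr /psumZ -big_split mulr_sumr; apply: eq_bigr => k _.
  by rewrite /jk /F !Vw /=; ring.
rewrite !Vw.
rewrite (_ : (2 * h)%:C^-1 = ((2 * h)^-1)%:C); last by rewrite fmorphV.
rewrite (_ : (h ^+ 2)%:C^-1 = ((h ^+ 2)^-1)%:C); last by rewrite fmorphV.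
by rewrite /a1 /a2 /a3 !(rmorphM _ dt) /=; ring.
Qed.

(** A shift of the grid function is a multiplication by an exponential in
    frequency ([coef_expi]); the convolution with J is a limit of finite
    combinations of shifts, and dominated convergence passes to the limit on both
    sides. *)
Lemma scheme_step_coef : has_coef h (scheme_step J h dt V)
  (fun x => amplification J h dt x * w x).
Proof.
move=> m; rewrite /scheme_step scheme_sum.
have k0 := amp_const_ge0.
have H : ccvg (fun N => coef h (fun x => ampN dt N x * w x) m)
    (coef h (fun x => amplification J h dt x * w x) m).
  apply: (@Cintegral_dct _ C _ _ (fun x => (1 + dt * amp_const) * cmod (w x))) => //.
  - move=> N; apply: cmeasM; first by apply: cmeas_expi; exact: measurable_lin.
    by apply: cmeasM.
  - apply: cmeasM; first by apply: cmeas_expi; exact: measurable_lin.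
    by apply: cmeasM => //; exact: cmeas_amplification.
  - move=> x _; apply: ccvgM; first exact: ccvg_cst.
    by apply: ccvgM; [exact: ampN_cvg|exact: ccvg_cst].
  - by apply: integrableZ_R => //; exact: integrable_cmod.
  - move=> N x _; rewrite !cmodM cmod_expi mul1r ler_wpM2r ?cmod_ge0 //.
    have -> : ampN dt N x = 1 + (ampN dt N x - 1) by ring.
    by rewrite (le_trans (cmodD _ _)) // cmod1 lerD2l ampN_le.
have H' := ccvgM (ccvg_cst (rt2pi^-1)%:C) H.
apply/esym; apply: (ccvg_unique H').
rewrite (_ : (fun N => _) = (fun N => V m - dt%:C * V m
  + dt%:C * ((V (m + 1) - V (m - 1)) / (2 * h)%:C)
  + dt%:C * ((V (m + 1) - 2 * V m + V (m - 1)) / (h ^+ 2)%:C)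
  + (h * dt)%:C * psumZ (F m) N)); last by apply/funext => N; rewrite coef_ampN.
apply: ccvgD; first exact: ccvg_cst.
by apply: ccvgM; [exact: ccvg_cst|exact: zsummable_ccvg].
Qed.

End OneStep.
End Step.
End Kernel.

(** * The error estimate *)

Section Symbol.
Context {R : realType}.
Notation mu := (@lebesgue_measure R).
Variable J : R -> R.
Hypothesis J_cont : continuous J.
Hypothesis H1 : forall x, 0 <= J x.
Hypothesis H2 : (\int[mu]_x (J x)%:E = 1)%E.

Let kint (x : R) : R[i] := Cintegral setT (fun y => expi (- (y * x)) * (J y)%:C).

Let symbolE (x : R) : symbol J x = kint x - kint 0 - 1 - (x ^+ 2)%:C + (0 +i* x).
Proof.
rewrite /symbol /kernel_hat /fourier_int /fourier_on -/rt2pi -/(kint x) -/(kint 0).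
by rewrite -mulrBr mulrA -rmorphM /= divff ?lt0r_neq0 ?rt2pi_gt0 // mul1r.
Qed.

Let iJ : mu.-integrable setT (EFin \o J). Proof. exact: integrable_kernel. Qed.

Let cint_kint x : cint setT (fun y => expi (- (y * x)) * (J y)%:C).
Proof.
apply: (@cint_expi _ _ _ (fun y => - (y * x))) => //.
  by apply: measurableT_comp => //; exact: measurable_funM.
by split => //=; have [] := cint0 (@measurableT _ R).
Qed.

Let cmod_kint x : cmod (kint x) <= 2.
Proof.
apply: (le_trans (cmod_Cintegral measurableT (cint_kint x))).
rewrite -[leRHS]mulr1 ler_pM2l // -(Rintegral_kernel H2).
rewrite le_eqVlt; apply/orP; left; apply/eqP; apply: eq_Rintegral => y _.
by rewrite cmodM cmod_expi mul1r cmodR ger0_norm.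
Qed.

Let Re_kint x : complex.Re (kint x) <= complex.Re (kint 0).
Proof.
rewrite /kint /=; apply: le_Rintegral => //.
- by have [] := cint_kint x.
- by have [] := cint_kint 0.
move=> y _; rewrite -[leLHS]/(complex.Re (expi (- (y * x)) * (J y)%:C)).
rewrite -[leRHS]/(complex.Re (expi (- (y * 0)) * (J y)%:C)).
rewrite !cReM /= !mulr0 !subr0 oppr0 cos0 mul1r.
by rewrite ler_piMl // cos_le1.
Qed.

(** The real part of the transform of J is maximal at 0 since J is nonnegative. *)
Lemma Re_symbol x : complex.Re (symbol J x) <= 0.
Proof.
rewrite symbolE; move: (kint x) (kint 0) (Re_kint x) => a b ab.
by rewrite !cReImE /= addr0; have := sqr_ge0 x; lra.
Qed.

(** 4 for the difference of two transforms of J, 1 for the term -1, and the two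
    powers of the largest frequency pi/h of the cell. *)
Definition symbol_bound (h : R) : R := 5 + (pi / h) ^+ 2 + pi / h.

Lemma symbol_bound_gt0 h : 0 < h -> 0 < symbol_bound h.
Proof.
move=> h0; have p0 := divr_gt0 (pi_gt0 R) h0.
by rewrite /symbol_bound !addr_gt0 // exprn_gt0.
Qed.

Lemma cmod_symbol h x : 0 < h -> freq_cell h x -> cmod (symbol J x) <= symbol_bound h.
Proof.
rewrite /freq_cell /= in_itv /= => h0; rewrite -ler_norml => xh.
rewrite symbolE; apply: (le_trans (cmodD _ _)); apply: lerD; last first.
  by apply: (le_trans (cmod_leD _)); rewrite /= normr0 add0r.
apply: (le_trans (cmodB _ _)); apply: lerD; last first.
  by rewrite cmodR ger0_norm ?sqr_ge0 // -(real_normK (num_real x)) lerXn2r // nnegrE ?divr_ge0 ?pi_ge0 ?ltW.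
apply: (le_trans (cmodB _ _)); rewrite cmod1.
have := cmodB (kint x) (kint 0); have := cmod_kint x; have := cmod_kint 0; lra.
Qed.

End Symbol.

Section Propagation.
Context {R : realType}.
Notation mu := (@lebesgue_measure R).
Variable J : R -> R.
Hypothesis J_cont : continuous J.
Hypothesis H1 : forall x, 0 <= J x.
Hypothesis H2 : (\int[mu]_x (J x)%:E = 1)%E.
Hypothesis H3 : forall x, J x = J (- x).
Hypothesis H4 : forall x y, 0 < x -> x <= y -> J y <= J x.
Variables h dt : R.
Hypotheses (h0 : 0 < h) (dt0 : 0 < dt).
Hypothesis stab : stable J h dt.
Let C : set R := freq_cell h.
Let g : R -> R[i] := amplification J h dt.
Let mC : measurable C. Proof. exact: measurable_cell. Qed.

Lemma stable_cmod x : C x -> cmod (g x) <= 1.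
Proof.
move=> Cx; have := stab (mem_set Cx).
by rewrite norm_cmodE lecR.
Qed.

Let cmeas_gn D n : cmeas D (fun x => g x ^+ n).
Proof. by apply: cmeasX; exact: cmeas_amplification. Qed.

Lemma sqn_gn x n : C x -> sqn (g x ^+ n) <= 1.
Proof.
move=> Cx; rewrite sqnX exprn_ile1 ?sqn_ge0 // -cmod_sqr exprn_ile1 ?cmod_ge0 //.
exact: stable_cmod.
Qed.

Lemma scheme_coef u0 (p : R -> R[i]) n :
  cmeas C p -> (energy C p < +oo)%E -> has_coef h (fun j => u0 (grid h j)) p ->
  [/\ cmeas C (fun x => g x ^+ n * p x),
      (energy C (fun x => g x ^+ n * p x)%R < +oo)%E &
      has_coef h (scheme J h dt u0 n) (fun x => g x ^+ n * p x)].
Proof.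
move=> mp ep Vp.
have mn k : cmeas C (fun x => g x ^+ k * p x) by apply: cmeasM.
have en k : (energy C (fun x => g x ^+ k * p x)%R < +oo)%E.
  apply: le_lt_trans ep; apply: le_energy => // x Cx.
  by rewrite sqnM ler_piMl ?sqn_ge0 // sqn_gn.
split => //; elim: n => [|n IH].
  by move=> m; rewrite /= Vp; congr (_ * _); apply: eq_Cintegral => x _; rewrite mul1r.
move=> m; rewrite /= (scheme_step_coef _ _ _ _ _ h0 (ltW dt0) (mn n) (en n) IH) //.
by congr (_ * _); apply: eq_Cintegral => x _; rewrite exprS -(mulrA (g x)).
Qed.

(** Each of the exact and the discrete one-step factors is compared with 1. *)
Definition step_rate : R := 3 * symbol_bound h + amp_const J h.

Lemma step_rate_gt0 : 0 < step_rate.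
Proof.
have := symbol_bound_gt0 h0; have := amp_const_ge0 H1 h0; rewrite /step_rate; lra.
Qed.

Lemma propagator_error x n : C x ->
  cmod (cexp (symbol J x * (n%:R * dt)%:C) - g x ^+ n) <= n%:R * dt * step_rate.
Proof.
move=> Cx; rewrite mulrC (_ : n%:R * dt = dt * n%:R); last by rewrite mulrC.
rewrite rmorphM /= [_ * symbol _ _]mulrC mulrA cexpMn.
have re : complex.Re (symbol J x * dt%:C) <= 0.
  by rewrite cReM /= mulr0 subr0 mulr_le0_ge0 ?(ltW dt0) // Re_symbol.
have ce : cmod (cexp (symbol J x * dt%:C)) <= 1 by rewrite cmod_cexp -expR0 ler_expR.
apply: (le_trans (cmod_subXn _ ce (stable_cmod Cx))).
rewrite [dt * _]mulrC -mulrA ler_wpM2l //.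
have -> : cexp (symbol J x * dt%:C) - g x = (cexp (symbol J x * dt%:C) - 1) - (g x - 1) by ring.
apply: (le_trans (cmodB _ _)); rewrite /step_rate mulrDr; apply: lerD.
  apply: (le_trans (cmod_cexpB1 re)); rewrite cmodM cmodR gtr0_norm //.
  have := ler_wpM2l (ltW dt0) (cmod_symbol J_cont H1 H2 h0 Cx).
  lra.
exact: (amplification_near1 _ _ _ _ _ h0 x (ltW dt0)).
Qed.

End Propagation.

Section Estimate.
Context {R : realType}.
Notation mu := (@lebesgue_measure R).
Variable J : R -> R.
Hypothesis J_cont : continuous J.
Hypothesis H1 : forall x, 0 <= J x.
Hypothesis H2 : (\int[mu]_x (J x)%:E = 1)%E.
Hypothesis H3 : forall x, J x = J (- x).
Hypothesis H4 : forall x y, 0 < x -> x <= y -> J y <= J x.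
Variables h dt : R.
Hypotheses (h0 : 0 < h) (dt0 : 0 < dt).
Hypothesis stab : stable J h dt.
Variables (s Z0 : R).
Hypotheses (s_gt : 2^-1 < s) (Z00 : 0 < Z0).
Hypothesis zeta : forall N, \sum_(0 <= j < N) (j.+1%:R `^ (- (2 * s))) <= Z0.
Let C : set R := freq_cell h.
Let g : R -> R[i] := amplification J h dt.
Let mC : measurable C. Proof. exact: measurable_cell. Qed.
Let s0 : 0 < s. Proof. by apply: lt_trans s_gt; rewrite invr_gt0. Qed.

Let pi_ge1 : 1 <= pi :> R. Proof. by have := pi_ge2 R; lra. Qed.

Let hs : (h `^ s) ^+ 2 = h `^ (2 * s).
Proof. by rewrite -powR_mulrn ?powR_ge0 // -powRrM mulrC. Qed.

(** Since pi >= 1, the factor (h / pi)^(2 s) is at most the square of h^s. *)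
Lemma alias_const_le : alias_const h s Z0 <= (h `^ s) ^+ 2 * (2 * Z0).
Proof.
rewrite /alias_const hs ler_wpM2r ?mulr_ge0 ?(ltW Z00) //.
apply: ge0_ler_powR; rewrite ?nnegrE ?mulr_ge0 ?divr_ge0 ?(ltW h0) ?(ltW s0) ?invr_ge0 ?pi_ge0 //.
by rewrite ler_pdivrMr ?pi_gt0 // ler_peMr // ltW.
Qed.

Lemma high_freq x : ~ C x -> 1 <= (h `^ s) ^+ 2 * sob_weight s x.
Proof.
move=> Cx; have xh : pi / h < `|x|.
  by rewrite ltNge; apply/negP; rewrite ler_norml => xh; apply: Cx; rewrite /C /freq_cell /= in_itv.
have h2 : (h `^ s) ^+ 2 = (h ^+ 2) `^ s.
  by rewrite hs -(powR_mulrn _ (ltW h0)) -powRrM.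
rewrite h2 /sob_weight -powRM ?exprn_ge0 ?(ltW h0) ?addr_ge0 ?sqr_ge0 //.
rewrite [leLHS](_ : 1 = 1 `^ s); last by rewrite powR1.
have key : 1 <= h ^+ 2 * (1 + x ^+ 2).
  have e : 1 <= h * `|x|.
    by rewrite (le_trans pi_ge1) // mulrC -ler_pdivrMr // ltW.
  have : 1 <= (h * `|x|) ^+ 2 by rewrite exprn_ege1.
  rewrite exprMn real_normK ?num_real // => e2.
  by rewrite mulrDr mulr1 (le_trans e2) // lerDr sqr_ge0.
by apply: ge0_ler_powR; rewrite ?nnegrE ?(ltW s0) // (le_trans _ key).
Qed.

Variables (u0 ut w : R -> R[i]) (n : nat).
Hypothesis u0_Re : continuous (fun x => complex.Re (u0 x)).
Hypothesis u0_Im : continuous (fun x => complex.Im (u0 x)).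
Hypothesis Fw : is_fourier u0 w.
Let E x := cexp (symbol J x * (n%:R * dt)%:C) * w x.
Hypothesis FE : is_fourier ut E.
Hypothesis fw : (sob_sq s w < +oo)%E.

Let p : R -> R[i] := aliased h s w.
Let phi x := g x ^+ n * p x.
Let T : R := n%:R * dt * step_rate J h.

Let mw : cmeas setT w. Proof. by have [] := is_fourier_meas Fw. Qed.
Let ew : (energy setT w < +oo)%E. Proof. by have [] := is_fourier_meas Fw. Qed.
Let mE : cmeas setT E. Proof. by have [] := is_fourier_meas FE. Qed.
Let mp : cmeas C p. Proof. exact: (cmeas_aliased h0 s_gt Z00 zeta). Qed.
Let mwC : cmeas C w. Proof. exact: cmeasS mw. Qed.
Let mgn D : cmeas D (fun x => g x ^+ n).
Proof. by apply: cmeasX; exact: cmeas_amplification. Qed.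

Let initial_coef : has_coef h (fun j => u0 (grid h j)) p.
Proof.
move=> m; rewrite (fourier_inversion Fw) //; last exact: (sobolev_cint h0 s_gt Z00 zeta).
congr (_ * _); rewrite /p (coef_aliased h0 s_gt Z00 zeta) //.
by apply: eq_Cintegral => x _; rewrite /grid [h * _]mulrC.
Qed.

Let ep : (energy C p < +oo)%E.
Proof. exact: (energy_aliased_lty h0 s_gt Z00 zeta). Qed.

Let T0 : 0 <= T.
Proof. by rewrite /T !mulr_ge0 ?(ltW dt0) // ltW // step_rate_gt0. Qed.

Let sob0 : (0 <= sob_sq s w)%E.
Proof. by apply: integral_ge0 => x _; rewrite lee_fin mulr_ge0 ?sqn_ge0 ?powR_ge0. Qed.

(* On the cell: the propagator error acts on w, the aliasing error is propagated
   by a contraction. *)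
Let low_error : (energy C (fun x => E x - phi x)%R <=
  (2 * T ^+ 2)%:E * energy setT w + (4 * Z0 * (h `^ s) ^+ 2)%:E * sob_sq s w)%E.
Proof.
have mf1 : cmeas C (fun x => E x - g x ^+ n * w x).
  by apply: cmeasB; [exact: cmeasS mE|exact: cmeasM].
have mpw : cmeas C (fun x => p x - w x) by exact: cmeasB.
have mf2 : cmeas C (fun x => g x ^+ n * (p x - w x)) by exact: cmeasM.
rewrite (_ : energy C _ = energy C (fun x => (E x - g x ^+ n * w x) - g x ^+ n * (p x - w x))); last first.
  by apply: eq_energy => x _; rewrite /phi; ring.
apply: (le_trans (energyB_le mC mf1 mf2)).
have e1 : (energy C (fun x => E x - g x ^+ n * w x)%R <= (T ^+ 2)%:E * energy setT w)%E.
  apply: (@le_trans _ _ (energy C (fun x => T%:C * w x)%R)).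
    apply: le_energy => //; first by apply: cmeasM => //; exact: cmeas_cst.
    move=> x Cx; rewrite /E -mulrBl !sqnM ler_wpM2r ?sqn_ge0 // sqnR -cmod_sqr.
    by apply: lerXn2r; rewrite ?nnegrE ?cmod_ge0 //; exact: propagator_error.
  rewrite energyZ // sqnR; apply: lee_wpmul2l; first by rewrite lee_fin sqr_ge0.
  exact: subset_energy.
have e2 : (energy C (fun x => g x ^+ n * (p x - w x))%R <=
    (2 * Z0 * (h `^ s) ^+ 2)%:E * sob_sq s w)%E.
  apply: (@le_trans _ _ (energy C (fun x => p x - w x)%R)).
    by apply: le_energy => // x Cx; rewrite sqnM ler_piMl ?sqn_ge0 // sqn_gn.
  apply: (le_trans (energy_aliased h0 s_gt Z00 zeta mw)).
  apply: lee_wpmul2r => //; rewrite lee_fin mulrC; exact: alias_const_le.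
apply: (le_trans (leeD (lee_wpmul2l _ e1) (lee_wpmul2l _ e2))) => //.
by rewrite !muleA -!EFinM (_ : 2 * (2 * Z0 * (h `^ s) ^+ 2) = 4 * Z0 * (h `^ s) ^+ 2) //; ring.
Qed.

(* Off the cell the interpolant has no frequencies. *)
Let high_error : (energy (~` C) E <= ((h `^ s) ^+ 2)%:E * sob_sq s w)%E.
Proof.
have mCC : measurable (~` C) by exact: measurableC.
have msw : measurable_fun setT (fun x => (sob_weight s x * sqn (w x))%:E).
  apply/measurable_EFinP; apply: measurable_funM; last exact: measurable_sqn.
  exact: measurable_weight.
have sw0 x : (0 <= (sob_weight s x * sqn (w x))%:E)%E.
  by rewrite lee_fin mulr_ge0 ?sqn_ge0 ?powR_ge0.
rewrite /sob_sq -ge0_integralZl_EFin ?sqr_ge0 //.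
apply: (@le_trans _ _ (\int[mu]_(x in ~` C) (((h `^ s) ^+ 2)%:E * (sob_weight s x * sqn (w x))%:E))%E).
  apply: ge0_le_integral => //.
  - by move=> x _; rewrite lee_fin sqn_ge0.
  - by apply: measurable_esqn; exact: cmeasS mE.
  - by apply: measurable_funeM; exact: measurable_funTS.
  - move=> x Cx; rewrite -EFinM lee_fin mulrA.
    apply: (@le_trans _ _ (1 * sqn (w x))); last first.
      by rewrite ler_wpM2r ?sqn_ge0 // high_freq.
    rewrite /E sqnM ler_wpM2r ?sqn_ge0 // -cmod_sqr exprn_ile1 ?cmod_ge0 //.
    rewrite cmod_cexp -expR0 ler_expR cReM /= mulr0 subr0.
    by rewrite mulr_le0_ge0 ?Re_symbol ?mulr_ge0 // ltW.
apply: ge0_subset_integral => //; first exact: measurable_funeM.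
by move=> x _; rewrite mule_ge0 // lee_fin sqr_ge0.
Qed.

(** The factor 4 of [is_fourier_inv], the factors 2 of the parallelogram inequality
    and of [is_fourier_le] combine into 16 T^2 = (4 T)^2 and 16 Z0 + 4. *)
Lemma energy_error :
  (energy setT (fun x => ut x - interpolant h (scheme J h dt u0 n) x)%R <=
   ((4 * T) ^+ 2)%:E * energy setT u0 +
   ((Num.sqrt (16 * Z0 + 4) * h `^ s) ^+ 2)%:E * sob_sq s w)%E.
Proof.
have [mphi ephi cphi] := scheme_coef J_cont H1 H2 H3 H4 h0 dt0 stab n mp ep initial_coef.
have dphi := is_dft_coef h0 mphi ephi cphi.
rewrite (_ : energy setT _ = energy setT (fun x => ut x - inv_on h phi x)); last first.
  by apply: eq_energy => x _; rewrite (interpolantE x dphi).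
apply: (le_trans (is_fourier_inv FE h0 mphi ephi)).
have mcut : cmeas setT (cutoff C phi) by exact: cmeas_cut.
have CT : C `|` ~` C = setT by exact: setUv.
have -> : energy setT (fun x => E x - cutoff C phi x) =
    (energy C (fun x => E x - cutoff C phi x)%R + energy (~` C) (fun x => E x - cutoff C phi x)%R)%E.
  rewrite -energy_setU ?CT //; [exact: measurableC|by apply/disj_set2P; rewrite setICr|exact: cmeasB].
have -> : energy C (fun x => E x - cutoff C phi x) = energy C (fun x => E x - phi x).
  by apply: eq_energy => x Cx; rewrite /cutoff mem_set.
have -> : energy (~` C) (fun x => E x - cutoff C phi x) = energy (~` C) E.
  by apply: eq_energy => x Cx; rewrite /cutoff memNset // subr0.
apply: (le_trans (lee_wpmul2l _ (leeD low_error high_error))) => //.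
have ew2 := is_fourier_le Fw.
apply: (@le_trans _ _ (4 * ((2 * T ^+ 2)%:E * (2 * energy setT u0) +
   (4 * Z0 * (h `^ s) ^+ 2)%:E * sob_sq s w + ((h `^ s) ^+ 2)%:E * sob_sq s w))%E).
  apply: lee_wpmul2l => //; apply: leeD => //; apply: leeD => //.
  by apply: lee_wpmul2l => //; rewrite lee_fin mulr_ge0 ?sqr_ge0.
have [_ eu0 _ _] := is_fourier_meas Fw.
have u00 : (0 <= energy setT u0)%E by exact: energy_ge0.
rewrite -(fineK (_ : energy setT u0 \is a fin_num)) ?ge0_fin_numE //.
rewrite -(fineK (_ : sob_sq s w \is a fin_num)) ?ge0_fin_numE //.
rewrite -!EFinM -?EFinD -?EFinM -?EFinD lee_fin !exprMn sqr_sqrtr; last by rewrite addr_ge0 ?mulr_ge0 ?ltW.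
by rewrite le_eqVlt; apply/orP; left; apply/eqP; ring.
Qed.

End Estimate.

Lemma sqrt_energy_le {R : realType} (x y z : \bar R) (a b : R) :
  (0 <= x)%E -> (0 <= y < +oo)%E -> (0 <= z < +oo)%E -> 0 <= a -> 0 <= b ->
  (x <= (a ^+ 2)%:E * y + (b ^+ 2)%:E * z)%E ->
  (x `^ 2^-1 <= a%:E * y `^ 2^-1 + b%:E * z `^ 2^-1)%E.
Proof.
move=> x0 /andP[y0 yoo] /andP[z0 zoo] a0 b0.
rewrite -(fineK (_ : y \is a fin_num)) ?ge0_fin_numE //.
rewrite -(fineK (_ : z \is a fin_num)) ?ge0_fin_numE //.
move: (fine_ge0 y0) (fine_ge0 z0); move: (fine y) (fine z) => r t r0 t0 xle.
have xoo : (x < +oo)%E by apply: le_lt_trans xle _; rewrite -!EFinM -EFinD ltry.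
move: xle; rewrite -(fineK (_ : x \is a fin_num)) ?ge0_fin_numE //.
move: (fine_ge0 x0); move: (fine x) => q q0.
rewrite -!EFinM -?EFinD !poweR_EFin -?EFinM -?EFinD !lee_fin !powR12_sqrt // => qle.
rewrite -(@ler_pXn2r _ 2) ?nnegrE ?addr_ge0 ?mulr_ge0 ?sqrtr_ge0 //.
rewrite sqr_sqrtr // (le_trans qle) // sqrrD !exprMn !sqr_sqrtr //.
have := mulr_ge0 (mulr_ge0 a0 (sqrtr_ge0 r)) (mulr_ge0 b0 (sqrtr_ge0 t)).
rewrite -mulr_natr; lra.
Qed.

Lemma sobolev_normE {R : realType} (s : R) (v : R -> R[i]) :
  sobolev_norm s v = (sob_sq s (fourier v) `^ 2^-1)%E.
Proof.
rewrite /sobolev_norm /weighted_norm; congr (_ `^ _)%E.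
by apply: eq_integral => x _; rewrite cmod_sqr.
Qed.

Lemma fourierP {R : realType} (s : R) (v : R -> R[i]) : in_sobolev s v ->
  is_fourier v (fourier v).
Proof. by move=> [w Fw _]; rewrite /fourier; case: xgetP => [y -> //|/(_ w)]; case. Qed.

Theorem theorem3 (R : realType) (J : R -> R)
  (J_L2 : J \in Lfun lebesgue_measure 2%:E)
  (J_cont : continuous J)
  (H1 : forall x, 0 <= J x)
  (H2 : (\int[lebesgue_measure]_x (J x)%:E = 1)%E)
  (H3 : forall x, J x = J (- x))
  (H4 : forall x y, 0 < x -> x <= y -> J y <= J x)
  (H5 : forall xi, 0 <= kernel_hat J xi)
  (H6 : forall xi, 0 <= xi ->
     derivable (fun z : R => complex.Re (kernel_hat J z)) xi 1 /\
     derive1 (fun z : R => complex.Re (kernel_hat J z)) xi <= 0) :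
  exists (C1 : R -> R) (C2 : R) (C3 : R -> R),
    [/\ forall h, 0 < h -> 0 < C1 h,
        0 < C2,
        forall sigma, 2^-1 < sigma -> 0 < C3 sigma &
        forall (h dt : R), 0 < h -> 0 < dt -> stable J h dt ->
        forall (sigma : R), 2^-1 < sigma ->
        forall (u0 : R -> R[i]),
          continuous (fun x => complex.Re (u0 x)) ->
          continuous (fun x => complex.Im (u0 x)) ->
          in_sobolev sigma u0 ->
        forall (u : R -> R -> R[i]), exact_solution J u0 u ->
        forall n : nat,
          (L2norm setT
             (fun x => (u x (n%:R * dt) - interpolant h (scheme J h dt u0 n) x)%R)
           <= (n%:R * dt * C1 h)%:E * L2norm setT u0
              + (C2 * h)%:E * sobolev_norm 2 u0
              + (C3 sigma * h `^ sigma)%:E * sobolev_norm sigma u0)%E].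
Proof.
(* C3 depends on sigma through a bound of zeta (2 sigma), chosen once for all. *)
have [Z HZ] : {Z : R -> R & forall s, 0 < Z s /\ (2^-1 < s ->
    forall N, \sum_(0 <= j < N) j.+1%:R `^ (- (2 * s)) <= Z s)}.
  apply: (@choice _ _ (fun s Z => 0 < Z /\ (2^-1 < s ->
    forall N, \sum_(0 <= j < N) j.+1%:R `^ (- (2 * s)) <= Z))) => s.
  have [s_le|s_gt] := leP s 2^-1; first by exists 1.
  have [|Z Z0 HZ] := @zeta_bound _ (2 * s); last by exists Z.
  by rewrite -ltr_pdivrMl // mulr1.
have Z0 s := (HZ s).1; have zeta s := (HZ s).2.
exists (fun h => 4 * step_rate J h), 1,
  (fun s => Num.sqrt (16 * Z s + 4)); split => //.
- by move=> h h0; rewrite mulr_gt0 ?step_rate_gt0.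
- by move=> s _; rewrite sqrtr_gt0 addr_gt0 ?mulr_gt0.
move=> h dt h0 dt0 stab s s_gt u0 u0_Re u0_Im u0_s u u_ex n; cbv beta.
have Fw := fourierP u0_s.
have [mu0 eu0 mw ew] := is_fourier_meas Fw.
have t0 : 0 <= n%:R * dt by rewrite mulr_ge0 // ltW.
have r0 : 0 < step_rate J h by exact: step_rate_gt0.
have c0 : 0 < Num.sqrt (16 * Z s + 4) by rewrite sqrtr_gt0 addr_gt0 ?mulr_gt0.
have hs0 : 0 < h `^ s by rewrite powR_gt0.
have sob0 : (0 <= sob_sq s (fourier u0))%E.
  by apply: integral_ge0 => x _; rewrite lee_fin mulr_ge0 ?sqn_ge0 ?powR_ge0.
rewrite energyE // energyE // !sobolev_normE.
have mid : (0 <= (1 * h)%:E * (sob_sq 2 (fourier u0) `^ 2^-1))%E.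
  by rewrite mule_ge0 ?poweR_ge0 // lee_fin mul1r ltW.
have fst : (0 <= (n%:R * dt * (4 * step_rate J h))%:E * energy setT u0 `^ 2^-1)%E.
  by rewrite mule_ge0 ?poweR_ge0 // lee_fin !mulr_ge0 // ltW.
have [fw|] := ltP (sob_sq s (fourier u0)) +oo%E; last first.
  rewrite leye_eq => /eqP ->; rewrite poweRyr ?invr_eq0 // mulry gtr0_sg ?mulr_gt0 // mul1e.
  rewrite addey ?leey //; rewrite -ltNye.
  by apply: (lt_le_trans _ (adde_ge0 fst mid)); rewrite ltNyr.
have FE := u_ex _ t0.
have H := energy_error J_cont H1 H2 H3 H4 h0 dt0 stab s_gt (Z0 s) (zeta s s_gt) u0_Re u0_Im Fw FE fw.
apply: (@le_trans _ _ ((n%:R * dt * (4 * step_rate J h))%:E * energy setT u0 `^ 2^-1 +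
  (Num.sqrt (16 * Z s + 4) * h `^ s)%:E * sob_sq s (fourier u0) `^ 2^-1)%E); last first.
  by apply: leeD => //; rewrite leeDl.
apply: sqrt_energy_le; rewrite ?energy_ge0 ?sob0 //.
- by rewrite !mulr_ge0 // ltW.
- by rewrite mulr_ge0 // ltW.
by rewrite (_ : n%:R * dt * (4 * step_rate J h) = 4 * (n%:R * dt * step_rate J h)) //; ring.
Qed.
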